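(* Let $\mathbf K$ be a 2-category which admits the construction of vector fields, and assume that for each tangentad $(\mathbb X,\mathbb T)$ of $\mathbf K$ and each positive integer $n$ the $n$-fold 2-pullback $\mathrm{VF}_n(\mathbb X,\mathbb T)$ of $U:\mathrm{VF}(\mathbb X,\mathbb T)\to(\mathbb X,\mathbb T)$ along itself exists in $\mathbf K$. For each tangentad $(\mathbb X,\mathbb T)$ which admits negatives, the abelian group bundle $(U:\mathrm{VF}(\mathbb X,\mathbb T)\to(\mathbb X,\mathbb T),0,+,-)$ in $\mathsf{Tng}_=(\mathbf K)$ comes with a Lie bracket $[\,,]:\mathrm{VF}_2(\mathbb X,\mathbb T)\to\mathrm{VF}(\mathbb X,\mathbb T)$, namely the tangent morphism corresponding to the Lie bracket $[\mathbf v_1,\mathbf v_2]$ described in the context, which makes $U$ into a Lie algebra bundle in $\mathsf{Tng}_=(\mathbf K)$.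
   Context: Let $\mathbf K$ be a 2-category. For a 2-morphism $\varphi$ and a 1-morphism $H$, write $H\varphi$ and $\varphi_H$ for the whiskerings (post- and precomposition with $H$). A pullback in $\mathbf K(\mathbb X,\mathbb Y)$ is pointwise if it is preserved by $\mathbf K(F,\mathbb Y)$ for every 1-morphism $F:\mathbb X'\to\mathbb X$. Tangentad: a tangentad $(\mathbb X,\mathbb T)$ in $\mathbf K$ is an object $\mathbb X$ with a tangent structure $\mathbb T=(T,p,z,s,l,c)$: a 1-morphism $T:\mathbb X\to\mathbb X$ and 2-morphisms $p:T\Rightarrow\mathrm{id}$, $z:\mathrm{id}\Rightarrow T$, $s:T_2\Rightarrow T$, $l:T\Rightarrow T^2$, $c:T^2\Rightarrow T^2$ such that: (1) for each $n\ge1$ the $n$-fold pullback $T_n$ of $p$ along itself (projections $\pi_k:T_n\Rightarrow T$) exists in $\mathbf K(\mathbb X,\mathbb X)$, is pointwise, and is preserved by postcomposition with all iterates $T^m$; (2) $pz=\mathrm{id}$, $ps=p\pi_1$, and $s$ is associative, commutative and unital with unit $z$; (3) $Tp\circ l=z\circ p$, $l\circ z=Tz\circ z$, $l\circ s=Ts\circ\langle l\pi_1,l\pi_2\rangle$; (4) $p_T\circ c=Tp$, $c\circ Tz=z_T$, $c\circ Ts=s_T\circ\langle c\circ T\pi_1,c\circ T\pi_2\rangle$; (5) $Tl\circ l=l_T\circ l$, $c\circ l=l$, $c_T\circ Tc\circ l_T=Tl\circ c$, $c\circ c=\mathrm{id}$, $Tc\circ c_T\circ Tc=c_T\circ Tc\circ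 c_T$; (6) the square with top $Ts\circ\langle l\pi_1,z_T\pi_2\rangle:T_2\Rightarrow T^2$, left side $p\pi_1:T_2\Rightarrow\mathrm{id}$, right side $Tp:T^2\Rightarrow T$ and bottom $z:\mathrm{id}\Rightarrow T$ is a pointwise pullback. It admits negatives if it is equipped with a 2-morphism $n:T\Rightarrow T$ with $s\circ\langle n,\mathrm{id}_T\rangle=z\circ p$. A tangent category (with negatives) is a tangentad (with negatives) in the 2-category $\mathsf{Cat}$. Morphisms: a lax tangent morphism $(F,\alpha):(\mathbb X,\mathbb T)\to(\mathbb X',\mathbb T')$ is a 1-morphism $F:\mathbb X\to\mathbb X'$ with a 2-morphism $\alpha:F\circ T\Rightarrow T'\circ F$ such that $p'_F\circ\alpha=Fp$, $\alpha\circ Fz=z'_F$, $\alpha\circ Fs=s'_F\circ\langle\alpha\circ F\pi_1,\alpha\circ F\pi_2\rangle$, $l'_F\circ\alpha=T'\alpha\circ\alpha_T\circ Fl$, $c'_F\circ T'\alpha\circ\alpha_T=T'\alpha\circ\alpha_T\circ Fc$. It is strong if $\alpha$ is invertible, strict if $\alpha$ is an identity. A tangent 2-morphism $\varphi:(F,\alpha)\Rightarrow(G,\beta)$ is a 2-morphism $\varphi:F\Rightarrow G$ with $T'\varphi\circ\alpha=\beta\circ\varphi_T$. $\mathsf{Tng}(\mathbf K)$ (resp. $\mathsf{Tng}_=(\mathbf K)$) is the 2-category of tangentads of $\mathbf K$, lax (resp. strict) tangent morphisms and tangent 2-morphisms. Hom-tangent category: $[\mathbb X',\mathbb T'\mid\mathbb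 X,\mathbb T]$ is the category $\mathsf{Tng}(\mathbf K)((\mathbb X',\mathbb T'),(\mathbb X,\mathbb T))$ with the pointwise tangent structure: $\bar T(F,\alpha)=(T,c)\circ(F,\alpha)=(T\circ F,c_F\circ T\alpha)$, $\bar T\varphi=T\varphi$, structural transformations $p_F,z_F,s_F,l_F,c_F$ (and negation $n_F$ if $(\mathbb X,\mathbb T)$ has negatives). Vector fields: a vector field on an object $M$ of a tangent category is $v:M\to TM$ with $p_M\circ v=\mathrm{id}_M$. The sum is $u+v=s\circ\langle u,v\rangle$ and, with negatives, $-v=n\circ v$. In a tangent category with negatives the Lie bracket of vector fields $u,v$ on $M$ is $[u,v]=\{Tv\circ u-c\circ Tu\circ v\}$, where for $f,g:X\to T^2M$ (with $p_Tf=p_Tg$) $f-g=s_T\circ\langle f,n_T\circ g\rangle$, and for $h:X\to T^2M$ with $Tp\circ h=z\circ p\circ p_T\circ h$, $\{h\}:X\to TM$ is the unique morphism with $p\circ\{h\}=p\circ p_T\circ h$ and $Ts\circ\langle l\circ\{h\},z_T\circ p_T\circ h\rangle=h$ (it exists by the pullback (6)). For a tangent category $(\mathbb Y,\mathbb T)$, $\mathrm{VF}(\mathbb Y,\mathbb T)$ is the tangent category of pairs $(M,v)$, $v$ a vector field on $M$; morphisms $f:(M,v)\to(N,u)$ are $f:M\to N$ with $Tf\circ v=u\circ f$; tangent bundle functor $(M,v)\mapsto(TM,c_M\circ Tv)$, $f\mapsto Tf$; structural transformations as in $(\mathbb Y,\mathbb T)$. $\mathrm{VF}[\mathbb X',\mathbb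 T'\mid\mathbb X,\mathbb T]$ is this construction applied to the Hom-tangent category. Construction of vector fields: for a strict tangent morphism $U:(\mathbb V,\mathbb T^{\mathbb V})\to(\mathbb X,\mathbb T)$ and a vector field $\mathbf v:U\Rightarrow\bar TU$ on $U$ in $[\mathbb V,\mathbb T^{\mathbb V}\mid\mathbb X,\mathbb T]$, for each tangentad $(\mathbb X',\mathbb T')$ let $\Gamma_{\mathbf v}:[\mathbb X',\mathbb T'\mid\mathbb V,\mathbb T^{\mathbb V}]\to\mathrm{VF}[\mathbb X',\mathbb T'\mid\mathbb X,\mathbb T]$ be the strict tangent morphism $(H,\gamma)\mapsto(U\circ(H,\gamma),\mathbf v_H)$, $\varphi\mapsto U\varphi$. A tangentad $(\mathbb X,\mathbb T)$ admits the construction of vector fields if there are a tangentad $\mathrm{VF}(\mathbb X,\mathbb T)$ (the tangentad of vector fields), a strict tangent morphism $U:\mathrm{VF}(\mathbb X,\mathbb T)\to(\mathbb X,\mathbb T)$ and a vector field $\mathbf v$ on $U$ in $[\mathrm{VF}(\mathbb X,\mathbb T)\mid\mathbb X,\mathbb T]$ (the universal vector field) such that $\Gamma_{\mathbf v}$ is invertible for every $(\mathbb X',\mathbb T')$. $\mathbf K$ admits the construction of vector fields if every tangentad of $\mathbf K$ does. The 2-pullbacks $\mathrm{VF}_n(\mathbb X,\mathbb T)$ carry an induced tangent structure making them $n$-fold 2-pullbacks in $\mathsf{Tng}(\mathbf K)$ with strict projections $\pi_k:\mathrm{VF}_n(\mathbb X,\mathbb T)\to\mathrm{VF}(\mathbb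 X,\mathbb T)$. Write $\mathbf v_k=\mathbf v_{\pi_k}=\Gamma_{\mathbf v}(\pi_k)$. Under $\Gamma_{\mathbf v}$: $0:(\mathbb X,\mathbb T)\to\mathrm{VF}(\mathbb X,\mathbb T)$ corresponds to the vector field $z$ on $\mathrm{id}_{(\mathbb X,\mathbb T)}$; $+:\mathrm{VF}_2(\mathbb X,\mathbb T)\to\mathrm{VF}(\mathbb X,\mathbb T)$ corresponds to $\mathbf v_1+\mathbf v_2$; $-:\mathrm{VF}(\mathbb X,\mathbb T)\to\mathrm{VF}(\mathbb X,\mathbb T)$ corresponds to $-\mathbf v$; and $[\,,]:\mathrm{VF}_2(\mathbb X,\mathbb T)\to\mathrm{VF}(\mathbb X,\mathbb T)$ corresponds to the Lie bracket $[\mathbf v_1,\mathbf v_2]$ of the vector fields $\mathbf v_1,\mathbf v_2$ on $U\circ\pi_1=U\circ\pi_2$ in $[\mathrm{VF}_2(\mathbb X,\mathbb T)\mid\mathbb X,\mathbb T]$. All these tangent morphisms are strict. Bundles: in a category, an additive bundle consists of morphisms $q:E\to B$, $z_q:B\to E$, $s_q:E_2\to E$ such that all $n$-fold pullbacks $E_n$ of $q$ along itself exist, $q z_q=\mathrm{id}_B$, $q s_q=q\pi_1$, and $s_q$ is associative, commutative and unital with unit $z_q$. It is an abelian group bundle if equipped with $-:E\to E$ with $s_q\circ\langle-,\mathrm{id}_E\rangle=z_q\circ q$. A Lie algebra bundle is an additive bundle with a morphism $[\,,]_q:E_2\to E$ over $B$ such that, writing $+_q$ for $s_q$ and $0_q$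 for $z_q$ (for generalized elements $x,y,w$ of $E$ over the same element of $B$): $[x+_qy,w]_q=[x,w]_q+_q[y,w]_q$, $[0_q,x]_q=0_q$, $[x,y]_q+_q[y,x]_q=0_q$, and $[[x,y]_q,w]_q+_q[[w,x]_q,y]_q+_q[[y,w]_q,x]_q=0_q$. *)

(* Defs.v *)
From mathcomp Require Import all_boot boolp.

Set Implicit Arguments.
Unset Strict Implicit.
Unset Printing Implicit Defensive.

(* A category is given by its objects, its arrows, and the source and target *)
(* of each arrow.  Composition is total, but constrained only on composable  *)
(* pairs.  With this presentation of the hom-categories, the laws of a       *)
(* strict 2-category are plain equations: no transport along equations       *)
(* between 1-cells is needed, and one can say literally that a 2-cell is an  *)
(* identity.                                                                 *)
Record category := Category {
  ob : Type;
  arr : Type;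
  dom : arr -> ob;
  cod : arr -> ob;
  idt : ob -> arr;
  cmp : arr -> arr -> arr;
  dom_idt : forall A, dom (idt A) = A;
  cod_idt : forall A, cod (idt A) = A;
  dom_cmp : forall g f, cod f = dom g -> dom (cmp g f) = dom f;
  cod_cmp : forall g f, cod f = dom g -> cod (cmp g f) = cod g;
  cmp_idl : forall f, cmp (idt (cod f)) f = f;
  cmp_idr : forall f, cmp f (idt (dom f)) = f;
  cmpA : forall h g f, cod f = dom g -> cod g = dom h ->
    cmp h (cmp g f) = cmp (cmp h g) f
}.
Arguments dom {_}. Arguments cod {_}. Arguments idt {_}. Arguments cmp {_}.

Notation "g \v f" := (cmp g f) (at level 43, right associativity).

Definition arrow (C : category) (f : arr C) (A B : ob C) : Prop :=
  dom f = A /\ cod f = B.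

Record functor (C D : category) := Functor {
  fob : ob C -> ob D;
  farr : arr C -> arr D;
  dom_farr : forall f, dom (farr f) = fob (dom f);
  cod_farr : forall f, cod (farr f) = fob (cod f);
  farr_idt : forall A, farr (idt A) = idt (fob A);
  farr_cmp : forall g f, cod f = dom g -> farr (g \v f) = farr g \v farr f
}.

Definition invertible_functor (C D : category) (F : functor C D) : Prop :=
  exists G : functor D C,
    [/\ cancel (fob F) (fob G), cancel (fob G) (fob F),
        cancel (farr F) (farr G) & cancel (farr G) (farr F)].

(* E with projections pr is the n-fold pullback of q along itself (n > 0).   *)
Definition is_nfold_pullback (C : category) (q : arr C) (n : nat) (E : ob C)
    (pr : 'I_n -> arr C) : Prop :=
  [/\ forall i, arrow (pr i) E (dom q),
      forall i j, q \v pr i = q \v pr j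
    & forall (A : ob C) (f : 'I_n -> arr C),
        (forall i, arrow (f i) A (dom q)) ->
        (forall i j, q \v f i = q \v f j) ->
        exists! m : arr C, arrow m A E /\ forall i, pr i \v m = f i].

(*      P --a--> A                                                           *)
(*      |b       |f                                                          *)
(*      B --g--> D                                                           *)
Definition is_pullback (C : category) (a b f g : arr C) : Prop :=
  [/\ arrow a (dom b) (dom f), cod b = dom g, cod f = cod g, f \v a = g \v b
    & forall x y : arr C, dom x = dom y -> cod x = dom f -> cod y = dom g ->
        f \v x = g \v y ->
        exists! m : arr C, [/\ arrow m (dom x) (dom b), a \v m = x & b \v m = y]].

(* Used for elements characterized by P; an arbitrary choice otherwise.       *)
Definition the_or (A : Type) (d : A) (P : A -> Prop) : A :=
  if pselect (exists x, P x) is left e then sval (cid e) else d.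

Definition k1 : 'I_2 := ord0.
Definition k2 : 'I_2 := ord_max.

(* The pairing <f,g>: A -> E_2, for projections pr : E_2 -> E.               *)
Definition pair_arr (C : category) (pr : 'I_2 -> arr C) (f g : arr C) : arr C :=
  the_or f (fun m => [/\ arrow m (dom f) (dom (pr k1)),
                         pr k1 \v m = f & pr k2 \v m = g]).

Record two_category := TwoCategory {
  tob :> Type;
  Hom : tob -> tob -> category;
  id1 : forall X, ob (Hom X X);
  comp1 : forall X Y Z, ob (Hom Y Z) -> ob (Hom X Y) -> ob (Hom X Z);
  hcmp : forall X Y Z, arr (Hom Y Z) -> arr (Hom X Y) -> arr (Hom X Z);
  comp1A : forall X Y Z W (H : ob (Hom Z W)) (G : ob (Hom Y Z))
    (F : ob (Hom X Y)), comp1 H (comp1 G F) = comp1 (comp1 H G) F;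
  comp1_idl : forall X Y (F : ob (Hom X Y)), comp1 (id1 Y) F = F;
  comp1_idr : forall X Y (F : ob (Hom X Y)), comp1 F (id1 X) = F;
  dom_hcmp : forall X Y Z (b : arr (Hom Y Z)) (a : arr (Hom X Y)),
    dom (hcmp b a) = comp1 (dom b) (dom a);
  cod_hcmp : forall X Y Z (b : arr (Hom Y Z)) (a : arr (Hom X Y)),
    cod (hcmp b a) = comp1 (cod b) (cod a);
  hcmp_idt : forall X Y Z (G : ob (Hom Y Z)) (F : ob (Hom X Y)),
    hcmp (idt G) (idt F) = idt (comp1 G F);
  interchange : forall X Y Z (b b' : arr (Hom Y Z)) (a a' : arr (Hom X Y)),
    cod b = dom b' -> cod a = dom a' ->
    hcmp (b' \v b) (a' \v a) = hcmp b' a' \v hcmp b a;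
  hcmpA : forall X Y Z W (d : arr (Hom Z W)) (b : arr (Hom Y Z))
    (a : arr (Hom X Y)), hcmp d (hcmp b a) = hcmp (hcmp d b) a;
  hcmp_idl : forall X Y (a : arr (Hom X Y)), hcmp (idt (id1 Y)) a = a;
  hcmp_idr : forall X Y (a : arr (Hom X Y)), hcmp a (idt (id1 X)) = a
}.
Arguments Hom {_}. Arguments id1 {_}. Arguments comp1 {_ _ _ _}.
Arguments hcmp {_ _ _ _}.

Notation "G \c F" := (comp1 G F) (at level 39, left associativity).
Notation "b \h a" := (hcmp b a) (at level 39, left associativity).
Notation "G \wl a" := (hcmp (idt G) a) (at level 39, left associativity).
Notation "a \wr F" := (hcmp a (idt F)) (at level 39, left associativity).

(* P with projections pr is the n-fold 2-pullback of U along itself (n > 0): *)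
(* each K(Y,P) is the n-fold strict pullback of K(Y,U) along itself.         *)
Definition is_nfold_2pullback (K : two_category) (V X : K) (U : ob (Hom V X))
    (n : nat) (P : K) (pr : 'I_n -> ob (Hom P V)) : Prop :=
  [/\ forall i j, U \c pr i = U \c pr j,
      forall (Y : K) (f : 'I_n -> ob (Hom Y V)),
        (forall i j, U \c f i = U \c f j) ->
        exists! g : ob (Hom Y P), forall i, pr i \c g = f i
    & forall (Y : K) (a : 'I_n -> arr (Hom Y V)),
        (forall i j, U \wl a i = U \wl a j) ->
        exists! b : arr (Hom Y P), forall i, pr i \wl b = a i].

Record nfold_2pullback (K : two_category) (V X : K) (U : ob (Hom V X))
    (n : nat) := Nfold2Pullback {
  apex : K;
  proj : 'I_n -> ob (Hom apex V);
  projP : is_nfold_2pullback U proj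
}.

Fixpoint pow1 (K : two_category) (X : K) (T : ob (Hom X X)) (m : nat) :
    ob (Hom X X) :=
  if m is m'.+1 then T \c pow1 T m' else id1 X.

(* In Tn_pullback, the composite T^m T_n F is a pullback for all m and F: it *)
(* says that T_n is a pullback (m = 0, F = id), that it is pointwise, and    *)
(* that T^m preserves it as a pointwise pullback.  tTn n and tpi n are       *)
(* unconstrained for n = 0.                                                  *)
Record tangent_structure (K : two_category) (X : K) := TangentStructure {
  tT : ob (Hom X X);
  tp : arr (Hom X X);
  tTn : nat -> ob (Hom X X);
  tpi : forall n, 'I_n -> arr (Hom X X);
  tz : arr (Hom X X);
  ts : arr (Hom X X);
  tl : arr (Hom X X);
  tc : arr (Hom X X);
  tp_arrow : arrow tp tT (id1 X);
  tz_arrow : arrow tz (id1 X) tT;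
  ts_arrow : arrow ts (tTn 2) tT;
  tl_arrow : arrow tl tT (tT \c tT);
  tc_arrow : arrow tc (tT \c tT) (tT \c tT);
  Tn_pullback : forall n : nat, 0 < n ->
    forall (Y : K) (F : ob (Hom Y X)) (m : nat),
      is_nfold_pullback (pow1 tT m \wl tp \wr F) (pow1 tT m \c tTn n \c F)
        (fun i : 'I_n => pow1 tT m \wl tpi i \wr F);
  pz : tp \v tz = idt (id1 X);
  ps : tp \v ts = tp \v tpi k1;
  sA : let q1 := tpi (@Ordinal 3 0 isT) in
       let q2 := tpi (@Ordinal 3 1 isT) in
       let q3 := tpi (@Ordinal 3 2 isT) in
    ts \v pair_arr (@tpi 2) (ts \v pair_arr (@tpi 2) q1 q2) q3 =
    ts \v pair_arr (@tpi 2) q1 (ts \v pair_arr (@tpi 2) q2 q3);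
  sC : ts \v pair_arr (@tpi 2) (tpi k2) (tpi k1) = ts;
  s_unit : ts \v pair_arr (@tpi 2) (tz \v tp) (idt tT) = idt tT;
  lp : (tT \wl tp) \v tl = tz \v tp;
  lz : tl \v tz = (tT \wl tz) \v tz;
  ls : tl \v ts = (tT \wl ts) \v
    pair_arr (fun i => tT \wl @tpi 2 i) (tl \v tpi k1) (tl \v tpi k2);
  cp : (tp \wr tT) \v tc = tT \wl tp;
  cz : tc \v (tT \wl tz) = tz \wr tT;
  cs : tc \v (tT \wl ts) = (ts \wr tT) \v
    pair_arr (fun i => @tpi 2 i \wr tT)
      (tc \v (tT \wl tpi k1)) (tc \v (tT \wl tpi k2));
  ll : (tT \wl tl) \v tl = (tl \wr tT) \v tl;
  cl : tc \v tl = tl;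
  ccl : (tc \wr tT) \v (tT \wl tc) \v (tl \wr tT) = (tT \wl tl) \v tc;
  cc : tc \v tc = idt (tT \c tT);
  ccc : (tT \wl tc) \v (tc \wr tT) \v (tT \wl tc) =
        (tc \wr tT) \v (tT \wl tc) \v (tc \wr tT);
  vertical_lift : forall (Y : K) (F : ob (Hom Y X)),
    is_pullback
      (((tT \wl ts) \v pair_arr (fun i => tT \wl @tpi 2 i)
          (tl \v tpi k1) ((tz \wr tT) \v tpi k2)) \wr F)
      ((tp \v tpi k1) \wr F)
      (tT \wl tp \wr F)
      (tz \wr F)
}.

Record tangentad (K : two_category) := Tangentad {
  tan_ob :> K;
  tan_str :> tangent_structure tan_ob
}.

Record negatives (K : two_category) (X : tangentad K) := Negatives {
  tn :> arr (Hom X X);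
  tn_arrow : arrow tn (tT X) (tT X);
  tn_p : tp X \v tn = tp X;
  tn_s : ts X \v pair_arr (@tpi _ _ X 2) tn (idt (tT X)) = tz X \v tp X
}.

Record lax_morphism (K : two_category) (X Y : tangentad K) := LaxMorphism {
  lax_ob :> ob (Hom (tan_ob X) (tan_ob Y));
  lax_cell : arr (Hom (tan_ob X) (tan_ob Y));
  lax_arrow : arrow lax_cell (lax_ob \c tT X) (tT Y \c lax_ob);
  lax_p : (tp Y \wr lax_ob) \v lax_cell = lax_ob \wl tp X;
  lax_z : lax_cell \v (lax_ob \wl tz X) = tz Y \wr lax_ob;
  lax_s : lax_cell \v (lax_ob \wl ts X) = (ts Y \wr lax_ob) \v
    pair_arr (fun i => @tpi _ _ Y 2 i \wr lax_ob)
      (lax_cell \v (lax_ob \wl tpi X k1)) (lax_cell \v (lax_ob \wl tpi X k2));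
  lax_l : (tl Y \wr lax_ob) \v lax_cell =
    (tT Y \wl lax_cell) \v (lax_cell \wr tT X) \v (lax_ob \wl tl X);
  lax_c : (tc Y \wr lax_ob) \v (tT Y \wl lax_cell) \v (lax_cell \wr tT X) =
    (tT Y \wl lax_cell) \v (lax_cell \wr tT X) \v (lax_ob \wl tc X)
}.

Definition strict (K : two_category) (X Y : tangentad K)
    (F : lax_morphism X Y) : Prop :=
  lax_cell F = idt (F \c tT X).

Record tangent_cell (K : two_category) (X Y : tangentad K) := TangentCell {
  tdom : lax_morphism X Y;
  tcod : lax_morphism X Y;
  tcell :> arr (Hom (tan_ob X) (tan_ob Y));
  tcell_arrow : arrow tcell tdom tcod;
  tcell_nat : (tT Y \wl tcell) \v lax_cell tdom = lax_cell tcod \v (tcell \wr tT X)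
}.

Create HintDb cell.
#[global] Hint Rewrite @dom_idt @cod_idt @dom_hcmp @cod_hcmp @comp1A
  @comp1_idl @comp1_idr : cell.

(* dc solves equations between sources and targets of pastings of cells.     *)
Ltac dc_step tac :=
  match goal with
  | |- context [dom (cmp ?g ?f)] =>
    let H := fresh in
    assert (H : dom (cmp g f) = dom f) by (apply: dom_cmp; tac);
    rewrite H; clear H
  | |- context [cod (cmp ?g ?f)] =>
    let H := fresh in
    assert (H : cod (cmp g f) = cod g) by (apply: cod_cmp; tac);
    rewrite H; clear H
  end.
Ltac dc_leaf := try done;
  repeat match goal with H : tcod ?a = _ |- context [tcod ?a] => rewrite H end;
  try done.
Ltac dc := simpl; try done; autorewrite with cell;
  repeat (dc_step ltac:(solve [dc]); autorewrite with cell); dc_leaf.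

Lemma arrow_dom (C : category) (f : arr C) A B : arrow f A B -> dom f = A.
Proof. by case. Qed.

Lemma arrow_cod (C : category) (f : arr C) A B : arrow f A B -> cod f = B.
Proof. by case. Qed.

Lemma cmp_idl' (C : category) (f : arr C) A : cod f = A -> idt A \v f = f.
Proof. by move=> <-; apply: cmp_idl. Qed.

Lemma cmp_idr' (C : category) (f : arr C) A : dom f = A -> f \v idt A = f.
Proof. by move=> <-; apply: cmp_idr. Qed.

Lemma the_orP (A : Type) (d : A) (P : A -> Prop) :
  (exists x, P x) -> P (the_or d P).
Proof.
by move=> e; rewrite /the_or; case: pselect => // e'; apply: (svalP (cid e')).
Qed.

Lemma ord2P (P : 'I_2 -> Prop) : P k1 -> P k2 -> forall i, P i.
Proof.
move=> P1 P2 [[|[|//]] lt_i].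
- by rewrite (_ : Ordinal lt_i = k1) //; apply: val_inj.
- by rewrite (_ : Ordinal lt_i = k2) //; apply: val_inj.
Qed.

Lemma pair_exists (C : category) (q : arr C) E (pr : 'I_2 -> arr C) A x y :
  is_nfold_pullback q E pr -> arrow x A (dom q) -> arrow y A (dom q) ->
  q \v x = q \v y ->
  exists! m : arr C, [/\ arrow m A E, pr k1 \v m = x & pr k2 \v m = y].
Proof.
move=> [_ _ univ] Ax Ay qxy.
have [||m [[Am mP] um]] := univ A (fun i => if i == k1 then x else y).
- by apply: ord2P.
- by apply: ord2P; apply: ord2P.
exists m; split=> [|m' [Am' m1 m2]]; first by split; rewrite ?mP.
by apply: um; split=> //; apply: ord2P.
Qed.

Lemma pair_arrP (C : category) (q : arr C) E (pr : 'I_2 -> arr C) A x y :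
  is_nfold_pullback q E pr -> arrow x A (dom q) -> arrow y A (dom q) ->
  q \v x = q \v y ->
  [/\ arrow (pair_arr pr x y) A E, pr k1 \v pair_arr pr x y = x
    & pr k2 \v pair_arr pr x y = y].
Proof.
move=> pb Ax Ay qxy; have [m [mP _]] := pair_exists pb Ax Ay qxy.
case: (pb) => Apr _ _; have [dpr _] := Apr k1; have [dx _] := Ax.
rewrite -dpr -dx; apply: (@the_orP _ _ (fun m => [/\ arrow m (dom x) (dom (pr k1)), _ & _])).
by exists m; rewrite dpr dx.
Qed.

Lemma pullback_inj (C : category) (q : arr C) n E (pr : 'I_n -> arr C) A m m' :
  is_nfold_pullback q E pr -> arrow m A E -> arrow m' A E ->
  (forall i, pr i \v m = pr i \v m') -> m = m'.
Proof.
move=> [Apr qpr univ] Am Am' mm'.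
have Ai i : cod m = dom (pr i) by case: (Apr i) Am => -> _ [].
have Aq i : cod (pr i) = dom q by case: (Apr i).
have [|i j|k [[_ kP] uk]] := univ A (fun i => pr i \v m).
- by move=> i; case: Am => dm cm; split; rewrite ?dom_cmp ?cod_cmp.
- by rewrite !cmpA // (qpr i j).
rewrite -(uk m) // -(uk m') //; split=> // i; by rewrite mm'.
Qed.

Lemma pair_arr_eq (C : category) (q : arr C) E (pr : 'I_2 -> arr C) A x y m :
  is_nfold_pullback q E pr -> arrow x A (dom q) -> arrow y A (dom q) ->
  arrow m A E -> pr k1 \v m = x -> pr k2 \v m = y -> pair_arr pr x y = m.
Proof.
move=> pb Ax Ay Am m1 m2.
have Ai i : cod m = dom (pr i).
  by case: (pb) => Apr _ _; case: (Apr i) Am => -> _ [].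
have Aq i : cod (pr i) = dom q by case: (pb) => Apr _ _; case: (Apr i).
have qxy : q \v x = q \v y.
  case: (pb) => _ qpr _.
  by rewrite -m1 -m2 !cmpA ?(qpr k1 k2).
have [Ap p1 p2] := pair_arrP pb Ax Ay qxy.
apply: (pullback_inj pb Ap Am); apply: ord2P.
- by rewrite p1 m1.
- by rewrite p2 m2.
Qed.

Section Whiskering.
Context (K : two_category) (X Y Z W : K).

Lemma wl_cmp (H : ob (Hom Y Z)) (g f : arr (Hom X Y)) :
  cod f = dom g -> H \wl (g \v f) = (H \wl g) \v (H \wl f).
Proof.
move=> fg; rewrite -interchange ?dom_idt ?cod_idt //.
by rewrite cmp_idl' ?cod_idt.
Qed.

Lemma wr_cmp (F : ob (Hom X Y)) (g f : arr (Hom Y Z)) :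
  cod f = dom g -> (g \v f) \wr F = (g \wr F) \v (f \wr F).
Proof.
move=> fg; rewrite -interchange ?dom_idt ?cod_idt //.
by rewrite cmp_idl' ?cod_idt.
Qed.

Lemma wl_wl (H : ob (Hom Z W)) (G : ob (Hom Y Z)) (a : arr (Hom X Y)) :
  H \wl (G \wl a) = (H \c G) \wl a.
Proof. by rewrite hcmpA hcmp_idt. Qed.

Lemma wr_wr (F : ob (Hom X Y)) (G : ob (Hom Y Z)) (a : arr (Hom Z W)) :
  (a \wr G) \wr F = a \wr (G \c F).
Proof. by rewrite -hcmpA hcmp_idt. Qed.

Lemma wl_wr (F : ob (Hom X Y)) (H : ob (Hom Z W)) (a : arr (Hom Y Z)) :
  H \wl (a \wr F) = (H \wl a) \wr F.
Proof. exact: hcmpA. Qed.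

Lemma wl_idt (H : ob (Hom Y Z)) (G : ob (Hom X Y)) : H \wl idt G = idt (H \c G).
Proof. exact: hcmp_idt. Qed.

Lemma hcmpE (a : arr (Hom X Y)) (b : arr (Hom Y Z)) A B :
  cod b = B -> dom a = A -> (B \wl a) \v (b \wr A) = b \h a.
Proof.
by move=> <- <-; rewrite -interchange ?dom_idt ?cod_idt // cmp_idl cmp_idr.
Qed.

Lemma hcmpE' (a : arr (Hom X Y)) (b : arr (Hom Y Z)) A B :
  dom b = B -> cod a = A -> (b \wr A) \v (B \wl a) = b \h a.
Proof.
by move=> <- <-; rewrite -interchange ?dom_idt ?cod_idt // cmp_idl cmp_idr.
Qed.

Lemma swap (a : arr (Hom X Y)) (b : arr (Hom Y Z)) A A' B B' :
  arrow a A A' -> arrow b B B' ->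
  (b \wr A') \v (B \wl a) = (B' \wl a) \v (b \wr A).
Proof. by move=> [? ?] [? ?]; rewrite hcmpE // hcmpE'. Qed.

End Whiskering.

Section TangentStructureTyping.
Context (K : two_category) (X : K) (S : tangent_structure X).

Lemma dom_tp : dom (tp S) = tT S. Proof. exact: (tp_arrow S).1. Qed.
Lemma cod_tp : cod (tp S) = id1 X. Proof. exact: (tp_arrow S).2. Qed.
Lemma dom_tz : dom (tz S) = id1 X. Proof. exact: (tz_arrow S).1. Qed.
Lemma cod_tz : cod (tz S) = tT S. Proof. exact: (tz_arrow S).2. Qed.
Lemma dom_ts : dom (ts S) = tTn S 2. Proof. exact: (ts_arrow S).1. Qed.
Lemma cod_ts : cod (ts S) = tT S. Proof. exact: (ts_arrow S).2. Qed.
Lemma dom_tl : dom (tl S) = tT S. Proof. exact: (tl_arrow S).1. Qed.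
Lemma cod_tl : cod (tl S) = tT S \c tT S. Proof. exact: (tl_arrow S).2. Qed.
Lemma dom_tc : dom (tc S) = tT S \c tT S. Proof. exact: (tc_arrow S).1. Qed.
Lemma cod_tc : cod (tc S) = tT S \c tT S. Proof. exact: (tc_arrow S).2. Qed.

Lemma Tn_pb n (Y : K) (F : ob (Hom Y X)) : 0 < n ->
  is_nfold_pullback (tp S \wr F) (tTn S n \c F) (fun i : 'I_n => tpi S i \wr F).
Proof.
move=> n0; move: (Tn_pullback S n0 F 0); rewrite /= hcmp_idl comp1_idl.
by under eq_fun => i do rewrite hcmp_idl.
Qed.

Lemma Tn_pbT n : 0 < n ->
  is_nfold_pullback (tT S \wl tp S) (tT S \c tTn S n)
    (fun i : 'I_n => tT S \wl tpi S i).
Proof.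
move=> n0; move: (Tn_pullback S n0 (id1 X) 1); rewrite /= hcmp_idr !comp1_idr.
by under eq_fun => i do rewrite hcmp_idr.
Qed.

Lemma Tn_pb0 n : 0 < n ->
  is_nfold_pullback (tp S) (tTn S n) (@tpi _ _ S n).
Proof.
move=> n0; move: (Tn_pb (id1 X) n0); rewrite /= hcmp_idr !comp1_idr.
by under eq_fun => i do rewrite hcmp_idr.
Qed.

Definition T2_pb Y F := @Tn_pb 2 Y F isT.

Lemma dom_tpi i : dom (@tpi _ _ S 2 i) = tTn S 2.
Proof. by have [A _ _] := @Tn_pb0 2 isT; case: (A i). Qed.

Lemma cod_tpi i : cod (@tpi _ _ S 2 i) = tT S.
Proof. by have [A _ _] := @Tn_pb0 2 isT; case: (A i) => _ ->; exact: dom_tp. Qed.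

Lemma p_tpi i : tp S \v @tpi _ _ S 2 i = tp S \v @tpi _ _ S 2 k1.
Proof. by have [_ A _] := @Tn_pb0 2 isT. Qed.

End TangentStructureTyping.

#[global] Hint Rewrite dom_tp cod_tp dom_tz cod_tz dom_ts cod_ts dom_tl cod_tl
  dom_tc cod_tc dom_tpi cod_tpi : cell.

Section LaxTyping.
Context (K : two_category) (X Y : tangentad K).
Implicit Type F : lax_morphism X Y.

Lemma dom_lax F : dom (lax_cell F) = F \c tT X.
Proof. exact: (lax_arrow F).1. Qed.
Lemma cod_lax F : cod (lax_cell F) = tT Y \c F.
Proof. exact: (lax_arrow F).2. Qed.

Lemma dom_tcell (a : tangent_cell X Y) : dom a = tdom a.
Proof. exact: (tcell_arrow a).1. Qed.
Lemma cod_tcell (a : tangent_cell X Y) : cod a = tcod a.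
Proof. exact: (tcell_arrow a).2. Qed.

Lemma lax_eq F G : lax_ob F = lax_ob G -> lax_cell F = lax_cell G -> F = G.
Proof.
case: F G => [F a a1 a2 a3 a4 a5 a6] [G b b1 b2 b3 b4 b5 b6] /= eF ea.
move: a1 a2 a3 a4 a5 a6; rewrite eF ea => *.
by congr LaxMorphism; apply: Prop_irrelevance.
Qed.

Lemma tcell_eq (a b : tangent_cell X Y) :
  tdom a = tdom b -> tcod a = tcod b -> tcell a = tcell b -> a = b.
Proof.
case: a b => [F G a a1 a2] [F' G' b b1 b2] /= eF eG e.
move: a1 a2; rewrite eF eG e => *.
by congr TangentCell; apply: Prop_irrelevance.
Qed.
End LaxTyping.

#[global] Hint Rewrite dom_lax cod_lax dom_tcell cod_tcell : cell.

Definition lax_pair (K : two_category) (X Y : tangentad K)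
    (F : lax_morphism X Y) : arr (Hom (tan_ob X) (tan_ob Y)) :=
  pair_arr (fun i => @tpi _ _ Y 2 i \wr F)
    (lax_cell F \v (F \wl tpi X k1)) (lax_cell F \v (F \wl tpi X k2)).

Lemma lax_pairP (K : two_category) (X Y : tangentad K) (F : lax_morphism X Y) :
  arrow (lax_pair F) (F \c tTn X 2) (tTn Y 2 \c F) /\
  forall i, (@tpi _ _ Y 2 i \wr F) \v lax_pair F = lax_cell F \v (F \wl tpi X i).
Proof.
have A i : arrow (lax_cell F \v (F \wl @tpi _ _ X 2 i)) (F \c tTn X 2)
    (dom (tp Y \wr F)).
  by split; dc.
have [|P1 P2 P3] := pair_arrP (T2_pb _ F) (A k1) (A k2).
  rewrite !cmpA; try by dc.
  by rewrite lax_p -!wl_cmp ?p_tpi //; dc.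
by split=> //; apply: ord2P.
Qed.

Lemma dom_lax_pair (K : two_category) (X Y : tangentad K)
  (F : lax_morphism X Y) : dom (lax_pair F) = F \c tTn X 2.
Proof. exact: (lax_pairP F).1.1. Qed.
Lemma cod_lax_pair (K : two_category) (X Y : tangentad K)
  (F : lax_morphism X Y) : cod (lax_pair F) = tTn Y 2 \c F.
Proof. exact: (lax_pairP F).1.2. Qed.
#[global] Hint Rewrite dom_lax_pair cod_lax_pair : cell.

Lemma lax_s' (K : two_category) (X Y : tangentad K) (F : lax_morphism X Y) :
  lax_cell F \v (F \wl ts X) = (ts Y \wr F) \v lax_pair F.
Proof. exact: lax_s. Qed.

Section LaxComp.
Context (K : two_category) (X Y Z : tangentad K).
Context (G : lax_morphism Y Z) (F : lax_morphism X Y).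

Definition comp_lax_cell := (lax_cell G \wr F) \v (G \wl lax_cell F).
Local Notation ga := comp_lax_cell.

Lemma comp_lax_arrow : arrow ga ((G \c F) \c tT X) (tT Z \c (G \c F)).
Proof. by split; rewrite /comp_lax_cell; dc. Qed.

Lemma comp_lax_p : (tp Z \wr (G \c F)) \v ga = (G \c F) \wl tp X.
Proof.
rewrite /comp_lax_cell cmpA; try by dc.
rewrite -wr_wr -wr_cmp; last by dc.
by rewrite lax_p -wl_wr -wl_cmp ?lax_p ?wl_wl //; dc.
Qed.

Lemma comp_lax_z : ga \v ((G \c F) \wl tz X) = tz Z \wr (G \c F).
Proof.
rewrite /comp_lax_cell -cmpA; try by dc.
rewrite -wl_wl -wl_cmp; last by dc.
by rewrite lax_z wl_wr -wr_cmp ?lax_z ?wr_wr //; dc.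
Qed.

Lemma comp_lax_s : ga \v ((G \c F) \wl ts X) = (ts Z \wr (G \c F)) \v
    pair_arr (fun i => @tpi _ _ Z 2 i \wr (G \c F))
      (ga \v ((G \c F) \wl tpi X k1)) (ga \v ((G \c F) \wl tpi X k2)).
Proof.
have gaE i : (@tpi _ _ Z 2 i \wr (G \c F)) \v (lax_pair G \wr F) \v (G \wl lax_pair F) =
    ga \v ((G \c F) \wl @tpi _ _ X 2 i).
  rewrite cmpA; try by dc.
  rewrite -wr_wr -wr_cmp; last by dc.
  rewrite (lax_pairP G).2 wr_cmp; last by dc.
  rewrite -cmpA; try by dc.
  rewrite -wl_wr -wl_cmp; last by dc.
  rewrite (lax_pairP F).2 wl_cmp; last by dc.
  by rewrite /comp_lax_cell -cmpA ?wl_wl //; dc.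
rewrite (pair_arr_eq (A := G \c F \c tTn X 2) (T2_pb _ (G \c F))
  (m := (lax_pair G \wr F) \v (G \wl lax_pair F))) ?gaE //; last first.
- by split; rewrite /comp_lax_cell; dc.
- by split; rewrite /comp_lax_cell; dc.
- by split; rewrite /comp_lax_cell; dc.
rewrite /comp_lax_cell -cmpA; try by dc.
rewrite -wl_wl -wl_cmp; last by dc.
rewrite lax_s' wl_cmp; last by dc.
rewrite !cmpA; try by dc.
congr (_ \v _).
rewrite wl_wr -wr_cmp ?lax_s' ?wr_cmp ?wr_wr //; by dc.
Qed.

Lemma comp_lax_l : (tl Z \wr (G \c F)) \v ga =
    (tT Z \wl ga) \v (ga \wr tT X) \v ((G \c F) \wl tl X).
Proof.
rewrite /comp_lax_cell cmpA; try by dc.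
rewrite -wr_wr -wr_cmp; last by dc.
rewrite lax_l !wr_cmp; try by dc.
rewrite -!cmpA; try by dc.
rewrite -(wl_wr F G) -wl_cmp; last by dc.
rewrite lax_l !wl_cmp; try by dc.
rewrite -!cmpA; try by dc.
rewrite -!wl_wr; congr (_ \v _).
rewrite !cmpA; try by dc.
rewrite !wl_wl; congr (_ \v _); rewrite wl_wr; congr (_ \v _).
by rewrite !wr_wr (swap (A := F \c tT X) (A' := tT Y \c F) (B := G \c tT Y)
   (B' := tT Z \c G)) //; split; dc.
Qed.

Lemma comp_lax_c :
  (tc Z \wr (G \c F)) \v (tT Z \wl ga) \v (ga \wr tT X) =
  (tT Z \wl ga) \v (ga \wr tT X) \v ((G \c F) \wl tc X).
Proof.
have E : (tT Z \wl ga) \v (ga \wr tT X) =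
    (((tT Z \wl lax_cell G) \v (lax_cell G \wr tT Y)) \wr F) \v
    (G \wl ((tT Y \wl lax_cell F) \v (lax_cell F \wr tT X))).
  rewrite /comp_lax_cell !wr_cmp ?wl_cmp; try by dc.
  rewrite -!cmpA; try by dc.
  rewrite -!wl_wr; congr (_ \v _).
  rewrite !cmpA; try by dc.
  rewrite !wl_wl wl_wr; congr (_ \v _).
  by rewrite !wr_wr (swap (A := F \c tT X) (A' := tT Y \c F) (B := G \c tT Y)
     (B' := tT Z \c G)) //; split; dc.
rewrite [RHS]cmpA; try by rewrite /comp_lax_cell; dc.
rewrite E [LHS]cmpA; try by dc.
rewrite -wr_wr -wr_cmp; last by dc.
rewrite lax_c [X in X \wr F]cmpA; try by dc.
rewrite wr_cmp; last by dc.
rewrite -[LHS]cmpA; try by dc.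
rewrite -(wl_wr F G) -wl_cmp; last by dc.
rewrite lax_c [X in G \wl X]cmpA; try by dc.
rewrite wl_cmp; last by dc.
by rewrite cmpA ?wl_wl //; dc.
Qed.

Definition comp_lax : lax_morphism X Z :=
  LaxMorphism comp_lax_arrow comp_lax_p comp_lax_z comp_lax_s comp_lax_l
    comp_lax_c.
End LaxComp.

Section LaxId.
Context (K : two_category) (X : tangentad K).

Lemma id_lax_arrow : arrow (idt (tT X)) (id1 X \c tT X) (tT X \c id1 X).
Proof. by split; dc. Qed.

Lemma id_lax_p : (tp X \wr id1 X) \v idt (tT X) = id1 X \wl tp X.
Proof. by rewrite hcmp_idl hcmp_idr cmp_idr' //; dc. Qed.

Lemma id_lax_z : idt (tT X) \v (id1 X \wl tz X) = tz X \wr id1 X.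
Proof. by rewrite hcmp_idl hcmp_idr cmp_idl' //; dc. Qed.

Lemma id_lax_s : idt (tT X) \v (id1 X \wl ts X) = (ts X \wr id1 X) \v
    pair_arr (fun i => @tpi _ _ X 2 i \wr id1 X)
      (idt (tT X) \v (id1 X \wl tpi X k1)) (idt (tT X) \v (id1 X \wl tpi X k2)).
Proof.
rewrite (pair_arr_eq (A := tTn X 2) (T2_pb _ (id1 X)) (m := idt (tTn X 2)));
  rewrite ?hcmp_idl ?hcmp_idr ?cmp_idr' ?cmp_idl' //; try by dc.
- by split; dc.
- by split; dc.
- by split; dc.
Qed.

Lemma id_lax_l : (tl X \wr id1 X) \v idt (tT X) =
  (tT X \wl idt (tT X)) \v (idt (tT X) \wr tT X) \v (id1 X \wl tl X).
Proof.
by rewrite !hcmp_idt hcmp_idl hcmp_idr !cmp_idl' ?cmp_idr' //; dc.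
Qed.

Lemma id_lax_c :
  (tc X \wr id1 X) \v (tT X \wl idt (tT X)) \v (idt (tT X) \wr tT X) =
  (tT X \wl idt (tT X)) \v (idt (tT X) \wr tT X) \v (id1 X \wl tc X).
Proof.
by rewrite !hcmp_idt hcmp_idl hcmp_idr !cmp_idl' ?cmp_idr' //; dc.
Qed.

Definition id_lax : lax_morphism X X :=
  LaxMorphism id_lax_arrow id_lax_p id_lax_z id_lax_s id_lax_l id_lax_c.
End LaxId.

Section HomTng.
Context (K : two_category) (X Y : tangentad K).

Lemma id_tcell_nat (F : lax_morphism X Y) :
  (tT Y \wl idt F) \v lax_cell F = lax_cell F \v (idt F \wr tT X).
Proof. by rewrite !hcmp_idt cmp_idl' ?cmp_idr' //; dc. Qed.

Lemma id_tcell_arrow (F : lax_morphism X Y) : arrow (idt (lax_ob F)) F F.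
Proof. by split; dc. Qed.

Definition id_tcell (F : lax_morphism X Y) : tangent_cell X Y :=
  TangentCell (id_tcell_arrow F) (id_tcell_nat F).

Lemma cmp_tcell_arrow (b a : tangent_cell X Y) : tcod a = tdom b ->
  arrow (tcell b \v tcell a) (tdom a) (tcod b).
Proof. by move=> e; split; dc. Qed.

Lemma cmp_tcell_nat (b a : tangent_cell X Y) : tcod a = tdom b ->
  (tT Y \wl (tcell b \v tcell a)) \v lax_cell (tdom a) =
  lax_cell (tcod b) \v ((tcell b \v tcell a) \wr tT X).
Proof.
move=> e; have e' : lax_ob (tcod a) = lax_ob (tdom b) by rewrite e.
rewrite wl_cmp ?wr_cmp; try by dc.
rewrite -cmpA; try by dc.
rewrite tcell_nat e cmpA; try by dc.
by rewrite tcell_nat -cmpA //; dc.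
Qed.

Definition cmp_tcell (b a : tangent_cell X Y) : tangent_cell X Y :=
  if pselect (tcod a = tdom b) is left e
  then TangentCell (cmp_tcell_arrow e) (cmp_tcell_nat e) else b.

Lemma cmp_tcellE (b a : tangent_cell X Y) : tcod a = tdom b ->
  [/\ tdom (cmp_tcell b a) = tdom a, tcod (cmp_tcell b a) = tcod b
    & tcell (cmp_tcell b a) = tcell b \v tcell a].
Proof. by move=> e; rewrite /cmp_tcell; case: pselect. Qed.

Lemma cmp_tcell_idl f : cmp_tcell (id_tcell (tcod f)) f = f.
Proof.
have [|/= d c e] := @cmp_tcellE (id_tcell (tcod f)) f; first by [].
by apply: tcell_eq => //; rewrite e /= cmp_idl' //; dc.
Qed.

Lemma cmp_tcell_idr f : cmp_tcell f (id_tcell (tdom f)) = f.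
Proof.
have [|/= d c e] := @cmp_tcellE f (id_tcell (tdom f)); first by [].
by apply: tcell_eq => //; rewrite e /= cmp_idr' //; dc.
Qed.

Lemma cmp_tcellA h g f : tcod f = tdom g -> tcod g = tdom h ->
  cmp_tcell h (cmp_tcell g f) = cmp_tcell (cmp_tcell h g) f.
Proof.
move=> fg gh.
have [d1 c1 e1] := cmp_tcellE fg; have [d2 c2 e2] := cmp_tcellE gh.
have [|d3 c3 e3] := @cmp_tcellE h (cmp_tcell g f); first by rewrite c1.
have [|d4 c4 e4] := @cmp_tcellE (cmp_tcell h g) f; first by rewrite d2.
apply: tcell_eq; rewrite ?d3 ?d4 ?c3 ?c4 ?e3 ?e4 ?e1 ?e2 //.
by rewrite cmpA //; dc.
Qed.

Definition hom_tng : category :=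
  @Category (lax_morphism X Y) (tangent_cell X Y) (@tdom _ _ _) (@tcod _ _ _)
    id_tcell cmp_tcell (fun _ => erefl) (fun _ => erefl)
    (fun g f e => let: And3 d _ _ := cmp_tcellE e in d)
    (fun g f e => let: And3 _ c _ := cmp_tcellE e in c)
    cmp_tcell_idl cmp_tcell_idr cmp_tcellA.
End HomTng.

Section HcmpTng.
Context (K : two_category) (X Y Z : tangentad K).
Context (b : tangent_cell Y Z) (a : tangent_cell X Y).

Lemma hcmp_tcell_arrow : arrow (tcell b \h tcell a)
  (comp_lax (tdom b) (tdom a)) (comp_lax (tcod b) (tcod a)).
Proof. by split; dc. Qed.

Lemma hcmp_tcell_nat :
  (tT Z \wl (tcell b \h tcell a)) \v lax_cell (comp_lax (tdom b) (tdom a)) =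
  lax_cell (comp_lax (tcod b) (tcod a)) \v ((tcell b \h tcell a) \wr tT X).
Proof.
rewrite /= /comp_lax_cell hcmpA cmpA; try by dc.
rewrite -interchange; try by dc.
rewrite tcell_nat cmp_idr'; last by dc.
rewrite -{1}[tcell a](@cmp_idl' _ _ (lax_ob (tcod a))); last by dc.
rewrite interchange; try by dc.
rewrite -cmpA; try by dc.
rewrite -[RHS]cmpA; try by dc.
congr (_ \v _).
rewrite -!hcmpA -!interchange; try by dc.
rewrite tcell_nat !cmp_idr' ?cmp_idl' //; by dc.
Qed.

Definition hcmp_tcell : tangent_cell X Z :=
  TangentCell hcmp_tcell_arrow hcmp_tcell_nat.
End HcmpTng.

Section Tng.
Context (K : two_category).

Lemma comp_laxA (X Y Z W : tangentad K) (H : lax_morphism Z W)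
    (G : lax_morphism Y Z) (F : lax_morphism X Y) :
  comp_lax H (comp_lax G F) = comp_lax (comp_lax H G) F.
Proof.
apply: lax_eq => /=; first exact: comp1A.
rewrite /comp_lax_cell /= /comp_lax_cell wl_cmp ?wr_cmp; try by dc.
by rewrite !hcmpA -!wr_wr hcmp_idt cmpA //; dc.
Qed.

Lemma comp_lax_idl (X Y : tangentad K) (F : lax_morphism X Y) :
  comp_lax (id_lax Y) F = F.
Proof.
apply: lax_eq => /=; first exact: comp1_idl.
by rewrite /comp_lax_cell /= hcmp_idt hcmp_idl cmp_idl' //; dc.
Qed.

Lemma comp_lax_idr (X Y : tangentad K) (F : lax_morphism X Y) :
  comp_lax F (id_lax X) = F.
Proof.
apply: lax_eq => /=; first exact: comp1_idr.
by rewrite /comp_lax_cell /= hcmp_idt hcmp_idr cmp_idr' //; dc.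
Qed.

Lemma hcmp_tcell_idt (X Y Z : tangentad K) (G : lax_morphism Y Z)
    (F : lax_morphism X Y) :
  hcmp_tcell (id_tcell G) (id_tcell F) = id_tcell (comp_lax G F).
Proof. by apply: tcell_eq => //=; rewrite hcmp_idt. Qed.

Lemma interchange_tcell (X Y Z : tangentad K) (b b' : tangent_cell Y Z)
    (a a' : tangent_cell X Y) : tcod b = tdom b' -> tcod a = tdom a' ->
  hcmp_tcell (cmp_tcell b' b) (cmp_tcell a' a) =
  cmp_tcell (hcmp_tcell b' a') (hcmp_tcell b a).
Proof.
move=> eb ea.
have [d1 c1 e1] := cmp_tcellE eb; have [d2 c2 e2] := cmp_tcellE ea.
have [|d3 c3 e3] := @cmp_tcellE _ _ _ (hcmp_tcell b' a') (hcmp_tcell b a).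
  by rewrite /= eb ea.
apply: tcell_eq; rewrite ?d3 ?c3 ?e3 /= ?d1 ?d2 ?c1 ?c2 ?e1 ?e2 //.
by rewrite interchange //; dc.
Qed.

Lemma hcmp_tcellA (X Y Z W : tangentad K) (d : tangent_cell Z W)
    (b : tangent_cell Y Z) (a : tangent_cell X Y) :
  hcmp_tcell d (hcmp_tcell b a) = hcmp_tcell (hcmp_tcell d b) a.
Proof. by apply: tcell_eq; rewrite /= ?comp_laxA ?hcmpA. Qed.

Lemma hcmp_tcell_idl (X Y : tangentad K) (a : tangent_cell X Y) :
  hcmp_tcell (id_tcell (id_lax Y)) a = a.
Proof. by apply: tcell_eq; rewrite /= ?comp_lax_idl ?hcmp_idl. Qed.

Lemma hcmp_tcell_idr (X Y : tangentad K) (a : tangent_cell X Y) :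
  hcmp_tcell a (id_tcell (id_lax X)) = a.
Proof. by apply: tcell_eq; rewrite /= ?comp_lax_idr ?hcmp_idr. Qed.

Definition Tng : two_category :=
  @TwoCategory (tangentad K) (@hom_tng K) (@id_lax K) (@comp_lax K)
    (@hcmp_tcell K) comp_laxA comp_lax_idl comp_lax_idr
    (fun _ _ _ _ _ => erefl) (fun _ _ _ _ _ => erefl)
    hcmp_tcell_idt interchange_tcell hcmp_tcellA hcmp_tcell_idl hcmp_tcell_idr.
End Tng.

Section TangentLax.
Context (K : two_category) (X : tangentad K).
Local Notation T := (tT X).
Local Notation T2 := (tTn X 2).
Local Notation p := (tp X).
Local Notation z := (tz X).
Local Notation s := (ts X).
Local Notation l := (tl X).
Local Notation c := (tc X).
Local Notation pi := (@tpi _ _ X 2).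

Lemma Tpc : (T \wl p) \v c = p \wr T.
Proof. by rewrite -cp -cmpA ?cc ?cmp_idr' //; dc. Qed.

Lemma T_lax_l : (l \wr T) \v c = (T \wl c) \v (c \wr T) \v (T \wl l).
Proof.
have E : (c \wr T) \v (T \wl l) \v c = (T \wl c) \v (l \wr T).
  rewrite -ccl cmpA; try by dc.
  by rewrite -wr_cmp ?cc ?hcmp_idt ?cmp_idl' //; dc.
have cTT : (T \wl c) \v (T \wl c) = idt (T \c T \c T).
  by rewrite -wl_cmp ?cc ?hcmp_idt ?comp1A //; dc.
have H : ((T \wl c) \v (c \wr T) \v (T \wl l)) \v c = l \wr T.
  rewrite -!cmpA; try by dc.
  by rewrite E cmpA ?cTT ?cmp_idl' //; dc.
by rewrite -H -[LHS]cmpA ?cc ?cmp_idr' //; dc.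
Qed.

Definition T_lax : lax_morphism X X :=
  LaxMorphism (tc_arrow X) (cp X) (cz X) (cs X) T_lax_l (esym (ccc X)).

Definition c2 : arr (Hom (tan_ob X) (tan_ob X)) :=
  pair_arr (fun i => T \wl pi i) (c \v (pi k1 \wr T)) (c \v (pi k2 \wr T)).

Lemma c2P : arrow c2 (T2 \c T) (T \c T2) /\
  forall i, (T \wl pi i) \v c2 = c \v (pi i \wr T).
Proof.
have A i : arrow (c \v (pi i \wr T)) (T2 \c T) (dom (T \wl p)).
  by split; dc.
have [|P1 P2 P3] := pair_arrP (@Tn_pbT _ _ X 2 isT) (A k1) (A k2).
  rewrite !cmpA; try by dc.
  by rewrite Tpc -!wr_cmp ?p_tpi //; dc.
by split=> //; apply: ord2P.
Qed.

Lemma dom_c2 : dom c2 = T2 \c T. Proof. exact: c2P.1.1. Qed.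
Lemma cod_c2 : cod c2 = T \c T2. Proof. exact: c2P.1.2. Qed.
End TangentLax.
#[global] Hint Rewrite dom_c2 cod_c2 : cell.

Section TangentT2.
Context (K : two_category) (X : tangentad K).
Local Notation T := (tT X).
Local Notation T2 := (tTn X 2).
Local Notation p := (tp X).
Local Notation z := (tz X).
Local Notation s := (ts X).
Local Notation l := (tl X).
Local Notation c := (tc X).
Local Notation pi := (@tpi _ _ X 2).
Local Notation c2 := (c2 X).

Lemma pi_arrow i : arrow (pi i) T2 T. Proof. by split; dc. Qed.

Lemma p_nat (a : arr (Hom X X)) A A' : arrow a A A' ->
  a \v (p \wr A) = (p \wr A') \v (T \wl a).
Proof.
move=> a_arr; rewrite (swap (A := A) (A' := A') (B := T) (B' := id1 _)) ?hcmp_idl //.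
exact: tp_arrow.
Qed.

Lemma z_nat (a : arr (Hom X X)) A A' : arrow a A A' ->
  (T \wl a) \v (z \wr A) = (z \wr A') \v a.
Proof.
move=> a_arr; rewrite -(swap (A := A) (A' := A') (B := id1 _) (B' := T)) ?hcmp_idl //.
exact: tz_arrow.
Qed.

Lemma pic i : (T \wl pi i) \v c2 = c \v (pi i \wr T).
Proof. exact: (c2P X).2. Qed.

Lemma T2_lax_arrow : arrow c2 (T2 \c T) (T \c T2).
Proof. exact: (c2P X).1. Qed.

Lemma T2_lax_p : (p \wr T2) \v c2 = T2 \wl p.
Proof.
apply: (pullback_inj (A := T2 \c T) (@Tn_pb0 _ _ X 2 isT)); try by split; dc.
move=> i; rewrite cmpA; try by dc.
rewrite (p_nat (pi_arrow i)) -cmpA; try by dc.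
rewrite pic cmpA; try by dc.
rewrite cp -(swap (A := T) (A' := id1 _) (B := T2) (B' := T)) ?hcmp_idr //.
  exact: tp_arrow.
exact: pi_arrow.
Qed.

Lemma T2_lax_z : c2 \v (T2 \wl z) = z \wr T2.
Proof.
apply: (pullback_inj (A := T2) (@Tn_pbT _ _ X 2 isT)); try by split; dc.
move=> i; rewrite cmpA; try by dc.
rewrite pic -cmpA; try by dc.
rewrite (swap (A := id1 _) (A' := T) (B := T2) (B' := T)); last 2 first.
- exact: tz_arrow.
- exact: pi_arrow.
rewrite hcmp_idr cmpA; try by dc.
by rewrite cz (z_nat (pi_arrow i)).
Qed.

Lemma T2_lax_s : c2 \v (T2 \wl s) = (s \wr T2) \v
    pair_arr (fun i => pi i \wr T2)
      (c2 \v (T2 \wl pi k1)) (c2 \v (T2 \wl pi k2)).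
Proof.
have A i : arrow (c2 \v (T2 \wl pi i)) (T2 \c T2) (dom (p \wr T2)).
  by split; dc.
have [|[dP cP] P1 P2] := pair_arrP (T2_pb _ T2) (A k1) (A k2).
  rewrite !cmpA; try by dc.
  by rewrite T2_lax_p -!wl_cmp ?p_tpi //; dc.
set P := pair_arr _ _ _ in dP cP P1 P2 *.
have PE : forall i, (pi i \wr T2) \v P = c2 \v (T2 \wl pi i) by apply: ord2P.
have E i : lax_pair (T_lax X) \v (pi i \wr T2) = (T2 \wl pi i) \v P.
  apply: (pullback_inj (A := T2 \c T2) (T2_pb _ T)); try by split; dc; rewrite ?dP ?cP.
  move=> j; rewrite !cmpA; try by (dc; rewrite ?cP).
  rewrite (lax_pairP (T_lax X)).2 /=.
  rewrite (swap (A := T2) (A' := T) (B := T2) (B' := T)); try exact: pi_arrow.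
  rewrite -[RHS]cmpA ?PE; try by (dc; rewrite ?cP).
  rewrite cmpA ?pic; try by dc.
  rewrite -!cmpA; try by dc.
  by rewrite (swap (A := T2) (A' := T) (B := T2) (B' := T)) //; exact: pi_arrow.
apply: (pullback_inj (A := T2 \c T2) (@Tn_pbT _ _ X 2 isT)).
- by split; dc.
- by split; rewrite ?dom_cmp ?cod_cmp; dc; rewrite ?cP.
move=> i; rewrite !cmpA; try by (dc; rewrite ?cP).
rewrite pic -cmpA; try by dc.
rewrite (swap (A := T2) (A' := T) (B := T2) (B' := T)); last 2 first.
- exact: ts_arrow.
- exact: pi_arrow.
rewrite cmpA; try by dc.
rewrite (lax_s' (T_lax X)) /= -[LHS]cmpA; try by dc.
rewrite E cmpA; try by (dc; rewrite ?cP).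
rewrite (swap (A := T2) (A' := T) (B := T2) (B' := T)) //.
  exact: pi_arrow.
exact: ts_arrow.
Qed.

Lemma T2_lax_cc i : (T \c T \wl pi i) \v (T \wl c2) \v (c2 \wr T) =
  (T \wl c) \v (c \wr T) \v (pi i \wr (T \c T)).
Proof.
rewrite cmpA; try by dc.
rewrite -wl_wl -wl_cmp; last by dc.
rewrite pic wl_cmp; last by dc.
rewrite -cmpA; try by dc.
rewrite wl_wr -wr_cmp; last by dc.
by rewrite pic wr_cmp ?wr_wr //; dc.
Qed.

Lemma TT_pb : is_nfold_pullback (T \c T \wl p) (T \c T \c T2)
  (fun i => T \c T \wl pi i).
Proof.
move: (@Tn_pullback _ _ X 2 isT _ (id1 _) 2); rewrite /= !comp1_idr hcmp_idr.
by under eq_fun => i do rewrite hcmp_idr.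
Qed.

Lemma T2_lax_l : (l \wr T2) \v c2 = (T \wl c2) \v (c2 \wr T) \v (T2 \wl l).
Proof.
apply: (pullback_inj (A := T2 \c T) TT_pb); try by split; dc.
move=> i; rewrite !cmpA; try by dc.
rewrite -[X in _ = X \v _]cmpA; try by dc.
rewrite T2_lax_cc -!cmpA; try by dc.
rewrite (swap (A := T) (A' := T \c T) (B := T2) (B' := T)); last 2 first.
- exact: tl_arrow.
- exact: pi_arrow.
rewrite [RHS](_ : _ = ((T \wl c) \v (c \wr T) \v (T \wl l)) \v (pi i \wr T)).
  rewrite -T_lax_l cmpA; try by dc.
  rewrite -(swap (A := T2) (A' := T) (B := T) (B' := T \c T)); last 2 first.
  - exact: pi_arrow.
  - exact: tl_arrow.
  rewrite -cmpA; try by dc.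
  by rewrite pic cmpA //; dc.
by rewrite -!cmpA //; dc.
Qed.

Lemma T2_lax_c : (c \wr T2) \v (T \wl c2) \v (c2 \wr T) =
  (T \wl c2) \v (c2 \wr T) \v (T2 \wl c).
Proof.
apply: (pullback_inj (A := T2 \c T \c T) TT_pb); try by split; dc.
move=> i; rewrite [LHS]cmpA; try by dc.
rewrite -(swap (A := T2) (A' := T) (B := T \c T) (B' := T \c T)); last 2 first.
- exact: pi_arrow.
- exact: tc_arrow.
rewrite -cmpA; try by dc.
rewrite T2_lax_cc [in RHS]cmpA; try by dc.
rewrite [in RHS]cmpA; try by dc.
rewrite -[X in _ = X \v _]cmpA; try by dc.
rewrite T2_lax_cc -!cmpA; try by dc.
rewrite (swap (A := T \c T) (A' := T \c T) (B := T2) (B' := T)); last 2 first.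
- exact: tc_arrow.
- exact: pi_arrow.
rewrite [LHS](_ : _ = ((c \wr T) \v (T \wl c) \v (c \wr T)) \v (pi i \wr (T \c T))).
  by rewrite -ccc -!cmpA //; dc.
by rewrite -!cmpA //; dc.
Qed.

Definition T2_lax : lax_morphism X X :=
  LaxMorphism T2_lax_arrow T2_lax_p T2_lax_z T2_lax_s T2_lax_l T2_lax_c.
End TangentT2.

Section Add.
Context (K : two_category) (X Y : K) (S : tangent_structure X).
Context (F : ob (Hom Y X)).
Local Notation p := (tp S).
Local Notation z := (tz S).
Local Notation s := (ts S).
Local Notation pi := (@tpi _ _ S 2).

Definition add_T (x y : arr (Hom Y X)) : arr (Hom Y X) :=
  (s \wr F) \v pair_arr (fun i => pi i \wr F) x y.

Lemma pair_T2 A x y m : arrow x A (tT S \c F) -> arrow y A (tT S \c F) ->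
  arrow m A (tTn S 2 \c F) -> (pi k1 \wr F) \v m = x -> (pi k2 \wr F) \v m = y ->
  pair_arr (fun i => pi i \wr F) x y = m.
Proof.
move=> Ax Ay Am; apply: (pair_arr_eq (A := A) (T2_pb S F)) => //.
- by case: Ax => *; split; dc.
- by case: Ay => *; split; dc.
Qed.

Lemma pair_T2P A x y : arrow x A (tT S \c F) -> arrow y A (tT S \c F) ->
  (p \wr F) \v x = (p \wr F) \v y ->
  [/\ arrow (pair_arr (fun i => pi i \wr F) x y) A (tTn S 2 \c F),
      (pi k1 \wr F) \v pair_arr (fun i => pi i \wr F) x y = x
    & (pi k2 \wr F) \v pair_arr (fun i => pi i \wr F) x y = y].
Proof.
move=> Ax Ay; apply: (pair_arrP (A := A) (T2_pb S F)).
- by case: Ax => *; split; dc.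
- by case: Ay => *; split; dc.
Qed.

Lemma add_T_arrow A x y : arrow x A (tT S \c F) -> arrow y A (tT S \c F) ->
  (p \wr F) \v x = (p \wr F) \v y -> arrow (add_T x y) A (tT S \c F).
Proof.
move=> Ax Ay e; have [[d c] _ _] := pair_T2P Ax Ay e.
by split; rewrite /add_T ?dom_cmp ?cod_cmp; dc; rewrite c.
Qed.

Lemma p_add_T A x y : arrow x A (tT S \c F) -> arrow y A (tT S \c F) ->
  (p \wr F) \v x = (p \wr F) \v y -> (p \wr F) \v add_T x y = (p \wr F) \v x.
Proof.
move=> Ax Ay e; have [[d c] e1 _] := pair_T2P Ax Ay e.
rewrite /add_T cmpA; try by (dc; rewrite c).
rewrite -wr_cmp ?ps ?wr_cmp; try by dc.
by rewrite -cmpA ?e1 //; dc; rewrite c.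
Qed.

Lemma add_TC A x y : arrow x A (tT S \c F) -> arrow y A (tT S \c F) ->
  (p \wr F) \v x = (p \wr F) \v y -> add_T x y = add_T y x.
Proof.
move=> Ax Ay e; have [[d c] e1 e2] := pair_T2P Ax Ay e.
set m := pair_arr _ x y in d c e1 e2.
have pi_ar i : arrow (pi i) (tTn S 2) (tT S) by split; dc.
have [|||[d' c'] q1 q2] := pair_arrP (@Tn_pb0 _ _ S 2 isT) (x := pi k2)
  (y := pi k1) (A := tTn S 2); try by split; dc.
  by rewrite p_tpi.
set w := pair_arr _ _ _ in d' c' q1 q2.
rewrite /add_T (@pair_T2 A y x ((w \wr F) \v m)) //; last 3 first.
- by split; rewrite ?dom_cmp ?cod_cmp; dc; rewrite ?c ?d' ?c' ?d.
- rewrite cmpA; try by (dc; rewrite ?c ?d' ?c').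
  by rewrite -wr_cmp ?q1 //; dc; rewrite c'.
- rewrite cmpA; try by (dc; rewrite ?c ?d' ?c').
  by rewrite -wr_cmp ?q2 //; dc; rewrite c'.
rewrite cmpA; try by (dc; rewrite ?c ?d' ?c').
rewrite -wr_cmp; last by (dc; rewrite c').
by rewrite sC.
Qed.

Lemma add0T A x : arrow x A (tT S \c F) ->
  add_T ((z \wr F) \v (p \wr F) \v x) x = x.
Proof.
move=> [d c].
have [|||[d' c'] q1 q2] := pair_arrP (@Tn_pb0 _ _ S 2 isT) (x := z \v p)
  (y := idt (tT S)) (A := tT S); try by split; dc.
  by rewrite cmpA ?pz ?cmp_idl' ?cmp_idr' //; dc.
set w := pair_arr _ _ _ in d' c' q1 q2.
rewrite /add_T (@pair_T2 A _ _ ((w \wr F) \v x)) //; last 4 first.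
- by split; rewrite ?dom_cmp ?cod_cmp; dc; rewrite ?c.
- by split; rewrite ?dom_cmp ?cod_cmp; dc; rewrite ?c ?d' ?c' ?d.
- rewrite cmpA; try by (dc; rewrite ?c ?d' ?c').
  rewrite -wr_cmp ?q1; try by (dc; rewrite c').
  by rewrite wr_cmp -?cmpA //; dc; rewrite c.
- rewrite cmpA; try by (dc; rewrite ?c ?d' ?c').
  rewrite -wr_cmp ?q2; try by (dc; rewrite c').
  by rewrite hcmp_idt cmp_idl'.
rewrite cmpA; try by (dc; rewrite ?c ?d' ?c').
rewrite -wr_cmp; last by (dc; rewrite c').
by rewrite s_unit hcmp_idt cmp_idl'.
Qed.

Lemma add_TA A x y w : arrow x A (tT S \c F) -> arrow y A (tT S \c F) ->
  arrow w A (tT S \c F) ->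
  (p \wr F) \v x = (p \wr F) \v y -> (p \wr F) \v y = (p \wr F) \v w ->
  add_T (add_T x y) w = add_T x (add_T y w).
Proof.
move=> Ax Ay Aw exy eyw.
have [Aq qq _] := @Tn_pb0 _ _ S 3 isT.
pose q1 := tpi S (@Ordinal 3 0 isT).
pose q2 := tpi S (@Ordinal 3 1 isT).
pose q3 := tpi S (@Ordinal 3 2 isT).
pose f (i : 'I_3) := if val i == 0 then x else if val i == 1 then y else w.
have [_ _ /(_ A f) univ] := @Tn_pb _ _ S 3 _ F isT.
have Af i : arrow (f i) A (tT S \c F) by rewrite /f; case: ifP => // _; case: ifP.
have pf i : (p \wr F) \v f i = (p \wr F) \v x.
  by rewrite /f; case: ifP => // _; case: ifP; rewrite -?eyw.
case: univ => [i|i j|m [[[dm cm] mP] _]]; rewrite ?pf //.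
  by case: (Af i) => *; split; dc.
have m1 : (q1 \wr F) \v m = x := mP (@Ordinal 3 0 isT).
have m2 : (q2 \wr F) \v m = y := mP (@Ordinal 3 1 isT).
have m3 : (q3 \wr F) \v m = w := mP (@Ordinal 3 2 isT).
have Aq' i : arrow (@tpi _ _ S 3 i) (tTn S 3) (tT S).
  by case: (Aq i) => ? e; split=> //; rewrite e dom_tp.
have [d1 c1] : arrow q1 (tTn S 3) (tT S) by exact: Aq'.
have [d2 c2'] : arrow q2 (tTn S 3) (tT S) by exact: Aq'.
have [d3 c3] : arrow q3 (tTn S 3) (tT S) by exact: Aq'.
have AT g : arrow g (tTn S 3) (tT S) -> arrow g (tTn S 3) (dom p).
  by case=> ? e; split; rewrite ?e ?dom_tp.
have pr a b : arrow a (tTn S 3) (tT S) -> arrow b (tTn S 3) (tT S) ->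
    p \v a = p \v q1 -> p \v b = p \v q1 ->
    [/\ arrow (s \v pair_arr pi a b) (tTn S 3) (tT S),
        p \v (s \v pair_arr pi a b) = p \v q1
      & (s \wr F) \v pair_arr (fun i => pi i \wr F) ((a \wr F) \v m) ((b \wr F) \v m)
        = ((s \v pair_arr pi a b) \wr F) \v m].
  move=> Aa Ab pa pb.
  have [|[d' c'] e1 e2] := pair_arrP (@Tn_pb0 _ _ S 2 isT) (AT _ Aa) (AT _ Ab).
    by rewrite pa.
  set k := pair_arr pi a b in d' c' e1 e2 *.
  have sk : cod k = dom s by rewrite c'; dc.
  case: Aa Ab => da ca [db cb].
  split.
  - by split; rewrite ?dom_cmp ?cod_cmp //; dc.
  - rewrite cmpA ?ps -?cmpA ?e1 //; dc; by rewrite c'.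
  rewrite (@pair_T2 A _ _ ((k \wr F) \v m)).
  - rewrite wr_cmp // -cmpA //; dc; rewrite ?cm ?d' //; by rewrite c'.
  - by split; rewrite ?dom_cmp ?cod_cmp; dc; rewrite ?cm ?da ?ca.
  - by split; rewrite ?dom_cmp ?cod_cmp; dc; rewrite ?cm ?db ?cb.
  - by split; rewrite ?dom_cmp ?cod_cmp; dc; rewrite ?cm ?d' ?c'.
  - rewrite cmpA; try by (dc; rewrite ?cm ?d' ?c').
    by rewrite -wr_cmp ?e1 //; rewrite c'; dc.
  - rewrite cmpA; try by (dc; rewrite ?cm ?d' ?c').
    by rewrite -wr_cmp ?e2 //; rewrite c'; dc.
have p21 : p \v q2 = p \v q1 by exact: qq.
have p31 : p \v q3 = p \v q1 by exact: qq.
have [A12 p12 E12] := pr q1 q2 (Aq' _) (Aq' _) erefl p21.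
have [A23 p23 E23] := pr q2 q3 (Aq' _) (Aq' _) p21 p31.
have [_ _ E1] := pr _ q3 A12 (Aq' _) p12 p31.
have [_ _ E2] := pr q1 _ (Aq' _) A23 erefl p23.
by rewrite /add_T -m1 -m2 -m3 E12 E1 E23 E2 sA.
Qed.
End Add.

Section StructureCells.
Context (K : two_category) (X : tangentad K).
Local Notation T := (tT X).
Local Notation TL := (T_lax X).
Local Notation TTL := (comp_lax (T_lax X) (T_lax X)).

Lemma p_cell_nat :
  (T \wl tp X) \v lax_cell TL = lax_cell (id_lax X) \v (tp X \wr T).
Proof. by rewrite /= Tpc cmp_idl' //; dc. Qed.
Definition p_cell : tangent_cell X X :=
  @TangentCell _ _ _ TL (id_lax X) _ (tp_arrow X) p_cell_nat.

Lemma z_cell_nat :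
  (T \wl tz X) \v lax_cell (id_lax X) = lax_cell TL \v (tz X \wr T).
Proof.
rewrite /= cmp_idr'; last by dc.
by rewrite -cz cmpA ?cc ?cmp_idl' //; dc.
Qed.
Definition z_cell : tangent_cell X X :=
  @TangentCell _ _ _ (id_lax X) TL _ (tz_arrow X) z_cell_nat.

Lemma pi_cell_nat i :
  (T \wl @tpi _ _ X 2 i) \v lax_cell (T2_lax X) =
  lax_cell TL \v (@tpi _ _ X 2 i \wr T).
Proof. exact: pic. Qed.
Definition pi_cell i : tangent_cell X X :=
  @TangentCell _ _ _ (T2_lax X) TL _ (pi_arrow X i) (pi_cell_nat i).

Lemma s_cell_nat :
  (T \wl ts X) \v lax_cell (T2_lax X) = lax_cell TL \v (ts X \wr T).
Proof.
rewrite /=.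
have E : lax_pair TL \v c2 X = idt (tTn X 2 \c T).
  apply: (pullback_inj (A := tTn X 2 \c T) (T2_pb _ T)); try by split; dc.
  move=> i; rewrite cmpA; try by dc.
  rewrite (lax_pairP TL).2 /= -cmpA; try by dc.
  rewrite pic cmpA; try by dc.
  by rewrite cc cmp_idl' ?cmp_idr' //; dc.
rewrite -[LHS](@cmp_idl' _ _ (T \c T)); last by dc.
rewrite -(cc X) -cmpA; try by dc.
congr (_ \v _).
rewrite cmpA; try by dc.
rewrite (lax_s' TL) /= -cmpA; try by dc.
by rewrite E cmp_idr' //; dc.
Qed.
Definition s_cell : tangent_cell X X :=
  @TangentCell _ _ _ (T2_lax X) TL _ (ts_arrow X) s_cell_nat.

Lemma l_cell_nat :
  (T \wl tl X) \v lax_cell TL = lax_cell TTL \v (tl X \wr T).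
Proof. by rewrite /= /comp_lax_cell /= -ccl -cmpA //; dc. Qed.
Definition l_cell : tangent_cell X X :=
  @TangentCell _ _ _ TL TTL _ (tl_arrow X) l_cell_nat.

Lemma c_cell_nat :
  (T \wl tc X) \v lax_cell TTL = lax_cell TTL \v (tc X \wr T).
Proof. by rewrite /= /comp_lax_cell /= ccc -cmpA //; dc. Qed.
Definition c_cell : tangent_cell X X :=
  @TangentCell _ _ _ TTL TTL _ (tc_arrow X) c_cell_nat.

Section Negation.
Context (n : negatives X).

Lemma dom_tn : dom n = T. Proof. exact: (tn_arrow n).1. Qed.
Lemma cod_tn : cod n = T. Proof. exact: (tn_arrow n).2. Qed.
Local Hint Rewrite dom_tn cod_tn : cell.

Lemma cTn : tc X \v (T \wl n) = (n \wr T) \v tc X.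
Proof.
have [||| [dn cn] n1 n2] := pair_arrP (@Tn_pb0 _ _ X 2 isT) (x := n)
  (y := idt T) (A := T); try by split; dc.
  by rewrite tn_p cmp_idr' //; dc.
set w := pair_arr _ _ _ in dn cn n1 n2.
have ws : ts X \v w = tz X \v tp X by exact: tn_s.
pose a := tc X \v (T \wl n); pose b := (n \wr T) \v tc X.
pose o := (tz X \wr T) \v (tp X \wr T) \v tc X.
have Aa : arrow a (T \c T) (T \c T) by split; rewrite /a; dc.
have Ab : arrow b (T \c T) (T \c T) by split; rewrite /b; dc.
have Ac : arrow (tc X) (T \c T) (T \c T) by exact: tc_arrow.
have pa : (tp X \wr T) \v a = (tp X \wr T) \v tc X.
  rewrite /a cmpA; try by dc.
  by rewrite cp -wl_cmp ?tn_p //; dc.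
have pb : (tp X \wr T) \v b = (tp X \wr T) \v tc X.
  rewrite /b cmpA; try by dc.
  by rewrite -wr_cmp ?tn_p //; dc.
have aE : add_T X T a (tc X) = o.
  rewrite /add_T (@pair_T2 _ _ _ X T (T \c T) a (tc X) (lax_pair TL \v (T \wl w))) //.
  - rewrite cmpA; try by (dc; rewrite ?cn).
    rewrite -(lax_s' TL) /= -cmpA; try by (dc; rewrite ?cn).
    rewrite -wl_cmp ?ws ?wl_cmp; try by (dc; rewrite ?cn).
    rewrite cmpA; try by dc.
    by rewrite cz -cp.
  - by split; rewrite ?dom_cmp ?cod_cmp; dc; rewrite ?cn ?dn.
  - rewrite cmpA; try by (dc; rewrite ?cn).
    rewrite (lax_pairP TL).2 /= -cmpA; try by (dc; rewrite ?cn).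
    by rewrite -wl_cmp ?n1 //; dc; rewrite ?cn.
  - rewrite cmpA; try by (dc; rewrite ?cn).
    rewrite (lax_pairP TL).2 /= -cmpA; try by (dc; rewrite ?cn).
    rewrite -wl_cmp ?n2; try by (dc; rewrite ?cn).
    by rewrite hcmp_idt cmp_idr' //; dc.
have bE : add_T X T b (tc X) = o.
  rewrite /add_T (@pair_T2 _ _ _ X T (T \c T) b (tc X) ((w \wr T) \v tc X)) //.
  - rewrite cmpA; try by (dc; rewrite ?cn ?dn).
    rewrite -wr_cmp ?ws ?wr_cmp; try by (dc; rewrite ?cn).
    by rewrite -cmpA //; dc.
  - by split; rewrite ?dom_cmp ?cod_cmp; dc; rewrite ?cn ?dn.
  - rewrite cmpA; try by (dc; rewrite ?cn ?dn).
    by rewrite -wr_cmp ?n1 //; dc; rewrite ?cn.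
  - rewrite cmpA; try by (dc; rewrite ?cn ?dn).
    rewrite -wr_cmp ?n2; try by (dc; rewrite ?cn).
    by rewrite hcmp_idt cmp_idl' //; dc.
have oa : add_T X T o a = a by rewrite /o -pa; apply: (add0T (A := T \c T)).
have ob : add_T X T o b = b by rewrite /o -pb; apply: (add0T (A := T \c T)).
have Ao : arrow o (T \c T) (T \c T) by rewrite -aE; apply: add_T_arrow.
have po : (tp X \wr T) \v o = (tp X \wr T) \v tc X.
  by rewrite -aE (p_add_T Aa Ac pa).
rewrite -/a -/b -oa -bE (add_TA Ab Ac Aa) ?pa ?pb //.
rewrite (add_TC Ac Aa) ?pa // aE (add_TC Ab Ao) ?pb ?po //.
Qed.

Lemma n_cell_nat : (T \wl n) \v lax_cell TL = lax_cell TL \v (n \wr T).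
Proof.
rewrite /= -[LHS](@cmp_idl' _ _ (T \c T)); last by dc.
rewrite -(cc X) -cmpA; try by dc.
congr (_ \v _).
rewrite cmpA; try by dc.
by rewrite cTn -cmpA ?cc ?cmp_idr' //; dc.
Qed.
Definition n_cell : tangent_cell X X :=
  @TangentCell _ _ _ TL TL _ (tn_arrow n) n_cell_nat.
End Negation.
End StructureCells.

(* The operations of a tangent category: tangent bundle functor, the objects *)
(* T_2 M with their projections, and the components of p, z, s, l, c.  These *)
(* are all that enters the definition of vector fields, their morphisms and  *)
(* their Lie bracket.                                                        *)
Record tangent_operations (C : category) := TangentOperations {
  o_T : functor C C;
  o_T2 : ob C -> ob C;
  o_pi : ob C -> 'I_2 -> arr C;
  o_p : ob C -> arr C;
  o_z : ob C -> arr C;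
  o_s : ob C -> arr C;
  o_l : ob C -> arr C;
  o_c : ob C -> arr C
}.

Section VectorFields.
Context (C : category) (O : tangent_operations C).
Local Notation T := (farr (o_T O)).
Local Notation To := (fob (o_T O)).

Definition is_vector_field (M : ob C) (v : arr C) : Prop :=
  arrow v M (To M) /\ o_p O M \v v = idt M.

Record vf_object := VFObject {
  vf_ob : ob C;
  vf_arr : arr C;
  vf_arrP : is_vector_field vf_ob vf_arr
}.

Record vf_morphism := VFMorphism {
  vf_dom : vf_object;
  vf_cod : vf_object;
  vf_mor : arr C;
  vf_mor_arrow : arrow vf_mor (vf_ob vf_dom) (vf_ob vf_cod);
  vf_mor_comm : T vf_mor \v vf_arr vf_dom = vf_arr vf_cod \v vf_mor
}.

Lemma vf_object_eq (a b : vf_object) :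
  vf_ob a = vf_ob b -> vf_arr a = vf_arr b -> a = b.
Proof.
case: a b => [M u hu] [N v hv] /= eM eu; move: hu hv; rewrite eM eu => hu hv.
by congr VFObject; apply: Prop_irrelevance.
Qed.

Lemma vf_morphism_eq (f g : vf_morphism) : vf_dom f = vf_dom g ->
  vf_cod f = vf_cod g -> vf_mor f = vf_mor g -> f = g.
Proof.
case: f g => [A B f f1 f2] [A' B' g g1 g2] /= eA eB ef.
move: f1 f2 g1 g2; rewrite eA eB ef => *.
by congr VFMorphism; apply: Prop_irrelevance.
Qed.

Lemma vf_id_comm (a : vf_object) :
  T (idt (vf_ob a)) \v vf_arr a = vf_arr a \v idt (vf_ob a).
Proof.
case: a => M v [[d c] e] /=.
by rewrite farr_idt cmp_idl' ?cmp_idr'.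
Qed.

Definition vf_id (a : vf_object) : vf_morphism :=
  @VFMorphism a a (idt (vf_ob a)) (conj (dom_idt _) (cod_idt _)) (vf_id_comm a).

Lemma vf_cmp_arrow (g f : vf_morphism) : vf_cod f = vf_dom g ->
  arrow (vf_mor g \v vf_mor f) (vf_ob (vf_dom f)) (vf_ob (vf_cod g)).
Proof.
case: g f => [A B g [dg cg] hg] [A' B' f [df cf] hf] /= e.
by split; rewrite ?dom_cmp ?cod_cmp // cf dg e.
Qed.

Lemma vf_cmp_comm (g f : vf_morphism) : vf_cod f = vf_dom g ->
  T (vf_mor g \v vf_mor f) \v vf_arr (vf_dom f) =
  vf_arr (vf_cod g) \v (vf_mor g \v vf_mor f).
Proof.
move=> e.
have [dg cg] := vf_mor_arrow g; have [df cf] := vf_mor_arrow f.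
have [[da ca] _] := vf_arrP (vf_dom f).
have [[db cb] _] := vf_arrP (vf_cod f).
have [[dd cd] _] := vf_arrP (vf_cod g).
have fg : cod (vf_mor f) = dom (vf_mor g) by rewrite cf dg e.
rewrite farr_cmp // -cmpA ?dom_farr ?cod_farr ?fg //; last by rewrite ca df.
rewrite vf_mor_comm cmpA ?dom_farr //; last 2 first.
- by rewrite cf db.
- by rewrite cb dg e.
by rewrite e vf_mor_comm -cmpA // cg dd.
Qed.

Definition vf_cmp (g f : vf_morphism) : vf_morphism :=
  if pselect (vf_cod f = vf_dom g) is left e
  then VFMorphism (vf_cmp_arrow e) (vf_cmp_comm e) else g.

Lemma vf_cmpE (g f : vf_morphism) : vf_cod f = vf_dom g ->
  [/\ vf_dom (vf_cmp g f) = vf_dom f, vf_cod (vf_cmp g f) = vf_cod g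
    & vf_mor (vf_cmp g f) = vf_mor g \v vf_mor f].
Proof. by move=> e; rewrite /vf_cmp; case: pselect. Qed.

Lemma vf_cmp_idl f : vf_cmp (vf_id (vf_cod f)) f = f.
Proof.
have [|/= d c e] := @vf_cmpE (vf_id (vf_cod f)) f; first by [].
apply: vf_morphism_eq => //; rewrite e /= cmp_idl' //.
by case: (vf_mor_arrow f).
Qed.

Lemma vf_cmp_idr f : vf_cmp f (vf_id (vf_dom f)) = f.
Proof.
have [|/= d c e] := @vf_cmpE f (vf_id (vf_dom f)); first by [].
apply: vf_morphism_eq => //; rewrite e /= cmp_idr' //.
by case: (vf_mor_arrow f).
Qed.

Lemma vf_cmpA h g f : vf_cod f = vf_dom g -> vf_cod g = vf_dom h ->
  vf_cmp h (vf_cmp g f) = vf_cmp (vf_cmp h g) f.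
Proof.
move=> fg gh.
have [d1 c1 e1] := vf_cmpE fg; have [d2 c2 e2] := vf_cmpE gh.
have [|d3 c3 e3] := @vf_cmpE h (vf_cmp g f); first by rewrite c1.
have [|d4 c4 e4] := @vf_cmpE (vf_cmp h g) f; first by rewrite d2.
apply: vf_morphism_eq; rewrite ?d3 ?d4 ?c3 ?c4 ?e3 ?e4 ?e1 ?e2 // cmpA //.
- by case: (vf_mor_arrow f) (vf_mor_arrow g) => _ -> [-> _]; rewrite fg.
- by case: (vf_mor_arrow g) (vf_mor_arrow h) => _ -> [-> _]; rewrite gh.
Qed.

Definition vf_category : category :=
  @Category vf_object vf_morphism vf_dom vf_cod vf_id vf_cmp
    (fun _ => erefl) (fun _ => erefl)
    (fun g f e => let: And3 d _ _ := vf_cmpE e in d)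
    (fun g f e => let: And3 _ c _ := vf_cmpE e in c)
    vf_cmp_idl vf_cmp_idr vf_cmpA.

(* For vector fields u, v on M; n is the negation.                           *)
Definition vf_add (M : ob C) (u v : arr C) : arr C :=
  o_s O M \v pair_arr (o_pi O M) u v.

Definition vf_opp (n : ob C -> arr C) (M : ob C) (v : arr C) : arr C := n M \v v.

(* f - g, for f, g : A -> T^2 M with p_T f = p_T g.                          *)
Definition diff_T (n : ob C -> arr C) (M : ob C) (f g : arr C) : arr C :=
  o_s O (To M) \v pair_arr (o_pi O (To M)) f (n (To M) \v g).

(* {h}, for h : A -> T^2 M with T p h = z p p_T h.                           *)
Definition brace (M : ob C) (h : arr C) : arr C :=
  the_or h (fun k : arr C =>
    [/\ arrow k (dom h) (To M),
        o_p O M \v k = o_p O M \v o_p O (To M) \v h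
      & T (o_s O M) \v pair_arr (fun i => T (o_pi O M i))
          (o_l O M \v k) (o_z O (To M) \v o_p O (To M) \v h) = h]).

Definition lie_bracket (n : ob C -> arr C) (M : ob C) (u v : arr C) : arr C :=
  brace M (diff_T n M (T v \v u) (o_c O M \v T u \v v)).

End VectorFields.

Definition postcomp (K : two_category) (X Y Z : K) (G : ob (Hom Y Z)) :
    functor (Hom X Y) (Hom X Z).
Proof.
apply: (@Functor _ _ (comp1 G) (hcmp (idt G))) => [f|f|F|g f e].
- by rewrite dom_hcmp dom_idt.
- by rewrite cod_hcmp cod_idt.
- exact: hcmp_idt.
- exact: wl_cmp.
Defined.

(* The Hom-tangent category [Y | X]: postcomposition, in Tng(K), with (T,c), *)
(* with T_2 and with the structural 2-morphisms of X.                        *)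
Definition hom_tangent (K : two_category) (Y X : tangentad K) :
    tangent_operations (hom_tng Y X) :=
  @TangentOperations (@Hom (Tng K) Y X)
    (@postcomp (Tng K) Y X X (T_lax X))
    (fun F => @comp1 (Tng K) Y X X (T2_lax X) F)
    (fun F i => @hcmp (Tng K) Y X X (pi_cell X i) (idt F))
    (fun F => @hcmp (Tng K) Y X X (p_cell X) (idt F))
    (fun F => @hcmp (Tng K) Y X X (z_cell X) (idt F))
    (fun F => @hcmp (Tng K) Y X X (s_cell X) (idt F))
    (fun F => @hcmp (Tng K) Y X X (l_cell X) (idt F))
    (fun F => @hcmp (Tng K) Y X X (c_cell X) (idt F)).

Definition hom_neg (K : two_category) (Y X : tangentad K) (n : negatives X)
    (F : ob (hom_tng Y X)) : arr (hom_tng Y X) :=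
  @hcmp (Tng K) Y X X (n_cell n) (idt F).

Record strict_morphism (K : two_category) (X Y : tangentad K) :=
    StrictMorphism {
  strict_lax :> lax_morphism X Y;
  strictP : strict strict_lax
}.

Section Gamma.
Context (K : two_category) (V X : tangentad K) (U : lax_morphism V X).
Context (v : tangent_cell V X) (hv : is_vector_field (hom_tangent V X) U v).
Context (Y : tangentad K).

Lemma Gamma_vf (H : lax_morphism Y V) :
  is_vector_field (hom_tangent Y X) (comp_lax U H) (hcmp_tcell v (id_tcell H)).
Proof.
case: hv => -[/= dv cv] /= pv; split; first split.
- by rewrite /= dv.
- by rewrite /= cv; rewrite /= comp_laxA.
rewrite /=.
rewrite -[RHS]hcmp_tcell_idt -[X in _ = hcmp_tcell X _]pv.
have e : tcod v = tdom (hcmp_tcell (p_cell X) (id_tcell U)) by rewrite cv.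
rewrite -{2}(cmp_tcell_idl (id_tcell H)) interchange_tcell //.
by rewrite -hcmp_tcell_idt hcmp_tcellA.
Qed.

Definition Gamma_ob (H : lax_morphism Y V) : vf_object (hom_tangent Y X) :=
  VFObject (Gamma_vf H).

Lemma Gamma_comm (f : tangent_cell Y V) :
  farr (o_T (hom_tangent Y X)) (hcmp_tcell (id_tcell U) f) \v
    vf_arr (Gamma_ob (tdom f)) =
  vf_arr (Gamma_ob (tcod f)) \v
    (hcmp_tcell (id_tcell U) f : arr (hom_tng Y X)).
Proof.
case: hv => -[dv cv] _ /=; move: dv cv => /= dv cv.
rewrite hcmp_tcellA hcmp_tcell_idt.
rewrite -interchange_tcell //= -interchange_tcell //=.
by rewrite -cv -dv !cmp_tcell_idl !cmp_tcell_idr.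
Qed.

Lemma Gamma_arrow (f : tangent_cell Y V) :
  @arrow (hom_tng Y X) (hcmp_tcell (id_tcell U) f)
    (vf_ob (Gamma_ob (tdom f))) (vf_ob (Gamma_ob (tcod f))).
Proof. by split. Qed.

Definition Gamma_arr (f : tangent_cell Y V) : vf_morphism (hom_tangent Y X) :=
  VFMorphism (Gamma_arrow f) (Gamma_comm f).

(* Only the underlying functor of the strict tangent morphism Gamma_v is     *)
(* recorded: the inverse of an invertible Gamma_v is again strict.           *)
Definition Gamma : functor (hom_tng Y V) (vf_category (hom_tangent Y X)).
Proof.
apply: (@Functor (hom_tng Y V) (vf_category (hom_tangent Y X))
  Gamma_ob Gamma_arr) => [f|f|F|g f e] //=.
- by apply: vf_morphism_eq => //=; rewrite hcmp_tcell_idt.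
rewrite /= in e; have [d1 c1 e1] := cmp_tcellE e.
have eG : vf_cod (Gamma_arr f) = vf_dom (Gamma_arr g) by rewrite /= e.
have [d2 c2 e2] := vf_cmpE eG.
apply: vf_morphism_eq; rewrite ?d2 ?c2 ?e2 /= ?d1 ?c1 //.
by rewrite -interchange_tcell //= (cmp_tcell_idl (id_tcell U)).
Defined.
End Gamma.

Record vf_construction (K : two_category) (X : tangentad K) := VFConstruction {
  VF : tangentad K;
  vfU : strict_morphism VF X;
  vfv : tangent_cell VF X;
  vfvP : is_vector_field (hom_tangent VF X) (strict_lax vfU) vfv;
  vfP : forall Y : tangentad K, invertible_functor (Gamma vfvP Y)
}.

Definition corresponds (K : two_category) (X Y : tangentad K)
    (D : vf_construction X) (H : lax_morphism Y (VF D))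
    (M : lax_morphism Y X) (w : tangent_cell Y X) : Prop :=
  let G := fob (Gamma (vfvP D) Y) H in vf_ob G = M /\ vf_arr G = w.

Section StrictTng.
Context (K : two_category).

Record strict_arrow := StrictArrow {
  sa_dom : tangentad K;
  sa_cod : tangentad K;
  sa_mor :> strict_morphism sa_dom sa_cod
}.

Lemma strict_eq (X Y : tangentad K) (F G : strict_morphism X Y) :
  strict_lax F = strict_lax G -> F = G.
Proof.
case: F G => [F f] [G g] /= e; move: f g; rewrite e => f g.
by congr StrictMorphism; apply: Prop_irrelevance.
Qed.

Lemma id_strictP (X : tangentad K) : strict (id_lax X).
Proof. by rewrite /strict /= comp1_idl. Qed.

Definition id_strict (X : tangentad K) := StrictMorphism (id_strictP X).

Lemma comp_strictP (X Y Z : tangentad K) (G : strict_morphism Y Z)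
  (F : strict_morphism X Y) : strict (comp_lax G F).
Proof.
rewrite /strict /= /comp_lax_cell.
have e : F \c tT X = tT Y \c F by rewrite -(cod_lax F) strictP cod_idt.
rewrite !strictP !hcmp_idt cmp_idr'; first by rewrite -!comp1A e.
by rewrite dom_idt -!comp1A e.
Qed.

Definition comp_strict (X Y Z : tangentad K) (G : strict_morphism Y Z)
  (F : strict_morphism X Y) := StrictMorphism (comp_strictP G F).

Definition cmp_strict (g f : strict_arrow) : strict_arrow :=
  if pselect (sa_cod f = sa_dom g) is left e
  then StrictArrow (comp_strict g
    (ecast Y (strict_morphism (sa_dom f) Y) e (sa_mor f))) else g.

Lemma cmp_strictE (X Y Z : tangentad K) (G : strict_morphism Y Z)
    (F : strict_morphism X Y) :
  cmp_strict (StrictArrow G) (StrictArrow F) = StrictArrow (comp_strict G F).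
Proof.
rewrite /cmp_strict; case: pselect => //= e.
by rewrite (Prop_irrelevance e erefl).
Qed.

Lemma sa_dom_cmp (g f : strict_arrow) : sa_cod f = sa_dom g ->
  sa_dom (cmp_strict g f) = sa_dom f.
Proof. by rewrite /cmp_strict; case: pselect. Qed.

Lemma sa_cod_cmp (g f : strict_arrow) : sa_cod f = sa_dom g ->
  sa_cod (cmp_strict g f) = sa_cod g.
Proof. by rewrite /cmp_strict; case: pselect. Qed.

Lemma cmp_strict_idl f : cmp_strict (StrictArrow (id_strict (sa_cod f))) f = f.
Proof.
case: f => X Y F; rewrite cmp_strictE; congr StrictArrow.
by apply: strict_eq; rewrite /= comp_lax_idl.
Qed.

Lemma cmp_strict_idr f : cmp_strict f (StrictArrow (id_strict (sa_dom f))) = f.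
Proof.
case: f => X Y F; rewrite cmp_strictE; congr StrictArrow.
by apply: strict_eq; rewrite /= comp_lax_idr.
Qed.

Lemma cmp_strictA h g f : sa_cod f = sa_dom g -> sa_cod g = sa_dom h ->
  cmp_strict h (cmp_strict g f) = cmp_strict (cmp_strict h g) f.
Proof.
case: f g h => [X Y F] [Y' Z G] [Z' W H] /= e e'.
move: G H; rewrite -e => G; rewrite -e' => H; rewrite !cmp_strictE.
by congr StrictArrow; apply: strict_eq; rewrite /= comp_laxA.
Qed.

Definition strict_tng : category :=
  @Category (tangentad K) strict_arrow sa_dom sa_cod
    (fun X => StrictArrow (id_strict X)) cmp_strict
    (fun _ => erefl) (fun _ => erefl) sa_dom_cmp sa_cod_cmp
    cmp_strict_idl cmp_strict_idr cmp_strictA.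

Definition strict_arr (X Y : tangentad K) (F : strict_morphism X Y) :
  arr strict_tng := StrictArrow F.
End StrictTng.

(* Bundle structures on q : E -> B, with E2 and pr the chosen 2-fold         *)
(* pullback of q along itself.  The fibrewise laws are stated on generalized *)
(* elements of E over the same element of B.                                 *)
Section Bundles.
Context (C : category) (q : arr C) (E2 : ob C) (pr : 'I_2 -> arr C).
Local Notation E := (dom q).
Local Notation B := (cod q).

Definition same_fibre (x y : arr C) : Prop :=
  [/\ dom x = dom y, cod x = E, cod y = E & q \v x = q \v y].

Definition fibre_op (o x y : arr C) : arr C := o \v pair_arr pr x y.

Record is_additive_bundle (zq sq : arr C) : Prop := IsAdditiveBundle {
  ab_E2 : is_nfold_pullback q E2 pr;
  ab_En : forall n, 0 < n ->
    exists (En : ob C) (prn : 'I_n -> arr C), is_nfold_pullback q En prn;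
  ab_zq : arrow zq B E;
  ab_sq : arrow sq E2 E;
  ab_qz : q \v zq = idt B;
  ab_qs : q \v sq = q \v pr k1;
  ab_assoc : forall x y w, same_fibre x y -> same_fibre y w ->
    fibre_op sq (fibre_op sq x y) w = fibre_op sq x (fibre_op sq y w);
  ab_comm : forall x y, same_fibre x y -> fibre_op sq x y = fibre_op sq y x;
  ab_unit : forall x, cod x = E -> fibre_op sq (zq \v q \v x) x = x
}.

Record is_abelian_group_bundle (zq sq mq : arr C) : Prop :=
    IsAbelianGroupBundle {
  agb_additive : is_additive_bundle zq sq;
  agb_mq : arrow mq E E;
  agb_qm : q \v mq = q;
  agb_neg : fibre_op sq mq (idt E) = zq \v q
}.

Record is_lie_algebra_bundle (zq sq bq : arr C) : Prop :=
    IsLieAlgebraBundle {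
  lab_additive : is_additive_bundle zq sq;
  lab_bq : arrow bq E2 E;
  lab_qb : q \v bq = q \v pr k1;
  lab_add : forall x y w, same_fibre x y -> same_fibre y w ->
    fibre_op bq (fibre_op sq x y) w =
    fibre_op sq (fibre_op bq x w) (fibre_op bq y w);
  lab_zero : forall x, cod x = E ->
    fibre_op bq (zq \v q \v x) x = zq \v q \v x;
  lab_anti : forall x y, same_fibre x y ->
    fibre_op sq (fibre_op bq x y) (fibre_op bq y x) = zq \v q \v x;
  lab_jacobi : forall x y w, same_fibre x y -> same_fibre y w ->
    fibre_op sq (fibre_op sq (fibre_op bq (fibre_op bq x y) w)
                             (fibre_op bq (fibre_op bq w x) y))
                (fibre_op bq (fibre_op bq y w) x) = zq \v q \v x
}.
End Bundles.

(* Tangent structures on the 2-pullbacks VF_(n+1)(X), with projections the   *)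
(* given ones, now strict, which make them 2-pullbacks in Tng(K).            *)
Definition induced_structure (K : two_category) (X : tangentad K)
    (D : vf_construction X)
    (P : forall n : nat, nfold_2pullback (lax_ob (vfU D)) n.+1)
    (E : forall n : nat, tangent_structure (apex (P n)))
    (pr : forall n : nat, 'I_n.+1 ->
       strict_morphism (Tangentad (E n)) (VF D)) : Prop :=
  (forall n i, lax_ob (pr n i) = proj (P n) i) /\
  (forall n, @is_nfold_2pullback (Tng K) (VF D) X (strict_lax (vfU D)) n.+1
     (Tangentad (E n)) (fun i => strict_lax (pr n i))).
Arguments induced_structure {K X D} P E pr.

(* Main.v *)
(** Under Gamma, a strict tangent morphism Y -> VF(X) is a strict morphism
    Y -> X together with a vector field on it, so the bundle laws become
    identities between vector fields in the tangent category K(Y, X).  The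
    Jacobi identity is the only hard one.  The bracket of u and v is defined by
    T v o u = (u^c + [u,v]^vert) o v on T M, where u^c = c o T u is the complete
    lift and w^vert the vertical lift of w; in other words v is a morphism of
    vector fields from (M, u) to (T M, u^c + [u,v]^vert).  The bracket is
    natural with respect to such morphisms, and [u^c, v^c] = [u,v]^c,
    [u^c, w^vert] = [u,w]^vert, [w^vert, w'^vert] = 0; comparing the images
    along v of [u1,u2] gives [[u1,u2],v] = [u1,[u2,v]] - [u2,[u1,v]].

    For the tangent structure on VF_n(X), every object Y of K carries the
    trivial tangent structure T = id, whose lax morphisms into X are the plain
    1-cells Y -> X.  Hence K(Y, VF_n(X)) is the category of objects of K(Y, X)
    with n vector fields: it is faithful over K(Y, X), so equations lift, and
    the pullbacks required of a tangent structure are created by K(Y, X). *)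
Require Import Defs.
From mathcomp Require Import all_boot boolp.

Set Implicit Arguments.
Unset Strict Implicit.
Unset Printing Implicit Defensive.

(* The Lie bracket is defined by chosen pairings and a chosen vertical component in the Hom-tangent
   category of [Tng K], while the calculations take place in K(Y, X) with composition and a partial
   addition. The two agree because every chosen element is fixed by a universal property, and
   because the vertical component of a tangent cell is again tangent. The latter is
   [vertical_compat], which serves again for the vertical lift of VF_n. T^3 M carries three
   additions, along p, T p and T T p. The flips c permute them, and any two of them satisfy an
   interchange law derived from [add_interchange]; the brackets of complete and vertical lifts come
   down to rearranging such sums. Negatives enter mostly as cancellation, which makes the bracket
   unique and lets the derivation formula be read off from an equation of sums. The bundle laws use
   only the projections and the 2-pullback property, so they hold for every induced structure on
   VF_n; that one exists is a separate construction. *)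
Reserved Notation "f \@ g" (at level 43, right associativity).
Reserved Notation "x [+] y" (at level 50, left associativity).
Reserved Notation "x [++] y" (at level 50, left associativity).
Reserved Notation "x [+++] y" (at level 50, left associativity).

(** * Vector fields in a tangent category with negatives *)

(* Instead of the pullback T_2, only the addition of maps into the fibres of p
   is recorded; it is total, but meaningful only for x and y in the same fibre. *)
Record tancat := TanCat {
  obj : Type;
  mor : obj -> obj -> Type;
  idm : forall A, mor A A;
  comp : forall A B C, mor B C -> mor A B -> mor A C;
  Tobj : obj -> obj;
  Tmap : forall A B, mor A B -> mor (Tobj A) (Tobj B);
  tproj : forall A, mor (Tobj A) A;
  tzero : forall A, mor A (Tobj A);
  tlift : forall A, mor (Tobj A) (Tobj (Tobj A));
  tflip : forall A, mor (Tobj (Tobj A)) (Tobj (Tobj A));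
  tneg : forall A, mor (Tobj A) (Tobj A);
  tadd : forall A M, mor A (Tobj M) -> mor A (Tobj M) -> mor A (Tobj M);
  compA : forall A B C D (h : mor C D) (g : mor B C) (f : mor A B),
    comp h (comp g f) = comp (comp h g) f;
  comp1m : forall A B (f : mor A B), comp (idm B) f = f;
  compm1 : forall A B (f : mor A B), comp f (idm A) = f;
  Tm1 : forall A, Tmap (idm A) = idm (Tobj A);
  TmM : forall A B C (g : mor B C) (f : mor A B),
    Tmap (comp g f) = comp (Tmap g) (Tmap f);
  P_nat : forall A B (f : mor A B), comp (tproj B) (Tmap f) = comp f (tproj A);
  Z_nat : forall A B (f : mor A B), comp (Tmap f) (tzero A) = comp (tzero B) f;
  L_nat : forall A B (f : mor A B), comp (Tmap (Tmap f)) (tlift A) =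
    comp (tlift B) (Tmap f);
  Fl_nat : forall A B (f : mor A B),
    comp (Tmap (Tmap f)) (tflip A) = comp (tflip B) (Tmap (Tmap f));
  PZ : forall A, comp (tproj A) (tzero A) = idm A;
  TPL : forall A, comp (Tmap (tproj A)) (tlift A) = comp (tzero A) (tproj A);
  LZ : forall A, comp (tlift A) (tzero A) = comp (Tmap (tzero A)) (tzero A);
  PFl : forall A, comp (tproj (Tobj A)) (tflip A) = Tmap (tproj A);
  FlZ : forall A, comp (tflip A) (Tmap (tzero A)) = tzero (Tobj A);
  FlFl : forall A, comp (tflip A) (tflip A) = idm (Tobj (Tobj A));
  FlL : forall A, comp (tflip A) (tlift A) = tlift A;
  LL : forall A, comp (Tmap (tlift A)) (tlift A) =
    comp (tlift (Tobj A)) (tlift A);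
  FFL : forall A, comp (tflip (Tobj A)) (comp (Tmap (tflip A)) (tlift (Tobj
    A))) =
    comp (Tmap (tlift A)) (tflip A);
  FFF : forall A, comp (Tmap (tflip A)) (comp (tflip (Tobj A)) (Tmap (tflip
    A))) =
    comp (tflip (Tobj A)) (comp (Tmap (tflip A)) (tflip (Tobj A)));
  N_nat : forall A B (f : mor A B), comp (Tmap f) (tneg A) =
    comp (tneg B) (Tmap f);
  PN : forall A, comp (tproj A) (tneg A) = tproj A;
  P_add : forall A M (x y : mor A (Tobj M)), comp (tproj M) x =
    comp (tproj M) y ->
    comp (tproj M) (tadd x y) = comp (tproj M) x;
  addC : forall A M (x y : mor A (Tobj M)), comp (tproj M) x =
    comp (tproj M) y ->
    tadd x y = tadd y x;
  addA : forall A M (x y w : mor A (Tobj M)), comp (tproj M) x =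
    comp (tproj M) y ->
    comp (tproj M) y = comp (tproj M) w -> tadd (tadd x y) w =
      tadd x (tadd y w);
  addZ : forall A M (x : mor A (Tobj M)),
    tadd (comp (tzero M) (comp (tproj M) x)) x = x;
  addN : forall A M (x : mor A (Tobj M)),
    tadd (comp (tneg M) x) x = comp (tzero M) (comp (tproj M) x);
  add_comp : forall A B M (x y : mor B (Tobj M)) (f : mor A B),
    comp (tproj M) x = comp (tproj M) y ->
    comp (tadd x y) f = tadd (comp x f) (comp y f);
  Tm_addr : forall A M M' (f : mor M M') (x y : mor A (Tobj M)),
    comp (tproj M) x = comp (tproj M) y ->
    comp (Tmap f) (tadd x y) = tadd (comp (Tmap f) x) (comp (Tmap f) y);
  Tm_add : forall A M (x y : mor A (Tobj M)), comp (tproj M) x =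
    comp (tproj M) y ->
    comp (tflip M) (Tmap (tadd x y)) =
      tadd (comp (tflip M) (Tmap x)) (comp (tflip M) (Tmap y));
  L_add : forall A M (x y : mor A (Tobj M)), comp (tproj M) x =
    comp (tproj M) y ->
    comp (tlift M) (tadd x y) = tadd (comp (tlift M) x) (comp (tlift M) y);
  add_interchange : forall A M (x y x' y' : mor A (Tobj (Tobj M))),
    comp (tproj (Tobj M)) x = comp (tproj (Tobj M)) x' ->
    comp (tproj (Tobj M)) y = comp (tproj (Tobj M)) y' ->
    comp (Tmap (tproj M)) x = comp (Tmap (tproj M)) y ->
    comp (Tmap (tproj M)) x' = comp (Tmap (tproj M)) y' ->
    let add2 u v := comp (tflip M) (tadd (comp (tflip M) u) (comp (tflip M) v))
      in
    tadd (add2 x y) (add2 x' y') = add2 (tadd x x') (tadd y y');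
  lift_ex : forall A M (h : mor A (Tobj (Tobj M))),
    comp (Tmap (tproj M)) h =
      comp (tzero M) (comp (tproj M) (comp (tproj (Tobj M)) h)) ->
    exists2 k : mor A (Tobj M), comp (tproj M) k =
      comp (tproj M) (comp (tproj (Tobj M)) h)
      & comp (tflip M) (tadd (comp (tflip M) (comp (tlift M) k))
          (comp (tflip M) (comp (tzero (Tobj M)) (comp (tproj (Tobj M)) h)))) =
            h;
  lift_inj : forall A M (k k' x : mor A (Tobj M)),
    comp (tproj M) k = comp (tproj M) x -> comp (tproj M) k' =
      comp (tproj M) x ->
    comp (tflip M) (tadd (comp (tflip M) (comp (tlift M) k))
      (comp (tflip M) (comp (tzero (Tobj M)) x))) =
    comp (tflip M) (tadd (comp (tflip M) (comp (tlift M) k'))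
      (comp (tflip M) (comp (tzero (Tobj M)) x))) -> k = k'
}.
Arguments mor {_}. Arguments idm {_}. Arguments comp {_ _ _ _}.
Arguments Tobj {_}. Arguments Tmap {_ _ _}. Arguments tproj {_}. Arguments
  tzero {_}.
Arguments tlift {_}. Arguments tflip {_}. Arguments tneg {_}. Arguments tadd {_
  _ _}.

Section Tancat.
Context (C : tancat).
Local Notation To := (@Tobj C).
Local Notation Tm := (@Tmap C _ _).
Local Notation P := (@tproj C).
Local Notation Z := (@tzero C).
Local Notation L := (@tlift C).
Local Notation Fl := (@tflip C).
Local Notation N := (@tneg C).
Local Notation add := (@tadd C _ _).
Local Notation "f \@ g" := (comp f g).
Local Notation "x [+] y" := (add x y).
Implicit Types A B M : obj C.

(* Addition along the fibres of T p (add2) and of T T p (add3). *)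
Definition add2 A M (x y : mor A (To (To M))) :=
  Fl M \@ (Fl M \@ x [+] Fl M \@ y).
Local Notation "x [++] y" := (add2 x y).

Definition add3 A M (x y : mor A (To (To (To M)))) :=
  Tm (Fl M) \@ (Tm (Fl M) \@ x [++] Tm (Fl M) \@ y).
Local Notation "x [+++] y" := (add3 x y).

(** * The axioms on generalized elements *)

Section Elements.
Context (A M : obj C).

Lemma TmMx B D (g : mor B D) (f : mor M B) (x : mor A (To M)) :
  Tm (g \@ f) \@ x = Tm g \@ Tm f \@ x.
Proof. by rewrite TmM -compA. Qed.
End Elements.

Section Elements.
Context (A M : obj C).

Lemma PTx B (f : mor M B) (x : mor A (To M)) : P B \@ Tm f \@ x = f \@ P M \@ x.
Proof. by rewrite compA P_nat -compA. Qed.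
Lemma TZx B (f : mor M B) (x : mor A M) : Tm f \@ Z M \@ x = Z B \@ f \@ x.
Proof. by rewrite compA Z_nat -compA. Qed.
Lemma TLx B (f : mor M B) (x : mor A (To M)) :
  Tm (Tm f) \@ L M \@ x = L B \@ Tm f \@ x.
Proof. by rewrite compA L_nat -compA. Qed.
Lemma TFlx B (f : mor M B) (x : mor A (To (To M))) :
  Tm (Tm f) \@ Fl M \@ x = Fl B \@ Tm (Tm f) \@ x.
Proof. by rewrite compA Fl_nat -compA. Qed.
Lemma PZx (x : mor A M) : P M \@ Z M \@ x = x.
Proof. by rewrite compA PZ comp1m. Qed.
Lemma TPLx (x : mor A (To M)) : Tm (P M) \@ L M \@ x = Z M \@ P M \@ x.
Proof. by rewrite compA TPL -compA. Qed.
Lemma LZx (x : mor A M) : L M \@ Z M \@ x = Z (To M) \@ Z M \@ x.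
Proof. by rewrite compA LZ -compA TZx. Qed.
Lemma PFlx (x : mor A (To (To M))) : P (To M) \@ Fl M \@ x = Tm (P M) \@ x.
Proof. by rewrite compA PFl. Qed.
Lemma FlTZx (x : mor A (To M)) : Fl M \@ Tm (Z M) \@ x = Z (To M) \@ x.
Proof. by rewrite compA FlZ. Qed.
Lemma FlFlx (x : mor A (To (To M))) : Fl M \@ Fl M \@ x = x.
Proof. by rewrite compA FlFl comp1m. Qed.
Lemma FlZx (x : mor A (To M)) : Fl M \@ Z (To M) \@ x = Tm (Z M) \@ x.
Proof. by rewrite -FlTZx FlFlx. Qed.
Lemma FlLx (x : mor A (To M)) : Fl M \@ L M \@ x = L M \@ x.
Proof. by rewrite compA FlL. Qed.
Lemma TPFlx (x : mor A (To (To M))) : Tm (P M) \@ Fl M \@ x = P (To M) \@ x.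
Proof. by rewrite -PFlx FlFlx. Qed.
Lemma PLx (x : mor A (To M)) : P (To M) \@ L M \@ x = Z M \@ P M \@ x.
Proof. by rewrite -FlLx PFlx TPLx. Qed.
Lemma PNx (x : mor A (To M)) : P M \@ N M \@ x = P M \@ x.
Proof. by rewrite compA PN. Qed.
Lemma LLx (x : mor A (To M)) : Tm (L M) \@ L M \@ x = L (To M) \@ L M \@ x.
Proof. by rewrite !compA LL. Qed.
Lemma FFLx (x : mor A (To (To M))) :
  Fl (To M) \@ Tm (Fl M) \@ L (To M) \@ x = Tm (L M) \@ Fl M \@ x.
Proof. by rewrite (compA (Tm _)) compA FFL -compA. Qed.
Lemma FFFx (x : mor A (To (To (To M)))) :
  Tm (Fl M) \@ Fl (To M) \@ Tm (Fl M) \@ x =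
    Fl (To M) \@ Tm (Fl M) \@ Fl (To M) \@ x.
Proof. by move: (congr1 (fun f => f \@ x) (FFF M)); rewrite -!compA. Qed.
End Elements.

Section Elements.
Context (A M : obj C).

Lemma TPTZx (x : mor A (To M)) : Tm (P M) \@ Tm (Z M) \@ x = x.
Proof. by rewrite -TmMx PZ Tm1 comp1m. Qed.
Lemma TFlFlx (x : mor A (To (To (To M)))) : Tm (Fl M) \@ Tm (Fl M) \@ x = x.
Proof. by rewrite -TmMx FlFl Tm1 comp1m. Qed.

End Elements.

Section Elements.
Context (A M : obj C).

Lemma LFlx (x : mor A (To (To M))) :
  L (To M) \@ Fl M \@ x = Tm (Fl M) \@ Fl (To M) \@ Tm (L M) \@ x.
Proof.
have e : Fl M \@ Fl M \@ x = x by exact: FlFlx.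
by rewrite -{2}e -FFLx FlFlx TFlFlx.
Qed.

Lemma TZTx (x : mor A (To (To M))) :
  Tm (Z (To M)) \@ x = Fl (To M) \@ Z (To (To M)) \@ x.
Proof. by rewrite FlZx. Qed.

Lemma addr0 (x : mor A (To M)) : x [+] Z M \@ P M \@ x = x.
Proof. by rewrite addC ?PZx // addZ. Qed.

Lemma addNr (x : mor A (To M)) : x [+] N M \@ x = Z M \@ P M \@ x.
Proof. by rewrite addC ?PNx // addN. Qed.

(** Negatives give cancellation; the hypotheses put the three elements in one fibre, where the
    partial addition is meaningful. *)
Lemma addKl (x y y' : mor A (To M)) :
  P M \@ x = P M \@ y -> P M \@ x = P M \@ y' -> x [+] y = x [+] y' -> y = y'.
Proof.
move=> e e' /(congr1 (fun w => N M \@ x [+] w)).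
by rewrite -!addA ?PNx // addN {1}e e' !addZ.
Qed.

Lemma addACA (x y x' y' : mor A (To M)) : P M \@ x = P M \@ y ->
  P M \@ x = P M \@ x' -> P M \@ x = P M \@ y' ->
  (x [+] y) [+] (x' [+] y') = (x [+] x') [+] (y [+] y').
Proof.
move=> e1 e2 e3.
have e4 : P M \@ y = P M \@ x' by rewrite -e1.
have e5 : P M \@ x' = P M \@ y' by rewrite -e2.
rewrite !addA ?P_add // -?e1 //.
by rewrite -(addA e4) // (addC e4) addA // -?e1.
Qed.

End Elements.

(** * Additions along [T p] and [T T p], and their interchange laws *)

Lemma Tm_add2 A M (x y : mor A (To M)) : P M \@ x = P M \@ y ->
  Tm (x [+] y) = Tm x [++] Tm y.
Proof. by move=> e; rewrite /add2 -Tm_add // FlFlx. Qed.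

Section Add2.
Context (A M : obj C).
Implicit Types x y w : mor A (To (To M)).

Lemma Fl_add x y : Fl M \@ (x [+] y) = Fl M \@ x [++] Fl M \@ y.
Proof. by rewrite /add2 !FlFlx. Qed.

Lemma Fl_add2 x y : Fl M \@ (x [++] y) = Fl M \@ x [+] Fl M \@ y.
Proof. by rewrite /add2 !FlFlx. Qed.

Lemma TP_add2 x y : Tm (P M) \@ x = Tm (P M) \@ y ->
  Tm (P M) \@ (x [++] y) = Tm (P M) \@ x.
Proof. by move=> e; rewrite /add2 TPFlx P_add ?PFlx. Qed.

(** [p_T c = T p], and [T p] is additive for [+], as every [T f] is. *)
Lemma P_add2 x y : Tm (P M) \@ x = Tm (P M) \@ y ->
  P (To M) \@ (x [++] y) = P (To M) \@ x [+] P (To M) \@ y.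
Proof. by move=> e; rewrite /add2 PFlx Tm_addr ?TPFlx ?PFlx. Qed.

Lemma add2C x y : Tm (P M) \@ x = Tm (P M) \@ y -> x [++] y = y [++] x.
Proof. by move=> e; rewrite /add2 addC ?PFlx. Qed.

Lemma add2A x y w : Tm (P M) \@ x = Tm (P M) \@ y -> Tm (P M) \@ y =
  Tm (P M) \@ w ->
  (x [++] y) [++] w = x [++] (y [++] w).
Proof. by move=> e e'; rewrite /add2 !FlFlx addA ?PFlx. Qed.

Lemma add2Z x : Tm (Z M) \@ Tm (P M) \@ x [++] x = x.
Proof. by rewrite /add2 FlTZx -PFlx addZ FlFlx. Qed.

Lemma add2r0 x : x [++] Tm (Z M) \@ Tm (P M) \@ x = x.
Proof. by rewrite add2C ?TPTZx // add2Z. Qed.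

Lemma add2_comp B x y (f : mor B A) : Tm (P M) \@ x = Tm (P M) \@ y ->
  (x [++] y) \@ f = x \@ f [++] y \@ f.
Proof. by move=> e; rewrite /add2 -!compA add_comp -?compA // !PFlx. Qed.

Lemma TT_add2 M' (f : mor M M') x y : Tm (P M) \@ x = Tm (P M) \@ y ->
  Tm (Tm f) \@ (x [++] y) = Tm (Tm f) \@ x [++] Tm (Tm f) \@ y.
Proof. by move=> e; rewrite /add2 TFlx Tm_addr ?PFlx // !TFlx. Qed.

Lemma interchange2 x y x' y' :
  P (To M) \@ x = P (To M) \@ x' -> P (To M) \@ y = P (To M) \@ y' ->
  Tm (P M) \@ x = Tm (P M) \@ y -> Tm (P M) \@ x' = Tm (P M) \@ y' ->
  (x [++] y) [+] (x' [++] y') = (x [+] x') [++] (y [+] y').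
Proof. exact: add_interchange. Qed.

Lemma add2KR x y x' : Tm (P M) \@ x = Tm (P M) \@ y ->
  Tm (P M) \@ x' = Tm (P M) \@ y -> x [++] y = x' [++] y -> x = x'.
Proof.
move=> e e' /(congr1 (fun w => Fl M \@ w)); rewrite !Fl_add2.
rewrite addC ?PFlx // (addC (x := Fl M \@ x')) ?PFlx // => /addKl H.
by rewrite -(FlFlx x) H ?FlFlx // !PFlx.
Qed.
End Add2.

(** Naturality of z rewrites [z_T f] as [T f o z], for [f] the sum and both summands; the additivity
    of z is thus that of T in [Tm_add2]. *)
Lemma Z_add A M (x y : mor A (To M)) : P M \@ x = P M \@ y ->
  Z (To M) \@ (x [+] y) = Z (To M) \@ x [++] Z (To M) \@ y.
Proof.
by move=> e; rewrite -!Z_nat Tm_add2 // add2_comp // -!TmM e.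
Qed.

Section Add3.
Context (A M : obj C).
Implicit Types x y w : mor A (To (To (To M))).
Local Notation TTP := (Tm (Tm (P M))).

Lemma TFl_add2 x y : Tm (Fl M) \@ (x [++] y) =
  Tm (Fl M) \@ x [+++] Tm (Fl M) \@ y.
Proof. by rewrite /add3 !TFlFlx. Qed.

Lemma TFl_add3 x y : Tm (Fl M) \@ (x [+++] y) =
  Tm (Fl M) \@ x [++] Tm (Fl M) \@ y.
Proof. by rewrite /add3 !TFlFlx. Qed.

Lemma TPTFlx x : Tm (P (To M)) \@ Tm (Fl M) \@ x = TTP \@ x.
Proof. by rewrite -TmMx PFl. Qed.

Lemma TTPTFlx x : TTP \@ Tm (Fl M) \@ x = Tm (P (To M)) \@ x.
Proof. by rewrite -TPTFlx TFlFlx. Qed.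

Lemma add3_comp B x y (f : mor B A) : TTP \@ x = TTP \@ y ->
  (x [+++] y) \@ f = x \@ f [+++] y \@ f.
Proof. by move=> e; rewrite /add3 -compA add2_comp ?TPTFlx // -!compA. Qed.

Lemma TTPTTZx B (x : mor B (To (To M))) : TTP \@ Tm (Tm (Z M)) \@ x = x.
Proof. by rewrite -TmMx -TmM PZ !Tm1 comp1m. Qed.

Lemma TTP_add3 x y : TTP \@ x = TTP \@ y -> TTP \@ (x [+++] y) = TTP \@ x.
Proof. by move=> e; rewrite /add3 TTPTFlx TP_add2 ?TPTFlx. Qed.

Lemma add3C x y : TTP \@ x = TTP \@ y -> x [+++] y = y [+++] x.
Proof. by move=> e; rewrite /add3 add2C ?TPTFlx. Qed.

Lemma add3A x y w : TTP \@ x = TTP \@ y -> TTP \@ y = TTP \@ w ->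
  (x [+++] y) [+++] w = x [+++] (y [+++] w).
Proof. by move=> e e'; rewrite /add3 !TFlFlx add2A ?TPTFlx. Qed.

Lemma add3r0 x : x [+++] Tm (Tm (Z M)) \@ TTP \@ x = x.
Proof.
rewrite /add3 -TPTFlx -(TmMx (Fl M)) FlZ add2r0 ?TFlFlx //.
Qed.

Lemma add3KR x y x' : TTP \@ x = TTP \@ y -> TTP \@ x' = TTP \@ y ->
  x [+++] y = x' [+++] y -> x = x'.
Proof.
move=> e e' /(congr1 (fun w => Tm (Fl M) \@ w)); rewrite !TFl_add3 => /add2KR H.
by rewrite -(TFlFlx x) H ?TFlFlx // !TPTFlx.
Qed.

(** [T c] turns [+++] into [++] and preserves [+], so this is [interchange2] conjugated by [T c]. *)
Lemma interchange13 x y x' y' :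
  P _ \@ x = P _ \@ x' -> P _ \@ y = P _ \@ y' ->
  TTP \@ x = TTP \@ y -> TTP \@ x' = TTP \@ y' ->
  (x [+++] y) [+] (x' [+++] y') = (x [+] x') [+++] (y [+] y').
Proof.
move=> e1 e2 e3 e4.
rewrite /add3 -Tm_addr; last by rewrite !P_add2 ?TPTFlx // !PTx e1 e2.
rewrite interchange2 ?TPTFlx // ?PTx ?e1 ?e2 //.
by rewrite !Tm_addr.
Qed.

(** [c_T] exchanges the additions along p and T p but fixes the one along [T T p]: the braid
    relation moves it past the conjugation by [T c] that defines [+++]. *)
Lemma FlT_add3 x y : TTP \@ x = TTP \@ y ->
  Fl (To M) \@ (x [+++] y) = Fl (To M) \@ x [+++] Fl (To M) \@ y.
Proof.
move=> e.
have e' : Tm (P (To M)) \@ Tm (Fl M) \@ x = Tm (P (To M)) \@ Tm (Fl M) \@ y.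
  by rewrite !TPTFlx.
rewrite /add3 [in LHS]/add2 -FFFx Tm_addr; last by rewrite !PFlx.
by rewrite !FFFx /add2.
Qed.

(** [interchange13] conjugated by [c_T], which turns [++] into [+] and preserves [+++]. *)
Lemma interchange23 x y x' y' :
  Tm (P _) \@ x = Tm (P _) \@ x' -> Tm (P _) \@ y = Tm (P _) \@ y' ->
  TTP \@ x = TTP \@ y -> TTP \@ x' = TTP \@ y' ->
  (x [+++] y) [++] (x' [+++] y') = (x [++] x') [+++] (y [++] y').
Proof.
move=> e1 e2 e3 e4.
rewrite [LHS]/add2 !FlT_add3 // interchange13 ?PFlx //; last 2 first.
- by rewrite !TFlx e3.
- by rewrite !TFlx e4.
rewrite FlT_add3 //.
by rewrite !Tm_addr ?PFlx // !TFlx e3 e4.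
Qed.
End Add3.

Lemma Tm_add3 A M (x y : mor A (To (To M))) : Tm (P M) \@ x = Tm (P M) \@ y ->
  Tm (x [++] y) = Tm x [+++] Tm y.
Proof.
move=> e; rewrite {1}/add2 TmM Tm_add2 ?PFlx // TFl_add2 !TmM.
by rewrite -!TmM !FlFlx.
Qed.

(** Since [c l = l], the lift is additive from [+] both to [+] and to [++]. *)
Lemma L_add2 A M (x y : mor A (To M)) : P M \@ x = P M \@ y ->
  L M \@ (x [+] y) = L M \@ x [++] L M \@ y.
Proof. by move=> e; rewrite /add2 !FlLx -L_add // FlLx. Qed.

Section LiftAdd.
Context (A M : obj C).
Implicit Types x y : mor A (To (To M)).

Lemma LT_add3 x y : Tm (P M) \@ x = Tm (P M) \@ y ->
  L (To M) \@ (x [++] y) = L (To M) \@ x [+++] L (To M) \@ y.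
Proof.
move=> e; rewrite /add2 LFlx Tm_addr ?PFlx // Fl_add TFl_add2.
by rewrite -!LFlx !FlFlx.
Qed.

(** [FFLx] factors [T l] as [c_T (T c) l_T c], and each factor is additive. *)
Lemma TL_add3 x y : Tm (P M) \@ x = Tm (P M) \@ y ->
  Tm (L M) \@ (x [++] y) = Tm (L M) \@ x [+++] Tm (L M) \@ y.
Proof.
move=> e.
have TTPLT w : Tm (Tm (P M)) \@ L (To M) \@ w = L M \@ Tm (P M) \@ w.
  by rewrite TLx.
rewrite /add2 -FFLx L_add2 ?PFlx // TFl_add2 FlT_add3 ?FFLx ?FlFlx //.
by rewrite !TTPTFlx !TPLx !PFlx e.
Qed.

Lemma ZT_add3 x y : Tm (P M) \@ x = Tm (P M) \@ y ->
  Z _ \@ (x [++] y) = Z _ \@ x [+++] Z _ \@ y.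
Proof.
by move=> e; rewrite /add2 -TZx Z_add ?PFlx // TFl_add2 !TZx !FlFlx.
Qed.

Lemma TZ_add3 x y : Tm (P M) \@ x = Tm (P M) \@ y ->
  Tm (Z (To M)) \@ (x [++] y) = Tm (Z (To M)) \@ x [+++] Tm (Z (To M)) \@ y.
Proof.
move=> e; rewrite !TZTx ZT_add3 // FlT_add3 //.
by rewrite !TZx e.
Qed.

End LiftAdd.

(** Uniqueness of vertical components, taken at a zero base point. *)
Lemma L_inj A M (k k' : mor A (To M)) : L M \@ k = L M \@ k' -> k = k'.
Proof.
move=> e; have Pe : P M \@ k = P M \@ k'.
  by rewrite -(PZx (P M \@ k)) -PLx e PLx PZx.
apply: (@lift_inj _ _ _ k k' (Z M \@ P M \@ k)); rewrite ?PZx //.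
by rewrite e.
Qed.

(** In [T l = c_T (T c) l_T c] the flips are invertible and [l_T] is monic by [L_inj]. *)
Lemma TL_inj A M (k k' : mor A (To (To M))) : Tm (L M) \@ k = Tm (L M) \@ k' ->
  k = k'.
Proof.
rewrite -(FlFlx k) -(FlFlx k') -!FFLx.
move=> /(congr1 (fun x => Fl _ \@ x)); rewrite !FlFlx.
move=> /(congr1 (fun x => Tm (Fl _) \@ x)); rewrite !TFlFlx.
by move=> /L_inj /(congr1 (fun x => Fl _ \@ x)); rewrite !FlFlx.
Qed.

(* The vertical component k of h = l k + z x is compatible with the cells a,   *)
(* b (of two lax morphisms, or two vector fields) as soon as h and x are.      *)
Lemma vertical_compat A A' M M' (a : mor A' (To A)) (b : mor M' (To M))
    (k x : mor A (To M)) (k' x' : mor A' (To M')) :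
  P M \@ k = P M \@ x -> P M' \@ k' = P M' \@ x' ->
  Tm x \@ a = Fl M \@ Tm b \@ x' ->
  Tm (L M \@ k [++] Z (To M) \@ x) \@ a =
    Fl (To M) \@ Tm (Fl M) \@ Tm (Tm b) \@ (L M' \@ k' [++] Z (To M') \@ x') ->
  Tm k \@ a = Fl M \@ Tm b \@ k'.
Proof.
move=> e e' ex.
have c1 : Tm (P M) \@ L M \@ k =
  Tm (P M) \@ Z (To M) \@ x by rewrite TPLx TZx e.
have c2 : Tm (P M') \@ L M' \@ k' = Tm (P M') \@ Z (To M') \@ x'.
  by rewrite TPLx TZx e'.
have c3 : Tm (P (To M)) \@ L (To M) \@ Tm b \@ k' =
    Tm (P (To M)) \@ Z (To (To M)) \@ Tm b \@ x'.
  by rewrite TPLx TZx !PTx e'.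
rewrite Tm_add3 // {1}/add3 -compA add2_comp; last first.
  by rewrite -!TmM !PFlx c1.
rewrite -!compA -/(add3 _ _) TT_add2 // TLx TZx.
rewrite TFl_add2 FlT_add3; last by rewrite !TTPTFlx c3.
rewrite FFLx (TZx (Fl M)) -TZTx !TmMx ex.
have HL B (y : mor B _) : Tm (Tm (P M)) \@ Tm (L M) \@ y =
  Tm (Z M) \@ Tm (P M) \@ y.
  by rewrite -!TmMx TPL.
have HZ B (y : mor B _) :
    Tm (Tm (P M)) \@ Tm (Z (To M)) \@ y = Tm (Z M) \@ Tm (P M) \@ y.
  by rewrite -!TmMx Z_nat.
(* Both sides are now sums along [T T p] whose second summands [ex] has made equal; cancelling them
   leaves an equation under [T l], which is monic. *)
move=> /add3KR H; apply: TL_inj; apply: H.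
- by rewrite HL HZ -ex -!(TmMx (P M)) e.
- by rewrite HL HZ !TPFlx !PTx e'.
Qed.

(** The map [T s o <l w, z_T x>] of the vertical lift axiom: [w] placed vertically at the point [x]
    of its fibre. In the equation for [{h}] the base point is [p_T h]. *)
Definition vert A M (w x : mor A (To M)) := L M \@ w [++] Z (To M) \@ x.

Lemma vert_fibre A M (w x : mor A (To M)) : P M \@ w = P M \@ x ->
  Tm (P M) \@ L M \@ w = Tm (P M) \@ Z (To M) \@ x.
Proof. by move=> e; rewrite TPLx TZx e. Qed.

Lemma P_vert A M (w x : mor A (To M)) : P M \@ w = P M \@ x ->
  P (To M) \@ vert w x = x.
Proof. by move=> e; rewrite /vert P_add2 ?(vert_fibre e) // PLx PZx e addZ. Qed.

Lemma TP_vert A M (w x : mor A (To M)) : P M \@ w = P M \@ x ->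
  Tm (P M) \@ vert w x = Z M \@ P M \@ w.
Proof. by move=> e; rewrite /vert TP_add2 ?TPLx // TZx e. Qed.

Lemma vert_inj A M (w w' x : mor A (To M)) : P M \@ w = P M \@ x ->
  P M \@ w' = P M \@ x -> vert w x = vert w' x -> w = w'.
Proof. exact: lift_inj. Qed.

Lemma vert_comp A B M (w x : mor A (To M)) (f : mor B A) :
  P M \@ w = P M \@ x -> vert w x \@ f = vert (w \@ f) (x \@ f).
Proof. by move=> e; rewrite /vert add2_comp ?(vert_fibre e) // -!compA. Qed.

Lemma TT_vert A M M' (f : mor M M') (w x : mor A (To M)) : P M \@ w =
  P M \@ x ->
  Tm (Tm f) \@ vert w x = vert (Tm f \@ w) (Tm f \@ x).
Proof. by move=> e; rewrite /vert TT_add2 ?(vert_fibre e) // TLx TZx. Qed.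

(** Interchange of [+] and [++]: the lifts of [w] and [w'] add up, and the zero [z_T x] is
    idempotent. *)
Lemma vert_add A M (w w' x : mor A (To M)) : P M \@ w = P M \@ x ->
  P M \@ w' = P M \@ x -> vert w x [+] vert w' x = vert (w [+] w') x.
Proof.
move=> e e'; rewrite /vert interchange2 ?(vert_fibre e) ?(vert_fibre e') //
  ?PLx ?e ?e' //.
rewrite L_add ?e ?e' //; congr (_ [++] _).
by have := addr0 (Z (To M) \@ x); rewrite PZx.
Qed.

(** * The bracket as a strong difference *)

Section Bracket.
Context (M : obj C).
Implicit Types u v w : mor M (To M).

Definition vector_field M (u : mor M (To M)) := P M \@ u = idm M.

(* w is the strong difference of T v u and c (T u) v, both of which lie over v. *)
Definition is_bracket M (u v w : mor M (To M)) :=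
  vector_field w /\ Tm v \@ u = Fl M \@ Tm u \@ v [+] vert w v.

Section Fields.
Context (u v : mor M (To M)) (hu : vector_field u) (hv : vector_field v).

Lemma vfield_P A (x : mor A M) : P M \@ u \@ x = x.
Proof. by rewrite compA hu comp1m. Qed.

Lemma vfield_TP A (x : mor A (To M)) : Tm (P M) \@ Tm u \@ x = x.
Proof. by rewrite -TmMx hu Tm1 comp1m. Qed.
End Fields.

Lemma bracket_uniq u v w w' : vector_field u -> vector_field v ->
  is_bracket u v w -> is_bracket u v w' -> w = w'.
Proof.
move=> hu hv [hw e] [hw' e'].
have Pw : P M \@ w = P M \@ v by rewrite hw hv.
have Pw' : P M \@ w' = P M \@ v by rewrite hw' hv.
apply: (vert_inj Pw Pw'); move: e; rewrite e' => /addKl H.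
by rewrite H // P_vert // PFlx vfield_TP.
Qed.

(** Ties [is_bracket] to the definition of the Lie bracket by braces. The difference [h] lies over
    [v] and [T p] sends it to a zero, so a brace applies to it; adding [c (T u) v] back to [h] gives
    the defining relation. *)
Lemma lie_lift u v (h := Tm v \@ u [+] N _ \@ Fl M \@ Tm u \@ v) :
  vector_field u -> vector_field v ->
  Tm (P M) \@ h = Z M \@ P M \@ P _ \@ h /\
  forall w, P M \@ w = P M \@ P _ \@ h -> vert w (P _ \@ h) = h ->
    is_bracket u v w.
Proof.
move=> hu hv.
have Pf : P _ \@ Tm v \@ u = v by rewrite compA P_nat -compA hu compm1.
have Pg : P _ \@ Fl M \@ Tm u \@ v = v by rewrite PFlx vfield_TP.
have Ph : P _ \@ h = v by rewrite /h P_add ?Pf // PNx Pg.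
split=> [|w].
  rewrite Ph hv compm1 /h Tm_addr ?Pf ?PNx //.
  rewrite vfield_TP // (compA _ (N _)) N_nat -!compA TPFlx.
  by rewrite PTx hv compm1 addNr hu compm1.
rewrite Ph => Pw hw; split; first by rewrite /vector_field Pw hv.
rewrite hw /h (addC (x := Tm v \@ u)) ?Pf ?PNx // -addA ?Pf ?PNx //.
by have := addZ (Tm v \@ u); rewrite Pf addNr Pg => ->.
Qed.

Lemma bracket_exists u v : vector_field u -> vector_field v ->
  exists w, is_bracket u v w.
Proof.
move=> hu hv; have [hP H] := lie_lift hu hv.
by have [w Pw hw] := lift_ex hP; exists w; apply: H.
Qed.

Lemma bracket_comp u v w A (x : mor A M) : vector_field u -> vector_field v ->
  is_bracket u v w ->
  Tm v \@ u \@ x = Fl M \@ Tm u \@ v \@ x [+] vert (w \@ x) (v \@ x).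
Proof.
move=> hu hv [hw e]; have Pw : P M \@ w = P M \@ v by rewrite hw hv.
rewrite (compA (Tm v)) e add_comp -?vert_comp -?compA //.
by rewrite P_vert // PFlx vfield_TP.
Qed.

Lemma vf_field_add u v : vector_field u -> vector_field v ->
  vector_field (u [+] v).
Proof. by move=> hu hv; rewrite /vector_field P_add ?hu. Qed.

Lemma vf_field_opp u : vector_field u -> vector_field (N M \@ u).
Proof. by move=> hu; rewrite /vector_field PNx. Qed.

Lemma vf_field_zero : vector_field (Z M).
Proof. exact: PZ. Qed.

(** Both [T v o u] and [c (T u) v] are additive in [u] for [+], the second because c turns the [++]
    of [Tm_add2] into [+]; the vertical lifts add up because they share the base point [v]. *)
Lemma bracket_add u u' v w w' : vector_field u -> vector_field u' ->
  vector_field v -> is_bracket u v w -> is_bracket u' v w' ->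
  is_bracket (u [+] u') v (w [+] w').
Proof.
move=> hu hu' hv [hw e] [hw' e']; split; first exact: vf_field_add.
have Pu : P M \@ u = P M \@ u' by rewrite hu.
have Pw : P M \@ w = P M \@ v by rewrite hw.
have Pw' : P M \@ w' = P M \@ v by rewrite hw'.
rewrite Tm_addr // e e' Tm_add2 // add2_comp -?TmM ?Pu // Fl_add2.
rewrite -vert_add // addACA ?P_vert // !PFlx !vfield_TP //.
Qed.

(** Applying c to the relation exchanges the roles of [T v o u] and [T u o v] and turns [+] into
    [++]. Adding the vertical lift of [-w] at [u] then cancels [l w], by interchange. *)
Lemma bracket_anti u v w : vector_field u -> vector_field v ->
  is_bracket u v w -> is_bracket v u (N M \@ w).
Proof.
move=> hu hv [hw e]; split; first exact: vf_field_opp.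
have Pw : P M \@ w = P M \@ v by rewrite hw.
have eC : Fl M \@ Tm v \@ u = Tm u \@ v [++] (L M \@ w [+] Tm (Z M) \@ v).
  by rewrite e Fl_add FlFlx /vert Fl_add2 FlLx FlZx.
have Pb : P _ \@ L M \@ w = P _ \@ Tm (Z M) \@ v by rewrite PLx PTx Pw.
have Tb : Tm (P M) \@ (L M \@ w [+] Tm (Z M) \@ v) = v.
  by rewrite Tm_addr // TPLx TPTZx Pw addZ.
rewrite eC /vert (add2C (x := L M \@ N M \@ w)); last first.
  by rewrite TPLx TZx PNx hw hu.
rewrite interchange2; last 4 first.
- by rewrite PTx hv compm1 PZx.
- by rewrite P_add // !PLx PNx.
- by rewrite vfield_TP // Tb.
- by rewrite TPLx TZx PNx hw hu.
have Pa : P _ \@ Tm u \@ v = u by rewrite PTx hv compm1.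
have := addr0 (Tm u \@ v); rewrite Pa => ->.
(* [l w] and [l (-w)] cancel and leave [T z o v], which is neutral for [++]. *)
have -> : L M \@ w [+] Tm (Z M) \@ v [+] L M \@ N M \@ w = Tm (Z M) \@ v.
  rewrite addC; last by rewrite P_add // !PLx PNx.
  rewrite -addA //; last by rewrite !PLx PNx.
  rewrite -L_add ?PNx // addN LZx Pw hv compm1.
  by have := addZ (Tm (Z M) \@ v); rewrite PTx hv compm1.
by have := add2r0 (Tm u \@ v); rewrite vfield_TP.
Qed.

End Bracket.

(** [T T f] applied to the relation on [M], and the relation on [M'] precomposed with [f], share all
    terms but the vertical ones; cancellation leaves an equality of vertical lifts at the base point
    [T f o v = v' o f]. *)
Lemma bracket_nat M M' (f : mor M M') (u v w : mor M (To M)) (u' v' w' : mor M'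
  (To M')) :
  vector_field u -> vector_field v -> vector_field u' -> vector_field v' ->
  is_bracket u v w -> is_bracket u' v' w' ->
  Tm f \@ u = u' \@ f -> Tm f \@ v = v' \@ f -> Tm f \@ w = w' \@ f.
Proof.
move=> hu hv hu' hv' hb hb' eu ev.
have [hw e] := hb; have [hw' e'] := hb'.
have Pw : P M \@ w = P M \@ v by rewrite hw.
have E : Tm (Tm f) \@ Tm v \@ u = Tm v' \@ u' \@ f.
  by rewrite -TmMx ev TmMx eu.
have := bracket_comp f hu' hv' hb'; rewrite -E e.
have -> : Fl M' \@ Tm u' \@ v' \@ f = Tm (Tm f) \@ Fl M \@ Tm u \@ v.
  by rewrite TFlx -(TmMx (Tm f)) eu TmMx ev.
rewrite Tm_addr ?P_vert // ?PFlx ?vfield_TP //.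
rewrite TT_vert // -ev => /addKl H.
apply: (@vert_inj _ _ _ _ (Tm f \@ v)).
- by rewrite !PTx Pw.
- by rewrite PTx vfield_P // hv compm1.
apply: H.
- rewrite P_vert ?PTx ?Pw //.
  by rewrite PFlx vfield_TP.
- rewrite P_vert; first by rewrite !PTx PFlx vfield_TP.
  by rewrite PTx vfield_P // hv compm1.
Qed.

Section Opposite.
Context (A M : obj C).
Implicit Types x y : mor A (To M).

Lemma opp_uniq x y : P M \@ x = P M \@ y -> x [+] y = Z M \@ P M \@ x -> y =
  N M \@ x.
Proof. by move=> e; rewrite -addNr; apply: addKl; rewrite ?PNx. Qed.

Lemma oppK x : N M \@ N M \@ x = x.
Proof. by apply/esym/opp_uniq; rewrite ?PNx ?addN. Qed.

Lemma opp_add x y : P M \@ x = P M \@ y -> N M \@ (x [+] y) =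
  N M \@ x [+] N M \@ y.
Proof.
move=> e; apply/esym/opp_uniq; first by rewrite !P_add ?PNx.
rewrite addACA ?PNx // !addNr P_add // e.
by have := addZ (Z M \@ P M \@ y); rewrite PZx.
Qed.
End Opposite.

Lemma vert0 A M (x : mor A (To M)) : vert (Z M \@ P M \@ x) x = Z (To M) \@ x.
Proof.
rewrite /vert LZx -TZx.
by have := add2Z (Z (To M) \@ x); rewrite TZx.
Qed.

Lemma vert_opp A M (w x : mor A (To M)) : P M \@ w = P M \@ x ->
  vert (N M \@ w) x = N _ \@ vert w x.
Proof.
move=> e; apply: opp_uniq; first by rewrite !P_vert ?PNx.
by rewrite vert_add ?PNx // addNr P_vert // e vert0.
Qed.

Lemma bracket_addr M (u v v' w w' : mor M (To M)) : vector_field u ->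
  vector_field v ->
  vector_field v' -> is_bracket u v w -> is_bracket u v' w' ->
  is_bracket u (v [+] v') (w [+] w').
Proof.
move=> hu hv hv' hb hb'.
have [[hw _] [hw' _]] := (hb, hb').
have := bracket_add hv hv' hu (bracket_anti hu hv hb) (bracket_anti hu hv' hb').
move=> /bracket_anti; rewrite -opp_add ?hw // oppK; apply=> //.
exact: vf_field_add.
Qed.

(** * Brackets of complete and vertical lifts *)

Section Lifts.
Context (M : obj C).
Implicit Types u v w r : mor M (To M).

Definition clift u := Fl M \@ Tm u.
Definition vlift w := vert (w \@ P M) (idm (To M)).

Lemma clift_field u : vector_field u -> vector_field (clift u).
Proof. by move=> hu; rewrite /vector_field /clift PFlx -TmM hu Tm1. Qed.

Lemma vlift_fibre w : vector_field w -> P M \@ w \@ P M = P M \@ idm _.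
Proof. by move=> hw; rewrite compA hw comp1m compm1. Qed.

Lemma vlift_field w : vector_field w -> vector_field (vlift w).
Proof. by move=> hw; rewrite /vector_field P_vert // vlift_fibre. Qed.

Lemma Tm_vlift w : vector_field w ->
  Tm (vlift w) = Tm (L M) \@ Tm w \@ Tm (P M) [+++] Tm (Z (To M)).
Proof.
move=> hw; rewrite /vlift /vert Tm_add3;
  last exact: (vert_fibre (vlift_fibre hw)).
by rewrite compm1 !TmM.
Qed.

Lemma Tm_vliftx w A (x : mor A (To (To M))) : vector_field w ->
  Tm (vlift w) \@ x = Tm (L M) \@ Tm w \@ Tm (P M) \@ x [+++] Tm (Z (To M)) \@
    x.
Proof.
move=> hw; rewrite Tm_vlift // add3_comp -?compA //.
have := vert_fibre (vlift_fibre hw); rewrite compm1 => /(congr1 Tm).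
by rewrite !TmM.
Qed.

Lemma vlift_comp w A (x : mor A (To M)) : vector_field w ->
  vlift w \@ x = vert (w \@ P M \@ x) x.
Proof. by move=> hw; rewrite /vlift vert_comp ?vlift_fibre // -compA comp1m.
  Qed.

(** The relation for [u], [v], [w] after T and then [T c o c_T]. The braid relation identifies the
    flipped composites, and [LFlx] turns the remaining part into the vertical lift of [clift w] at
    [clift v]. *)
Lemma bracket_clift u v w : vector_field u -> vector_field v ->
  is_bracket u v w -> is_bracket (clift u) (clift v) (clift w).
Proof.
move=> hu hv [hw e]; split; first exact: clift_field.
have Pw : P M \@ w = P M \@ v by rewrite hw.
have Pe : P _ \@ Fl M \@ Tm u \@ v = P _ \@ vert w v.
  by rewrite PFlx vfield_TP // P_vert.
rewrite /clift TmMx TFlx -!TmM e Tm_add2 // Fl_add2.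
rewrite Tm_addr; last by rewrite !PFlx -!TmM Pe.
congr (_ [+] _).
  by rewrite !TmM -!compA FFFx TFlx.
rewrite Tm_add3 ?(vert_fibre Pw) // FlT_add3; last first.
  by rewrite -!TmM (vert_fibre Pw).
rewrite TFl_add3 !TmM -LFlx FlTZx TZx.
by [].
Qed.

Lemma TP_vlift w : vector_field w -> Tm (P M) \@ vlift w = Z M \@ P M.
Proof. by move=> hw; rewrite /vlift TP_vert ?(vlift_fibre hw) // compm1. Qed.

(** Each of the two composites is a sum along [T T p] of a part from [w], a part from [w'] and
    [z z]. One part starts with [T z_T] and the other with the zero of [T T M], which [c_T]
    exchanges. *)
Lemma bracket_vlift w w' : vector_field w -> vector_field w' ->
  is_bracket (vlift w) (vlift w') (Z (To M)).
Proof.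
move=> hw hw'; split; first exact: vf_field_zero.
have E x x' : vector_field x -> vector_field x' -> Tm (vlift x') \@ vlift x =
    Z _ \@ L M \@ x' \@ P M [+++]
    (Tm (Z _) \@ L M \@ x \@ P M [+++] Z _ \@ Z _).
  move=> hx hx'; rewrite Tm_vliftx // TP_vlift // (TZx x') TZx.
  congr (_ [+++] _).
  rewrite /vlift /vert compm1 TZ_add3; last first.
    by have := vert_fibre (vlift_fibre hx); rewrite compm1.
  by rewrite -Z_nat.
have hv := vlift_field hw; have hv' := vlift_field hw'.
have := vert0 (vlift w'); rewrite hv' compm1 => ->.
have := addr0 (Fl _ \@ Tm (vlift w) \@ vlift w').
rewrite PFlx (vfield_TP hv) => ->; rewrite !E //.
have E1 x : vector_field x ->
    Tm (Tm (P M)) \@ Z _ \@ L M \@ x \@ P M = Z _ \@ Z _ \@ P M.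
  by move=> hx; rewrite TZx TPLx vfield_P.
have E2 x : vector_field x ->
    Tm (Tm (P M)) \@ Tm (Z _) \@ L M \@ x \@ P M = Z _ \@ Z _ \@ P M.
  move=> hx; rewrite -TmMx Z_nat TmMx TPLx vfield_P //.
  by rewrite TZx.
have E3 : Tm (Tm (P M)) \@ Z _ \@ Z (To M) = Z _ \@ Z _ \@ P M.
  by rewrite TZx Z_nat.
rewrite !FlT_add3 ?TTP_add3 ?E1 ?E2 ?E3 //.
rewrite !FlTZx !FlZx Z_nat.
rewrite -!add3A ?E1 ?E2 ?E3 //.
by rewrite (add3C (x := Tm _ \@ _)) // ?E1 ?E2.
Qed.

(** With [a], [b], [A] as in the proof, the claim is [(a + b) +++ A = (a +++ A) + (b +++ z p A)], an
    instance of interchange since [z p A] is neutral for [+]. The sum [a + b] is the relation for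
    [u], [w], [r] lifted by [T l]. *)
Lemma bracket_clift_vlift u w r : vector_field u -> vector_field w ->
  is_bracket u w r -> is_bracket (clift u) (vlift w) (vlift r).
Proof.
move=> hu hw hb; have [hr e] := hb; split; first exact: vlift_field.
rewrite Tm_vliftx //.
have -> : Tm (L M) \@ Tm w \@ Tm (P M) \@ clift u =
   Tm (L M) \@ Fl M \@ Tm u \@ w \@ P M [+] Tm (L M) \@ vert (r \@ P M) (w \@ P
     M).
  rewrite /clift TPFlx P_nat (bracket_comp (P M) hu hw hb).
  by rewrite Tm_addr // P_vert ?PFlx ?vfield_TP // !compA hr hw.
have -> : Fl _ \@ Tm (clift u) \@ vlift w =
   Tm (L M) \@ Fl M \@ Tm u \@ w \@ P M [+++] Tm (Z _) \@ clift u.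
  rewrite /clift TmMx TT_vert ?(vlift_fibre hw) // /vert TFl_add2 FlT_add3.
    by rewrite FFLx TZx FlZx compm1.
  by rewrite !TTPTFlx (vert_fibre (x := Tm u \@ idm _)) // !PTx vlift_fibre.
set a := Tm (L M) \@ Fl M \@ Tm u \@ w \@ P M.
set b := Tm (L M) \@ vert _ _.
set A := Tm (Z _) \@ clift u.
have Prw : P M \@ r \@ P M = P M \@ w \@ P M by rewrite !compA hr hw.
have PA : P _ \@ A = Z _ by rewrite PTx clift_field // compm1.
have bE : b = L (To M) \@ L M \@ r \@ P M [+++] Z _ \@ L M \@ w \@ P M.
  by rewrite /b /vert TL_add3 ?(vert_fibre Prw) // LLx TZx.
have E1 : Tm (Tm (P M)) \@ L (To M) \@ L M \@ r \@ P M = Z _ \@ Z _ \@ P M.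
  by rewrite TLx TPLx vfield_P // LZx.
have E2 : Tm (Tm (P M)) \@ Z _ \@ L M \@ w \@ P M = Z _ \@ Z _ \@ P M.
  by rewrite TZx TPLx vfield_P.
have E3 : Tm (Tm (P M)) \@ Z _ \@ Z (To M) = Z _ \@ Z _ \@ P M.
  by rewrite TZx Z_nat.
have Tb : Tm (Tm (P M)) \@ b = Z _ \@ Z _ \@ P M.
  by rewrite bE TTP_add3 E1 ?E2.
have Ta : Tm (Tm (P M)) \@ a = Tm (Tm (P M)) \@ A.
  rewrite -(TmMx (Tm _)) TPL TmMx TPFlx PTx vfield_P //.
  by rewrite -(TmMx (Tm _)) Z_nat TmMx TPFlx P_nat.
have -> : vert (vlift r) (vlift w) = b [+++] Z _ \@ P _ \@ A.
  have vE x : vector_field x -> vlift x = L M \@ x \@ P M [++] Z (To M).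
    by rewrite /vlift /vert compm1.
  have fE x : vector_field x -> Tm (P M) \@ L M \@ x \@ P M =
    Tm (P M) \@ Z (To M).
    by move=> hx; have := vert_fibre (vlift_fibre hx); rewrite compm1.
  rewrite PA bE add3A ?E1 ?E2 ?E3 // -ZT_add3 ?fE // -vE //.
  rewrite /vert {1}vE // LT_add3 ?fE // -(compm1 (Z (To M))) LZx compm1.
  set Y := Z _ \@ vlift w.
  have TPY : Tm (P _) \@ Y = Z (To M) by rewrite TZx vlift_field // compm1.
  have TTPY : Tm (Tm (P M)) \@ Y = Z _ \@ Z _ \@ P M by rewrite TZx TP_vlift.
  (* [Y] is written as a zero of [+++] plus [Y], so that interchange applies; each of the two
     resulting [++] then has a neutral summand. *)
  have {1}<- : Tm (Tm (Z M)) \@ Tm (Tm (P M)) \@ Y [+++] Y = Y.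
    rewrite add3C ?add3r0 //.
    by rewrite TTPTTZx.
  rewrite interchange23; last 4 first.
  - rewrite TPLx PLx vfield_P // TTPY.
    by rewrite -(TmMx (P _)) P_nat TmMx (TZx (P M)) PZx TZx.
  - by rewrite TZx PZ compm1 TPY.
  - by rewrite E1 E3.
  - by rewrite TTPTTZx.
  congr (_ [+++] _).
    have := add2r0 (L (To M) \@ L M \@ r \@ P M).
    by rewrite TPLx PLx vfield_P // TTPY !TZx.
  by have := add2Z Y; rewrite TPY -Z_nat.
have := interchange13 (x := a) (y := A) (x' := b) (y' := Z _ \@ P _ \@ A).
rewrite addr0 => ->; rewrite ?PZx // ?Ta //.
- rewrite /a /b !PTx P_vert // PFlx vfield_TP //.
- by rewrite Tb PA E3.
Qed.

End Lifts.

(** * The derivation property and the Jacobi identity *)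

Section LieIdentities.
Context (M : obj C).
Implicit Types u v w x y : mor M (To M).

Lemma bracket_zero v : vector_field v -> is_bracket (Z M) v (Z M).
Proof.
move=> hv; split; first exact: vf_field_zero.
rewrite Z_nat FlTZx; have := vert0 v; rewrite hv compm1 => ->.
by have := addr0 (Z _ \@ v); rewrite PZx => ->.
Qed.

Lemma field_addN u : vector_field u -> u [+] N M \@ u = Z M.
Proof. by move=> hu; rewrite addNr hu compm1. Qed.

(** [[u,v] + [u,-v] = [u,0] = 0], where the last equality comes from [bracket_zero] by
    antisymmetry. *)
Lemma bracket_oppr u v w : vector_field u -> vector_field v ->
  is_bracket u v w -> is_bracket u (N M \@ v) (N M \@ w).
Proof.
move=> hu hv hb; have [hw _] := hb.
have hz := @vf_field_zero M.
have [w' hb'] := bracket_exists hu (vf_field_opp hv); have [hw' _] := hb'.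
have := bracket_addr hu hv (vf_field_opp hv) hb hb'.
rewrite field_addN // => hb0.
have hbz : is_bracket u (Z M) (Z M).
  have := bracket_anti hz hu (bracket_zero hu).
  suff -> : N M \@ Z M = Z M by [].
  by have := addZ (N M \@ Z M); rewrite PNx PZ compm1 field_addN.
have := bracket_uniq hu hz hb0 hbz.
rewrite -(compm1 (Z M)) -{1}hw => /opp_uniq <- //.
by rewrite hw hw'.
Qed.

Lemma bracket_derivation u1 u2 v a b c d e f : vector_field u1 ->
  vector_field u2 -> vector_field v ->
  is_bracket u1 v a -> is_bracket u2 v b -> is_bracket u1 u2 c ->
  is_bracket c v d -> is_bracket u1 b e -> is_bracket u2 a f ->
  d = e [+] N M \@ f.
Proof.
move=> h1 h2 hv ha hb hc hd he hf.
have [fa _] := ha; have [fb _] := hb; have [fc _] := hc.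
have [fd _] := hd; have [fe _] := he; have [ff _] := hf.
have rel u r : vector_field u -> is_bracket u v r ->
    Tm v \@ u = (clift u [+] vlift r) \@ v.
  move=> hu hr; have [fr ->] := hr.
  rewrite add_comp ?clift_field ?vlift_field // vlift_comp //.
  by rewrite hv compm1 /clift -compA.
have fX u r : vector_field u -> vector_field r ->
  vector_field (clift u [+] vlift r).
  by move=> hu hr; apply: vf_field_add; [apply: clift_field|apply: vlift_field].
(* Expanding both sums: [[u1^c,u2^c] = c^c], [[a^vert,u2^c] = -f^vert] by antisymmetry,
   [[u1^c,b^vert] = e^vert] and [[a^vert,b^vert] = 0]. *)
have bX : is_bracket (clift u1 [+] vlift a) (clift u2 [+] vlift b)
    ((clift c [+] N _ \@ vlift f) [+] (vlift e [+] Z _)).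
  have c1 := clift_field h1; have c2 := clift_field h2.
  have va := vlift_field fa; have vb := vlift_field fb.
  apply: bracket_addr => //; first exact: fX.
  - apply: bracket_add => //; first exact: bracket_clift.
    by apply: bracket_anti => //; apply: bracket_clift_vlift.
  - apply: bracket_add => //; last exact: bracket_vlift.
    exact: bracket_clift_vlift.
have := bracket_nat h1 h2 (fX _ _ h1 fa) (fX _ _ h2 fb) hc bX (rel _ _ h1 ha)
  (rel _ _ h2 hb).
rewrite (rel _ _ fc hd).
have fvf := vlift_field ff; have fve := vlift_field fe;
  have fvd := vlift_field fd.
have fvn := vf_field_opp fvf.
have fcc := clift_field fc; have fz := @vf_field_zero (To M).
have -> : vlift e [+] Z _ = vlift e.
  by have := addr0 (vlift e); rewrite fve compm1.
rewrite addA ?fcc ?fvn ?fve // !add_comp ?P_add ?fcc ?fvn ?fve ?fvd //.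
(* Naturality along [v] is compared with the relation defining [d]: the complete lift of [c]
   cancels, and the vertical lifts, evaluated at [v], all have base point [v]. *)
move=> /addKl H.
have Pv (y : mor (To M) _) : vector_field y -> P (To M) \@ y \@ v =
  v by move=> hy; rewrite vfield_P.
rewrite P_add ?Pv // in H; have {H} := H erefl erefl.
have Pf x : vector_field x -> P M \@ x = P M \@ v by rewrite hv.
rewrite -compA !vlift_comp // hv !compm1 -vert_opp ?Pf // vert_add ?PNx ?Pf //.
move=> /vert_inj -> //; rewrite ?Pf //; first by rewrite addC ?PNx ?Pf.
by apply: vf_field_add => //; apply: vf_field_opp.
Qed.

Lemma jacobi x y w xy xyw wx wxy yw ywx :
  vector_field x -> vector_field y -> vector_field w ->
  is_bracket x y xy -> is_bracket xy w xyw ->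
  is_bracket w x wx -> is_bracket wx y wxy ->
  is_bracket y w yw -> is_bracket yw x ywx ->
  xyw [+] wxy [+] ywx = Z M.
Proof.
move=> hx hy hw h1 h2 h3 h4 h5 h6.
have [f2 _] := h2; have [f3 _] := h3; have [f4 _] := h4.
have [f5 _] := h5; have [f6 _] := h6.
(* The derivation formula is used for [x], [y], [w], with [[x,w] = -wx], [[y,-wx] = wxy] and [[x,yw]
   = -ywx]. *)
have h3' := bracket_anti hw hx h3.
have := bracket_oppr hy f3 (bracket_anti f3 hy h4); rewrite oppK => h4'.
have h6' := bracket_anti f5 hx h6.
rewrite (bracket_derivation hx hy hw h3' h5 h1 h2 h6' h4').
have zz : Z M \@ P M \@ wxy = Z M \@ P M \@ N M \@ ywx by rewrite PNx f4 f6.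
by rewrite (addA (y := N M \@ wxy) (w :=
  wxy)) ?PNx ?f4 ?f6 // addN zz addr0 addN f6 compm1.
Qed.
End LieIdentities.

End Tancat.

(** * The tangent category K(Y, X) *)

Section Cells.
Context (K : two_category) (X : tangentad K) (n : negatives X) (Y : K).
Local Notation T := (tT X).
Implicit Types A F G H : ob (Hom Y X).

(** Arrows typed by source and target, as [tancat] asks; by [cell_eq] equality is that of the
    underlying arrows, so the untyped laws of K apply. *)
Definition cell F G := {a : arr (Hom Y X) | arrow a F G}.

Definition Cell F G (a : arr (Hom Y X)) (h : arrow a F G) : cell F G :=
  exist (fun a => arrow a F G) a h.

Lemma cell_eq F G (a b : cell F G) : sval a = sval b -> a = b.
Proof. by case: a b => a ha [b hb] /= e; apply: eq_exist. Qed.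

Lemma dom_cell F G (a : cell F G) : dom (sval a) = F.
Proof. by case: a => a []. Qed.

Lemma cod_cell F G (a : cell F G) : cod (sval a) = G.
Proof. by case: a => a []. Qed.
Hint Rewrite dom_cell cod_cell : cell.

Lemma vcmp_arrow F G H (b : cell G H) (a : cell F G) : arrow (sval b \v sval a)
  F H.
Proof. by split; dc. Qed.
Definition vcmp F G H (b : cell G H) (a : cell F G) : cell F H :=
  Cell (vcmp_arrow b a).
Local Notation "b \@ a" := (vcmp b a).

Lemma idc_arrow F : arrow (idt F) F F. Proof. by split; dc. Qed.
Definition idc F : cell F F := Cell (idc_arrow F).

Lemma Tcell_arrow F G (a : cell F G) : arrow (T \wl sval a) (T \c F) (T \c G).
Proof. by split; dc. Qed.
Definition Tcell F G (a : cell F G) : cell (T \c F) (T \c G) :=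
  Cell (Tcell_arrow a).

Lemma T2cell_arrow F G (a : cell F G) :
  arrow (tTn X 2 \wl sval a) (tTn X 2 \c F) (tTn X 2 \c G).
Proof. by split; dc. Qed.
Definition T2cell F G (a : cell F G) : cell (tTn X 2 \c F) (tTn X 2 \c G) :=
  Cell (T2cell_arrow a).

Lemma pcell_arrow F : arrow (tp X \wr F) (T \c F) F. Proof. by split; dc. Qed.
Definition pcell F : cell (T \c F) F := Cell (pcell_arrow F).

Lemma zcell_arrow F : arrow (tz X \wr F) F (T \c F). Proof. by split; dc. Qed.
Definition zcell F : cell F (T \c F) := Cell (zcell_arrow F).

Lemma lcell_arrow F : arrow (tl X \wr F) (T \c F) (T \c (T \c F)).
Proof. by split; dc. Qed.
Definition lcell F : cell (T \c F) (T \c (T \c F)) := Cell (lcell_arrow F).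

Lemma ccell_arrow F : arrow (tc X \wr F) (T \c (T \c F)) (T \c (T \c F)).
Proof. by split; dc. Qed.
Definition ccell F : cell (T \c (T \c F)) (T \c (T \c F)) :=
  Cell (ccell_arrow F).

Lemma ncell_arrow F : arrow (n \wr F) (T \c F) (T \c F).
Proof. by have [d c] := tn_arrow n; split; dc; rewrite ?d ?c. Qed.
Definition ncell F : cell (T \c F) (T \c F) := Cell (ncell_arrow F).

Lemma picell_arrow i F : arrow (@tpi _ _ X 2 i \wr F) (tTn X 2 \c F) (T \c F).
Proof. by split; dc. Qed.
Definition picell i F : cell (tTn X 2 \c F) (T \c F) := Cell (picell_arrow i F).

Lemma scell_arrow F : arrow (ts X \wr F) (tTn X 2 \c F) (T \c F).
Proof. by split; dc. Qed.
Definition scell F : cell (tTn X 2 \c F) (T \c F) := Cell (scell_arrow F).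

Lemma vcmpA A F G H (h : cell G H) (g : cell F G) (f : cell A F) :
  h \@ (g \@ f) = (h \@ g) \@ f.
Proof. by apply: cell_eq; rewrite /= cmpA //; dc. Qed.

Lemma vcmp1l F G (f : cell F G) : idc G \@ f = f.
Proof. by apply: cell_eq; rewrite /= cmp_idl' //; dc. Qed.

Lemma vcmp1r F G (f : cell F G) : f \@ idc F = f.
Proof. by apply: cell_eq; rewrite /= cmp_idr' //; dc. Qed.

Lemma Tcell1 F : Tcell (idc F) = idc (T \c F).
Proof. by apply: cell_eq; rewrite /= hcmp_idt. Qed.

Lemma TcellM F G H (g : cell G H) (f : cell F G) : Tcell (g \@ f) =
  Tcell g \@ Tcell f.
Proof. by apply: cell_eq; rewrite /= wl_cmp //; dc. Qed.

Lemma whisker_nat (B B' : ob (Hom X X)) (a : arr (Hom X X)) F G (f : cell F G) :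
  arrow a B B' -> (B' \wl sval f) \v (a \wr F) = (a \wr G) \v (B \wl sval f).
Proof. by move=> ha; rewrite (swap (svalP f) ha). Qed.

Lemma pcell_nat F G (f : cell F G) : pcell G \@ Tcell f = f \@ pcell F.
Proof.
apply: cell_eq; rewrite /= -(whisker_nat f (tp_arrow X)).
by rewrite hcmp_idl.
Qed.

Lemma zcell_nat F G (f : cell F G) : Tcell f \@ zcell F = zcell G \@ f.
Proof.
apply: cell_eq; rewrite /= (whisker_nat f (tz_arrow X)).
by rewrite hcmp_idl.
Qed.

Lemma lcell_nat F G (f : cell F G) : Tcell (Tcell f) \@ lcell F =
  lcell G \@ Tcell f.
Proof. by apply: cell_eq; rewrite /= wl_wl (whisker_nat f (tl_arrow X)). Qed.

Lemma ccell_nat F G (f : cell F G) :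
  Tcell (Tcell f) \@ ccell F = ccell G \@ Tcell (Tcell f).
Proof. by apply: cell_eq; rewrite /= wl_wl (whisker_nat f (tc_arrow X)). Qed.

Lemma ncell_nat F G (f : cell F G) : Tcell f \@ ncell F = ncell G \@ Tcell f.
Proof. by apply: cell_eq; rewrite /= (whisker_nat f (tn_arrow n)). Qed.

Lemma scell_nat F G (f : cell F G) : Tcell f \@ scell F = scell G \@ T2cell f.
Proof. by apply: cell_eq; rewrite /= (whisker_nat f (ts_arrow X)). Qed.

Lemma picell_nat i F G (f : cell F G) : Tcell f \@ picell i F =
  picell i G \@ T2cell f.
Proof. by apply: cell_eq; rewrite /= (whisker_nat f (pi_arrow X i)). Qed.

Lemma pz_cell F : pcell F \@ zcell F = idc F.
Proof. by apply: cell_eq; rewrite /= -wr_cmp ?pz ?hcmp_idt ?comp1_idl //;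
  dc. Qed.

Lemma Tpl_cell F : Tcell (pcell F) \@ lcell F = zcell F \@ pcell F.
Proof. by apply: cell_eq; rewrite /= wl_wr -!wr_cmp ?lp //; dc. Qed.

Lemma lz_cell F : lcell F \@ zcell F = Tcell (zcell F) \@ zcell F.
Proof. by apply: cell_eq; rewrite /= wl_wr -!wr_cmp ?lz //; dc. Qed.

Lemma pc_cell F : pcell (T \c F) \@ ccell F = Tcell (pcell F).
Proof. by apply: cell_eq; rewrite /= wl_wr -wr_wr -wr_cmp ?cp //; dc. Qed.

Lemma cz_cell F : ccell F \@ Tcell (zcell F) = zcell (T \c F).
Proof. by apply: cell_eq; rewrite /= wl_wr -wr_wr -wr_cmp ?cz //; dc. Qed.

Lemma cc_cell F : ccell F \@ ccell F = idc (T \c (T \c F)).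
Proof. by apply: cell_eq; rewrite /= -wr_cmp ?cc ?hcmp_idt ?comp1A //; dc. Qed.

Lemma cl_cell F : ccell F \@ lcell F = lcell F.
Proof. by apply: cell_eq; rewrite /= -wr_cmp ?cl //; dc. Qed.

Lemma ll_cell F : Tcell (lcell F) \@ lcell F = lcell (T \c F) \@ lcell F.
Proof. by apply: cell_eq; rewrite /= wl_wr -wr_wr -!wr_cmp ?ll //; dc. Qed.

Lemma ccl_cell F : ccell (T \c F) \@ (Tcell (ccell F) \@ lcell (T \c F)) =
  Tcell (lcell F) \@ ccell F.
Proof.
apply: cell_eq; rewrite /= !wl_wr -!wr_wr -!wr_cmp; try by dc.
by rewrite ccl.
Qed.

Lemma ccc_cell F :
  Tcell (ccell F) \@ (ccell (T \c F) \@ Tcell (ccell F)) =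
  ccell (T \c F) \@ (Tcell (ccell F) \@ ccell (T \c F)).
Proof.
apply: cell_eq; rewrite /= !wl_wr -!wr_wr -!wr_cmp; try by dc.
by rewrite ccc.
Qed.

Lemma pn_cell F : pcell F \@ ncell F = pcell F.
Proof.
have [d c] := tn_arrow n.
by apply: cell_eq; rewrite /= -wr_cmp ?tn_p //; dc; rewrite c.
Qed.

Lemma ppi_cell i j F : pcell F \@ picell i F = pcell F \@ picell j F.
Proof.
apply: cell_eq; rewrite /= -!wr_cmp; try by dc.
by rewrite (p_tpi X i) (p_tpi X j).
Qed.

Lemma ps_cell F : pcell F \@ scell F = pcell F \@ picell k1 F.
Proof. by apply: cell_eq; rewrite /= -!wr_cmp ?ps //; dc. Qed.

Lemma pair_cell_ex A F (x y : cell A (T \c F)) : pcell F \@ x = pcell F \@ y ->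
  exists m : cell A (tTn X 2 \c F), picell k1 F \@ m = x /\ picell k2 F \@ m =
    y.
Proof.
move=> /(congr1 (fun a => sval a)) /= e.
have [Am e1 e2] := pair_T2P (svalP x) (svalP y) e.
by exists (Cell Am); split; apply: cell_eq.
Qed.

Lemma pair_cell_inj A F (m m' : cell A (tTn X 2 \c F)) :
  picell k1 F \@ m = picell k1 F \@ m' -> picell k2 F \@ m =
    picell k2 F \@ m' -> m = m'.
Proof.
move=> /(congr1 (fun a => sval a)) /= e1 /(congr1 (fun a => sval a)) /= e2.
apply: cell_eq; apply: (pullback_inj (T2_pb X F) (svalP m) (svalP m')).
exact: ord2P.
Qed.

Lemma TT2_pb F : is_nfold_pullback (T \wl (tp X \wr F)) (T \c (tTn X 2 \c F))
  (fun i => T \wl (@tpi _ _ X 2 i \wr F)).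
Proof.
move: (@Tn_pullback _ _ X 2 isT Y F 1); rewrite /= comp1_idr comp1A wl_wr.
by under [in X in _ -> X]eq_fun => i do rewrite wl_wr.
Qed.

Lemma Tpair_cell_ex A F (x y : cell A (T \c (T \c F))) :
  Tcell (pcell F) \@ x = Tcell (pcell F) \@ y ->
  exists m : cell A (T \c (tTn X 2 \c F)),
    Tcell (picell k1 F) \@ m = x /\ Tcell (picell k2 F) \@ m = y.
Proof.
move=> /(congr1 (fun a => sval a)) /= e.
have Ax (w : cell A (T \c (T \c F))) : arrow (sval w) A (dom (T \wl (tp X \wr
  F))).
  by split; dc.
have [Am e1 e2] := pair_arrP (TT2_pb F) (Ax x) (Ax y) e.
by exists (Cell Am); split; apply: cell_eq.
Qed.

Lemma Tpair_cell_inj A F (m m' : cell A (T \c (tTn X 2 \c F))) :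
  Tcell (picell k1 F) \@ m = Tcell (picell k1 F) \@ m' ->
  Tcell (picell k2 F) \@ m = Tcell (picell k2 F) \@ m' -> m = m'.
Proof.
move=> /(congr1 (fun a => sval a)) /= e1 /(congr1 (fun a => sval a)) /= e2.
apply: cell_eq; apply: (pullback_inj (TT2_pb F) (svalP m) (svalP m')).
exact: ord2P.
Qed.

(* Meaningful only when x and y lie in the same fibre of p.                   *)
Definition cadd A F (x y : cell A (T \c F)) : cell A (T \c F) :=
  if pselect (arrow (add_T X F (sval x) (sval y)) A (T \c F)) is left e
  then Cell e else x.

(** Two cells in one fibre are the components of some [m] into T_2 F, by [pair_cell_ex]. On such a
    pair the addition is [s o m], which reduces laws of [cadd] to equations between structure
    cells. *)
Lemma caddE A F (m : cell A (tTn X 2 \c F)) :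
  cadd (picell k1 F \@ m) (picell k2 F \@ m) = scell F \@ m.
Proof.
have e : add_T X F (sval (picell k1 F \@ m)) (sval (picell k2 F \@ m)) =
  sval (scell F \@ m).
  rewrite /add_T /=; congr (_ \v _).
  apply: (@pair_T2 _ _ _ X F A) => //; try exact: (svalP m).
  - exact: (svalP (picell k1 F \@ m)).
  - exact: (svalP (picell k2 F \@ m)).
rewrite /cadd; case: pselect => [h|[]]; first by apply: cell_eq.
by rewrite e; exact: (svalP (scell F \@ m)).
Qed.

Lemma sval_cadd A F (x y : cell A (T \c F)) : pcell F \@ x = pcell F \@ y ->
  sval (cadd x y) = add_T X F (sval x) (sval y).
Proof.
move=> e; rewrite /cadd; case: pselect => // -[].
apply: (add_T_arrow (svalP x) (svalP y)).
by move: e => /(congr1 (fun a => sval a)).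
Qed.

Lemma pcadd A F (x y : cell A (T \c F)) : pcell F \@ x = pcell F \@ y ->
  pcell F \@ cadd x y = pcell F \@ x.
Proof. by move=> /pair_cell_ex[m [<- <-]]; rewrite caddE !vcmpA ps_cell. Qed.

Lemma caddC A F (x y : cell A (T \c F)) : pcell F \@ x = pcell F \@ y ->
  cadd x y = cadd y x.
Proof.
move=> e; apply: cell_eq; rewrite !sval_cadd // (add_TC (svalP x) (svalP y)) //.
by move: e => /(congr1 (fun a => sval a)).
Qed.

Lemma caddA A F (x y w : cell A (T \c F)) : pcell F \@ x = pcell F \@ y ->
  pcell F \@ y = pcell F \@ w -> cadd (cadd x y) w = cadd x (cadd y w).
Proof.
move=> e e'; apply: cell_eq; rewrite !sval_cadd ?pcadd ?e //.
apply: (add_TA (svalP x) (svalP y) (svalP w)).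
- by move: e => /(congr1 (fun a => sval a)).
- by move: e' => /(congr1 (fun a => sval a)).
Qed.

Lemma caddZ A F (x : cell A (T \c F)) : cadd (zcell F \@ (pcell F \@ x)) x = x.
Proof.
apply: cell_eq; rewrite sval_cadd /=; last by rewrite !vcmpA pz_cell vcmp1l.
exact: (add0T (svalP x)).
Qed.

Lemma cadd_comp A B F (x y : cell B (T \c F)) (f : cell A B) :
  pcell F \@ x = pcell F \@ y -> cadd x y \@ f = cadd (x \@ f) (y \@ f).
Proof. by move=> /pair_cell_ex[m [<- <-]]; rewrite -!vcmpA !caddE -vcmpA. Qed.

Lemma caddN A F (x : cell A (T \c F)) :
  cadd (ncell F \@ x) x = zcell F \@ (pcell F \@ x).
Proof.
have [dn cn] := tn_arrow n.
have [||| [dw cw] w1 w2] := pair_arrP (@Tn_pb0 _ _ X 2 isT) (x := n)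
  (y := idt T) (A := T); try by split; dc.
  by rewrite tn_p cmp_idr' //; dc.
have := tn_s n; set w := pair_arr _ _ _ in dw cw w1 w2 * => ws.
have Aw : arrow (w \wr F) (T \c F) (tTn X 2 \c F) by split; dc; rewrite ?dw ?cw.
have e1 : picell k1 F \@ Cell Aw = ncell F.
  by apply: cell_eq; rewrite /= -wr_cmp ?w1 // cw; dc.
have e2 : picell k2 F \@ Cell Aw = idc (T \c F).
  by apply: cell_eq; rewrite /= -wr_cmp ?w2 ?hcmp_idt // cw; dc.
rewrite -{2}(vcmp1l x) -e1 -e2 -!vcmpA caddE !vcmpA; congr (_ \@ _).
by apply: cell_eq; rewrite /= -!wr_cmp ?ws //; dc; rewrite cw.
Qed.

Lemma Tcell_caddr A F G (f : cell F G) (x y : cell A (T \c F)) :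
  pcell F \@ x = pcell F \@ y ->
  Tcell f \@ cadd x y = cadd (Tcell f \@ x) (Tcell f \@ y).
Proof.
move=> /pair_cell_ex[m [<- <-]].
by rewrite caddE !vcmpA !picell_nat scell_nat -!vcmpA caddE.
Qed.

(** [q] is the comparison [T T_2 => T_2 T] with components [c o T pi_k], the pairing that occurs in
    the axiom for [c] and [s]. *)
Lemma ccell_T2 F : exists q : cell (T \c (tTn X 2 \c F)) (tTn X 2 \c (T \c F)),
  [/\ picell k1 (T \c F) \@ q = ccell F \@ Tcell (picell k1 F),
      picell k2 (T \c F) \@ q = ccell F \@ Tcell (picell k2 F)
    & ccell F \@ Tcell (scell F) = scell (T \c F) \@ q].
Proof.
have Aq : arrow (lax_pair (T_lax X) \wr F) (T \c (tTn X 2 \c F)) (tTn X 2 \c (T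
  \c F)).
  by split; dc.
have pq i : picell i (T \c F) \@ Cell Aq = ccell F \@ Tcell (picell i F).
  apply: cell_eq; rewrite /= -wr_wr wl_wr -!wr_cmp; try by dc.
  by rewrite (lax_pairP (T_lax X)).2.
exists (Cell Aq); split=> //.
apply: cell_eq; rewrite /= -wr_wr wl_wr -!wr_cmp; try by dc.
by rewrite (lax_s' (T_lax X)).
Qed.

Lemma ccell_Ts A F (m : cell A (T \c (tTn X 2 \c F))) :
  ccell F \@ (Tcell (scell F) \@ m) =
  cadd (ccell F \@ (Tcell (picell k1 F) \@ m)) (ccell F \@ (Tcell (picell k2 F)
    \@ m)).
Proof.
have [q [e1 e2 e3]] := ccell_T2 F.
by rewrite !vcmpA e3 -e1 -e2 -!vcmpA caddE.
Qed.

Lemma Tcell_cadd A F (x y : cell A (T \c F)) : pcell F \@ x = pcell F \@ y ->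
  ccell F \@ Tcell (cadd x y) = cadd (ccell F \@ Tcell x) (ccell F \@ Tcell y).
Proof. by move=> /pair_cell_ex[m [<- <-]]; rewrite caddE !TcellM ccell_Ts. Qed.

(** The axiom for [l] and [s] expresses additivity from [+] to the addition along [T p]; since
    [c l = l], composing with c gives additivity for [+]. *)
Lemma lcell_cadd A F (x y : cell A (T \c F)) : pcell F \@ x = pcell F \@ y ->
  lcell F \@ cadd x y = cadd (lcell F \@ x) (lcell F \@ y).
Proof.
move=> /pair_cell_ex[m [<- <-]]; rewrite caddE.
have Al i : arrow (tl X \v @tpi _ _ X 2 i) (tTn X 2) (dom (T \wl tp X)).
  by split; dc.
have [|[dw cw] w1 w2] := pair_arrP (@Tn_pbT _ _ X 2 isT) (Al k1) (Al k2).
  rewrite !cmpA; try by dc.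
  rewrite lp -!cmpA; try by dc.
  by rewrite (p_tpi X k2).
have := ls X; set w := pair_arr _ _ _ in dw cw w1 w2 * => ws.
have Aw : arrow (w \wr F) (tTn X 2 \c F) (T \c (tTn X 2 \c F)).
  by split; dc; rewrite ?dw ?cw; dc.
have e1 : Tcell (picell k1 F) \@ Cell Aw = lcell F \@ picell k1 F.
  by apply: cell_eq; rewrite /= wl_wr -!wr_cmp ?w1 //; dc; rewrite cw.
have e2 : Tcell (picell k2 F) \@ Cell Aw = lcell F \@ picell k2 F.
  by apply: cell_eq; rewrite /= wl_wr -!wr_cmp ?w2 //; dc; rewrite cw.
have e3 : lcell F \@ scell F = Tcell (scell F) \@ Cell Aw.
  by apply: cell_eq; rewrite /= wl_wr -!wr_cmp ?ws //; dc; rewrite cw; dc.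
rewrite vcmpA -[lcell F in
  LHS]cl_cell -vcmpA -vcmpA (vcmpA (lcell F)) e3 -!vcmpA.
by rewrite ccell_Ts !(vcmpA (Tcell _)) e1 e2 -!vcmpA !(vcmpA (ccell F)) cl_cell.
Qed.

(** [T s] is the addition along [T p], that is [add2] of the abstract setting. *)
Lemma Ts_cadd A F (m : cell A (T \c (tTn X 2 \c F))) :
  Tcell (scell F) \@ m =
  ccell F \@ cadd (ccell F \@ (Tcell (picell k1 F) \@ m))
                  (ccell F \@ (Tcell (picell k2 F) \@ m)).
Proof. by rewrite -ccell_Ts vcmpA cc_cell vcmp1l. Qed.

(** The two values of [add2] on the left are [T s o m] and [T s o m'] for pairs [m], [m'] into T T_2
    F. As every [T f] is additive for [+], both sides are [T s] of the sum of [m] and [m']. *)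
Lemma cadd_interchange A F (x y x' y' : cell A (T \c (T \c F))) :
  pcell (T \c F) \@ x = pcell (T \c F) \@ x' ->
  pcell (T \c F) \@ y = pcell (T \c F) \@ y' ->
  Tcell (pcell F) \@ x = Tcell (pcell F) \@ y ->
  Tcell (pcell F) \@ x' = Tcell (pcell F) \@ y' ->
  let add2 u v := ccell F \@ cadd (ccell F \@ u) (ccell F \@ v) in
  cadd (add2 x y) (add2 x' y') = add2 (cadd x x') (cadd y y').
Proof.
move=> e1 e2 /Tpair_cell_ex[m [mx my]] /Tpair_cell_ex[m' [mx' my']] /=.
move: e1 e2; rewrite -mx -my -mx' -my' !vcmpA !pcell_nat -!vcmpA => e1 e2.
have e3 : pcell (tTn X 2 \c F) \@ m = pcell (tTn X 2 \c F) \@ m'.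
  by apply: pair_cell_inj.
by rewrite -!Ts_cadd -!Tcell_caddr // -Ts_cadd.
Qed.

(** Expresses the top side of the vertical lift square through [cadd], in the form that [tancat]
    uses for its vertical lift axioms. *)
Lemma nu_cell F : exists2 nu : cell (tTn X 2 \c F) (T \c (T \c F)),
  sval nu = ((T \wl ts X) \v pair_arr (fun i => T \wl @tpi _ _ X 2 i)
      (tl X \v tpi X k1) ((tz X \wr T) \v tpi X k2)) \wr F &
  forall A (m : cell A (tTn X 2 \c F)), nu \@ m =
    ccell F \@ cadd (ccell F \@ (lcell F \@ (picell k1 F \@ m)))
      (ccell F \@ (zcell (T \c F) \@ (picell k2 F \@ m))).
Proof.
have A1 : arrow (tl X \v @tpi _ _ X 2 k1) (tTn X 2) (dom (T \wl tp X)).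
  by split; dc.
have A2 : arrow ((tz X \wr T) \v @tpi _ _ X 2 k2) (tTn X 2) (dom (T \wl tp X)).
  by split; dc.
have [|[dw cw] w1 w2] := pair_arrP (@Tn_pbT _ _ X 2 isT) A1 A2.
  rewrite !cmpA; try by dc.
  rewrite lp (z_nat (tp_arrow X)) -!cmpA; try by dc.
  by rewrite hcmp_idr (p_tpi X k2).
set w := pair_arr _ _ _ in dw cw w1 w2 *.
have Aw : arrow (w \wr F) (tTn X 2 \c F) (T \c (tTn X 2 \c F)).
  by split; dc; rewrite ?dw ?cw; dc.
have e1 : Tcell (picell k1 F) \@ Cell Aw = lcell F \@ picell k1 F.
  by apply: cell_eq; rewrite /= wl_wr -!wr_cmp ?w1 //; dc; rewrite cw.
have e2 : Tcell (picell k2 F) \@ Cell Aw = zcell (T \c F) \@ picell k2 F.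
  by apply: cell_eq; rewrite /= -wr_wr wl_wr -!wr_cmp ?w2 //; dc; rewrite cw.
exists (Tcell (scell F) \@ Cell Aw) => [|A m].
  by rewrite /= wl_wr -wr_cmp //; dc; rewrite cw.
by rewrite -vcmpA Ts_cadd !(vcmpA (Tcell _)) e1 e2 -!vcmpA.
Qed.

Lemma Tp_ccell A F (x : cell A (T \c (T \c F))) :
  Tcell (pcell F) \@ (ccell F \@ x) = pcell (T \c F) \@ x.
Proof. by rewrite -pc_cell -!vcmpA (vcmpA (ccell F)) cc_cell vcmp1l. Qed.

Section Nu.
Context (A F : ob (Hom Y X)) (k x : cell A (T \c F)).
Context (e : pcell F \@ k = pcell F \@ x).

Lemma nu_fibre : pcell (T \c F) \@ (ccell F \@ (lcell F \@ k)) =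
  pcell (T \c F) \@ (ccell F \@ (zcell (T \c F) \@ x)).
Proof.
by rewrite !(vcmpA (pcell _)) pc_cell !(vcmpA (Tcell _)) Tpl_cell zcell_nat
  -!vcmpA e.
Qed.

Lemma pnu_cell : pcell (T \c F) \@ (ccell F \@ cadd (ccell F \@ (lcell F \@ k))
    (ccell F \@ (zcell (T \c F) \@ x))) = x.
Proof.
rewrite vcmpA pc_cell Tcell_caddr; last exact: nu_fibre.
rewrite !Tp_ccell (vcmpA (pcell _) (zcell _)) pz_cell vcmp1l.
by rewrite -{1}cl_cell !vcmpA pc_cell Tpl_cell -!vcmpA e caddZ.
Qed.

Lemma Tpnu_cell : Tcell (pcell F) \@ (ccell F \@ cadd (ccell F \@ (lcell F \@
  k))
    (ccell F \@ (zcell (T \c F) \@ x))) = zcell F \@ (pcell F \@ k).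
Proof.
rewrite Tp_ccell pcadd; last exact: nu_fibre.
by rewrite !vcmpA pc_cell Tpl_cell.
Qed.
End Nu.

(** The pullback gives [m] into T_2 F, whose first component is the vertical part. The square
    records only [p] of the base point; that the base point is [p_T h] itself comes from
    [pnu_cell]. *)
Lemma lift_cell_ex A F (h : cell A (T \c (T \c F))) :
  Tcell (pcell F) \@ h = zcell F \@ (pcell F \@ (pcell (T \c F) \@ h)) ->
  exists2 k : cell A (T \c F), pcell F \@ k = pcell F \@ (pcell (T \c F) \@ h) &
    ccell F \@ cadd (ccell F \@ (lcell F \@ k))
      (ccell F \@ (zcell (T \c F) \@ (pcell (T \c F) \@ h))) = h.
Proof.
move=> /(congr1 (fun a => sval a)) /= eh.
have [nu enu nuE] := nu_cell F.
have [_ _ _ _ /(_ (sval h) (sval (pcell F \@ (pcell (T \c F) \@ h))))] :=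
  vertical_lift X F.
case=> [||||m [[[dm cm] m1 m2] _]]; rewrite ?wl_wr //; try by dc.
  by rewrite -wl_wr.
have Am : arrow m A (tTn X 2 \c F) by split; rewrite ?dm ?cm; dc.
have e1 : nu \@ Cell Am = h by apply: cell_eq; rewrite /= enu.
have e2 : pcell F \@ (picell k1 F \@ Cell Am) =
  pcell F \@ (pcell (T \c F) \@ h).
  apply: cell_eq; rewrite -[RHS]m2 /= cmpA -?wr_cmp //; dc; exact: Am.2.
exists (picell k1 F \@ Cell Am) => //.
move: e1; rewrite nuE => e1; rewrite -[RHS]e1.
have e3 := pnu_cell (k := picell k1 F \@ Cell Am) (x := picell k2 F \@ Cell Am).
rewrite -{1}e1 e3 // !vcmpA; congr (_ \@ _); exact: ppi_cell.
Qed.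

(** The pairs [(k, x)] and [(k', x)] are cells into T_2 F with the same two projections in the
    vertical lift square, hence equal. *)
Lemma lift_cell_inj A F (k k' x : cell A (T \c F)) :
  pcell F \@ k = pcell F \@ x -> pcell F \@ k' = pcell F \@ x ->
  ccell F \@ cadd (ccell F \@ (lcell F \@ k)) (ccell F \@ (zcell (T \c F) \@
    x)) =
  ccell F \@ cadd (ccell F \@ (lcell F \@ k')) (ccell F \@ (zcell (T \c F) \@
    x)) ->
  k = k'.
Proof.
have [nu enu nuE] := nu_cell F.
move=> /pair_cell_ex[m [mk mx]] /pair_cell_ex[m' [mk' mx']] e.
have {}e : nu \@ m = nu \@ m' by rewrite !nuE mk mk' mx mx' e.
rewrite -mk -mk'; congr (_ \@ _).
have e2 : pcell F \@ (picell k1 F \@ m) = pcell F \@ (picell k1 F \@ m').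
  by rewrite !vcmpA !(ppi_cell k1 k2) -!vcmpA mx mx'.
have [_ _ _ _ /(_ (sval (nu \@ m)) (sval (pcell F \@ (picell k1 F \@ m))))] :=
  vertical_lift X F.
case=> [||||m0 [_ um]].
- by dc.
- by dc.
- by dc.
- have := Tpnu_cell (k := picell k1 F \@ m) (x := picell k2 F \@ m).
  rewrite -nuE => /(_ _)/(congr1 (fun a => sval a)) /=; rewrite wl_wr; apply.
  by rewrite !vcmpA (ppi_cell k1 k2).
have Q (a : cell A (tTn X 2 \c F)) : nu \@ a = nu \@ m ->
    pcell F \@ (picell k1 F \@ a) = pcell F \@ (picell k1 F \@ m) -> m0 =
      sval a.
  move=> /(congr1 (fun a => sval a)) /= ea /(congr1 (fun a => sval a)) /= ea'.
  apply: um; split.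
  - by split; dc.
  - by rewrite /= -ea enu.
  - rewrite /= -ea' cmpA ?wr_cmp //; dc.
by apply: cell_eq; rewrite -(Q m) // -(Q m').
Qed.

Definition cell_tancat : tancat := @TanCat (ob (Hom Y X)) cell idc vcmp
  (comp1 T) Tcell pcell zcell lcell ccell ncell cadd vcmpA vcmp1l vcmp1r
  Tcell1 TcellM pcell_nat zcell_nat lcell_nat ccell_nat pz_cell Tpl_cell
  lz_cell pc_cell cz_cell cc_cell cl_cell ll_cell ccl_cell ccc_cell ncell_nat
  pn_cell pcadd caddC caddA caddZ caddN cadd_comp Tcell_caddr Tcell_cadd
  lcell_cadd cadd_interchange lift_cell_ex lift_cell_inj.

End Cells.

(** * The universal property of VF on plain objects *)

Section Trivial.
Context (K : two_category) (Y : K).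
Local Notation i := (idt (id1 Y)).

Lemma const_pullback (C : category) (A : ob C) n : 0 < n ->
  is_nfold_pullback (idt A) A (fun _ : 'I_n => idt A).
Proof.
case: n => // n _; split=> // [_|B f Af ef]; first by split;
  rewrite ?dom_idt ?cod_idt.
have Af' k : arrow (f k) B A by have := Af k; rewrite dom_idt.
have ff k : f k = f ord0.
  by have := ef k ord0; rewrite !cmp_idl' //; [case: (Af' ord0)|case: (Af' k)].
exists (f ord0); split=> [|m [Am mP]].
  by split=> // k; rewrite cmp_idl' ?ff //; case: (Af' ord0).
by rewrite -(mP ord0) cmp_idl' //; case: Am.
Qed.

Lemma const_pair (C : category) (A : ob C) :
  pair_arr (fun _ : 'I_2 => idt A) (idt A) (idt A) = idt A.
Proof.
by apply: (pair_arr_eq (A := A) (@const_pullback C A 2 isT));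
  rewrite ?cmp_idl' ?cod_idt //;
  split; rewrite ?dom_idt ?cod_idt.
Qed.

Lemma pow1_id m : pow1 (id1 Y) m = id1 Y.
Proof. by elim: m => //= m ->; rewrite comp1_idl. Qed.

Lemma idt1_v : i \v i = i. Proof. by rewrite cmp_idl' ?cod_idt. Qed.
Lemma idt1_h : i \h i = i. Proof. by rewrite hcmp_idl. Qed.

Lemma idt1_arrow : arrow i (id1 Y) (id1 Y).
Proof. by split; rewrite ?dom_idt ?cod_idt. Qed.

Lemma idt1_arrow2 : arrow i (id1 Y) (id1 Y \c id1 Y).
Proof. by rewrite comp1_idl; exact: idt1_arrow. Qed.

Lemma idt1_arrow22 : arrow i (id1 Y \c id1 Y) (id1 Y \c id1 Y).
Proof. by rewrite comp1_idl; exact: idt1_arrow. Qed.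

Definition trivial_structure : tangent_structure Y.
Proof.
apply: (@TangentStructure K Y (id1 Y) i (fun _ => id1 Y) (fun _ _ => i) i i i i
    idt1_arrow idt1_arrow idt1_arrow idt1_arrow2 idt1_arrow22);
  rewrite /= ?idt1_h ?const_pair ?idt1_v ?const_pair ?idt1_v ?comp1_idl //.
- move=> n n0 Z F m; rewrite pow1_id !hcmp_idl comp1_idl comp1_idl.
  exact: const_pullback.
- move=> Z F; rewrite ?const_pair ?idt1_v !hcmp_idl.
  split; rewrite ?dom_idt ?cod_idt //; first by split;
    rewrite ?dom_idt ?cod_idt.
  move=> x y dxy cx cy; rewrite !cmp_idl' // => exy.
  exists x; split=> [|m [[dm cm] mx _]].
    by split; rewrite ?cmp_idl' //; split.
  by rewrite -mx cmp_idl'.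
Defined.

Definition trivial_tangentad : tangentad K := Tangentad trivial_structure.
End Trivial.

Section TrivialLax.
Context (K : two_category) (Y : K) (X : tangentad K).
Local Notation triv := (trivial_tangentad Y).
Implicit Types F G : ob (Hom Y X).

Section Lax.
Context (F : ob (Hom Y X)).
Local Notation zF := (tz X \wr F).

Lemma wl_idt1 : F \wl idt (id1 Y) = idt F. Proof. exact: hcmp_idr. Qed.

Lemma triv_arrow : arrow zF (F \c id1 Y) (tT X \c F). Proof. by split; dc. Qed.

Lemma triv_p : (tp X \wr F) \v zF = F \wl idt (id1 Y).
Proof. by rewrite wl_idt1 -wr_cmp ?pz ?hcmp_idt ?comp1_idl //; dc. Qed.

Lemma triv_z : zF \v (F \wl idt (id1 Y)) = zF.
Proof. by rewrite wl_idt1 cmp_idr' //; dc. Qed.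

(** The axiom here says [0 + 0 = 0], an instance of [add0T]. *)
Lemma triv_s : zF \v (F \wl idt (id1 Y)) = (ts X \wr F) \v
  pair_arr (fun i => @tpi _ _ X 2 i \wr F)
    (zF \v (F \wl idt (id1 Y))) (zF \v (F \wl idt (id1 Y))).
Proof.
have Az : arrow zF F (tT X \c F) by split; dc.
by have := add0T Az; rewrite triv_p triv_z => /esym.
Qed.

Lemma triv_l : (tl X \wr F) \v zF =
  (tT X \wl zF) \v (zF \wr id1 Y) \v (F \wl idt (id1 Y)).
Proof.
rewrite wl_idt1 hcmp_idr (cmp_idr' (A := F)); last by dc.
by rewrite wl_wr -!wr_cmp ?lz //; dc.
Qed.

Lemma triv_c : (tc X \wr F) \v (tT X \wl zF) \v (zF \wr id1 Y) =
  (tT X \wl zF) \v (zF \wr id1 Y) \v (F \wl idt (id1 Y)).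
Proof.
rewrite wl_idt1 hcmp_idr (cmp_idr' (A := F)); last by dc.
rewrite !wl_wr -!wr_cmp; try by dc.
rewrite cmpA; try by dc.
by have := z_nat (tz_arrow X); rewrite hcmp_idr cz => ->.
Qed.

Definition triv_lax : lax_morphism triv X :=
  @LaxMorphism K triv X F zF triv_arrow triv_p triv_z triv_s triv_l triv_c.
End Lax.

(** The zero of the trivial structure is an identity, so the axiom [lax_z] forces the cell; this is
    why lax morphisms out of it are mere 1-cells. *)
Lemma triv_cell (F : lax_morphism triv X) : lax_cell F = tz X \wr F.
Proof.
have := lax_z F; rewrite /= hcmp_idr cmp_idr' //.
by have [/= -> _] := lax_arrow F; rewrite comp1_idr.
Qed.

Lemma triv_lax_eq (F G : lax_morphism triv X) : lax_ob F = lax_ob G -> F = G.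
Proof. by move=> e; apply: lax_eq => //; rewrite !triv_cell e. Qed.

Lemma triv_nat (F G : lax_morphism triv X) a : arrow a F G ->
  (tT X \wl a) \v lax_cell F = lax_cell G \v (a \wr tT triv).
Proof.
move=> Aa; rewrite !triv_cell /= (hcmp_idr (a : arr (Hom Y X))).
by rewrite -(swap Aa (tz_arrow X)) hcmp_idl.
Qed.

Definition triv_tcell (F G : lax_morphism triv X) a (h : arrow a F G) :
  tangent_cell triv X := TangentCell h (triv_nat h).
End TrivialLax.

Section Classify.
Context (K : two_category) (X : tangentad K) (D : vf_construction X).
Local Notation V := (VF D).
Local Notation U := (lax_ob (strict_lax (vfU D))).
Local Notation v := (tcell (vfv D)).

Lemma vfv_arrow : arrow v U (tT X \c U).
Proof.
have [[/= d c] _] := vfvP D.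
by split; rewrite ?dom_tcell ?cod_tcell ?d ?c.
Qed.

Lemma vfv_p : (tp X \wr U) \v v = idt U.
Proof.
have [[d c] /(congr1 (fun a : tangent_cell _ _ => tcell a))] := vfvP D.
move: d c => /= d c.
have [|_ _ ->] := @cmp_tcellE _ _ _ (hcmp_tcell (p_cell X) (id_tcell (vfU D)))
  (vfv D).
  by rewrite c.
by [].
Qed.

Lemma Gamma_inj (Y : tangentad K) (H H' : lax_morphism Y V) :
  comp_lax (vfU D) H = comp_lax (vfU D) H' -> v \wr H = v \wr H' -> H = H'.
Proof.
move=> eU ev; have [G [GK _ _ _]] := vfP D Y.
apply: (can_inj GK); apply: vf_object_eq => //=.
have [[/= d c] _] := vfvP D.
by apply: tcell_eq => //=; rewrite ?d ?c ?comp_laxA // -!comp_laxA eU.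
Qed.

Lemma Gamma_surj (Y : tangentad K) (M : lax_morphism Y X) (w : tangent_cell Y
  X) :
  is_vector_field (hom_tangent Y X) M w -> exists H : lax_morphism Y V,
    corresponds H M w.
Proof.
move=> hw; have [G [_ GK _ _]] := vfP D Y.
by exists (fob G (VFObject hw)); rewrite /corresponds GK.
Qed.

Section Plain.
Context (Y : K).
Local Notation triv := (trivial_tangentad Y).

Lemma VF_inj (H H' : ob (Hom Y V)) : U \c H = U \c H' -> v \wr H = v \wr H' ->
  H = H'.
Proof.
move=> eU ev; suff: triv_lax H = triv_lax H' by move=> /(congr1 (fun F =>
  lax_ob F)).
by apply: Gamma_inj => //; apply: triv_lax_eq.
Qed.

Lemma VF_surj (M : ob (Hom Y X)) w : arrow w M (tT X \c M) ->
  (tp X \wr M) \v w = idt M ->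
  exists H : ob (Hom Y V), U \c H = M /\ v \wr H = w.
Proof.
move=> Aw pw.
pose W := @triv_tcell _ Y X (triv_lax M) (comp_lax (T_lax X) (triv_lax M)) w Aw.
have hW : is_vector_field (hom_tangent triv X) (triv_lax M) W.
  split=> //; apply: tcell_eq.
  - by have [] := @cmp_tcellE _ _ _ (hcmp_tcell (p_cell X) (id_tcell (triv_lax
    M))) W.
  - have [|_ -> _] := @cmp_tcellE _ _ _ (hcmp_tcell (p_cell X) (id_tcell
    (triv_lax M))) W => //=.
    by rewrite comp_lax_idl.
  - by have [|_ _ ->] := @cmp_tcellE _ _ _ (hcmp_tcell (p_cell X) (id_tcell
    (triv_lax M))) W.
have [H [/= e1 e2]] := Gamma_surj hW.
exists (lax_ob H); split; first by move: e1 => /(congr1 (fun F => lax_ob F)).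
by move: e2 => /(congr1 (fun a : tangent_cell _ _ => tcell a)).
Qed.

Lemma VF_faithful (a a' : arr (Hom Y V)) : dom a = dom a' -> cod a = cod a' ->
  U \wl a = U \wl a' -> a = a'.
Proof.
move=> ed ec eU; have [G [_ _ GK _]] := vfP D triv.
have A : arrow a (triv_lax (dom a)) (triv_lax (cod a)) by [].
have A' : arrow a' (triv_lax (dom a)) (triv_lax (cod a)) by split.
suff : triv_tcell A = triv_tcell A'.
  by move=> /(congr1 (fun a : tangent_cell _ _ => tcell a)).
by apply: (can_inj GK); apply: vf_morphism_eq => //=; apply: tcell_eq.
Qed.

(** The cell is the preimage under Gamma of [f] seen as a morphism of vector fields; its source and
    target are [H] and [H'] since the inverse of Gamma cancels on objects. *)
Lemma VF_full (H H' : ob (Hom Y V)) f : arrow f (U \c H) (U \c H') ->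
  (tT X \wl f) \v (v \wr H) = (v \wr H') \v f ->
  exists a, arrow a H H' /\ U \wl a = f.
Proof.
move=> Af ef; have [G [GK KG GaK KGa]] := vfP D triv.
pose F := @triv_tcell _ Y X (comp_lax (vfU D) (triv_lax H)) (comp_lax (vfU D)
  (triv_lax H')) f Af.
pose Gm := fob (Gamma (vfvP D) triv).
have [[/= dv cv] _] := vfvP D.
have AF : @arrow (hom_tng triv X) F (vf_ob (Gm (triv_lax H))) (vf_ob (Gm
  (triv_lax H'))).
  by [].
have eF : farr (o_T (hom_tangent triv X)) F \v vf_arr (Gm (triv_lax H)) =
    vf_arr (Gm (triv_lax H')) \v F.
  have [|d1 c1 e1] := @cmp_tcellE _ _ _ (hcmp_tcell (id_tcell (T_lax X)) F)
    (hcmp_tcell (vfv D) (id_tcell (triv_lax H))).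
    by rewrite /= cv -comp_laxA.
  have [|d2 c2 e2] := @cmp_tcellE _ _ _ (hcmp_tcell (vfv D) (id_tcell (triv_lax
    H'))) F.
    by rewrite /= dv.
  apply: tcell_eq; rewrite /= ?d1 ?c1 ?d2 ?c2 ?e1 ?e2 //=.
  - by rewrite dv.
  - by rewrite cv comp_laxA.
pose m := VFMorphism AF eF.
have Gd : tdom (farr G m) = triv_lax H.
  by have := dom_farr G m; rewrite /= => ->; rewrite -[RHS]GK.
have Gc : tcod (farr G m) = triv_lax H'.
  by have := cod_farr G m; rewrite /= => ->; rewrite -[RHS]GK.
exists (tcell (farr G m)); split.
  by have := tcell_arrow (farr G m); rewrite Gd Gc.
have := KGa m => /(congr1 (@vf_mor _ _)) /(congr1 (fun a : tangent_cell _ _ =>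
  tcell a)).
by [].
Qed.
End Plain.
End Classify.

#[global] Hint Rewrite dom_cell cod_cell : cell.

(** * Precomposition with a 1-cell preserves brackets *)

Section WhiskerCells.
Context (K : two_category) (X : tangentad K) (n : negatives X) (Y Y' : K).
Context (G : ob (Hom Y' Y)).
Local Notation T := (tT X).
Local Notation "b \@ a" := (vcmp b a).
Local Notation tcY := (cell_tancat n Y).
Local Notation tcY' := (cell_tancat n Y').
Implicit Types A F : ob (Hom Y X).

Lemma whT_arrow A F (a : cell A (T \c F)) : arrow (sval a \wr G) (A \c G) (T \c
  (F \c G)).
Proof. by have [d c] := svalP a; split; dc; rewrite ?d ?c; dc. Qed.
Definition whT A F (a : cell A (T \c F)) := Cell (whT_arrow a).

Lemma whTT_arrow A F (a : cell A (T \c (T \c F))) :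
  arrow (sval a \wr G) (A \c G) (T \c (T \c (F \c G))).
Proof. by have [d c] := svalP a; split; dc; rewrite ?d ?c; dc. Qed.
(** The same underlying arrow as [whT], with its target associated as [T (T (F G))]: associativity
    of 1-cells is an equation, not a conversion, and [ccell] and [vert] need this form. *)
Definition whTT A F (a : cell A (T \c (T \c F))) := Cell (whTT_arrow a).

Section Ops.
Context (A F F' : ob (Hom Y X)).

Lemma whTT_T (f : cell F (T \c F')) (x : cell A (T \c F)) :
  whTT (Tcell f \@ x) = Tcell (whT f) \@ whT x.
Proof.
have [d c] := svalP x; have [d' c'] := svalP f.
by apply: cell_eq; rewrite /= wr_cmp ?wl_wr //; dc; rewrite d' c.
Qed.

Lemma whTT_c (x : cell A (T \c (T \c F))) :
  whTT (ccell F \@ x) = ccell (F \c G) \@ whTT x.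
Proof.
have [d c] := svalP x.
by apply: cell_eq; rewrite /= wr_cmp ?wr_wr //; dc; rewrite c; dc.
Qed.

Lemma whTT_l (x : cell A (T \c F)) :
  whTT (lcell F \@ x) = lcell (F \c G) \@ whT x.
Proof.
have [d c] := svalP x.
by apply: cell_eq; rewrite /= wr_cmp ?wr_wr //; dc; rewrite c; dc.
Qed.

Lemma whTT_z (x : cell A (T \c F)) :
  whTT (zcell (T \c F) \@ x) = zcell (T \c (F \c G)) \@ whT x.
Proof.
have [d c] := svalP x.
by apply: cell_eq; rewrite /= wr_cmp ?wr_wr ?comp1A //; dc; rewrite c; dc.
Qed.

Lemma wh_fibre (x y : cell A (T \c F)) : pcell F \@ x = pcell F \@ y ->
  pcell (F \c G) \@ whT x = pcell (F \c G) \@ whT y.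
Proof.
move=> /(congr1 (fun a => sval a \wr G)) /= e.
have [d c] := svalP x; have [d' c'] := svalP y.
apply: cell_eq; move: e; rewrite /= !wr_cmp ?wr_wr //.
- by rewrite c'; dc.
- by rewrite c; dc.
Qed.

Lemma whT_add (x y : cell A (T \c F)) : pcell F \@ x = pcell F \@ y ->
  whT (cadd x y) = cadd (whT x) (whT y).
Proof.
move=> /pair_cell_ex[m [<- <-]]; rewrite caddE.
have [d c] := svalP m.
have Am : arrow (sval m \wr G) (A \c G) (tTn X 2 \c (F \c G)).
  by split; dc; rewrite ?d ?c; dc.
have e i : whT (picell i F \@ m) = picell i (F \c G) \@ Cell Am.
  by apply: cell_eq; rewrite /= wr_cmp ?wr_wr //; dc; rewrite c.
rewrite !e caddE; by apply: cell_eq; rewrite /= wr_cmp ?wr_wr //; dc; rewrite c.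
Qed.
End Ops.

Lemma whTT_whT A F (a : cell A (T \c (T \c F))) : sval (whTT a) = sval (whT a).
Proof. by []. Qed.

Lemma whTT_add A F (x y : cell A (T \c (T \c F))) :
  pcell (T \c F) \@ x = pcell (T \c F) \@ y ->
  whTT (cadd x y) = cadd (whTT x) (whTT y).
Proof.
move=> e; apply: cell_eq; rewrite whTT_whT whT_add // !sval_cadd.
- by rewrite /= [T \c (F \c G)]comp1A.
- apply: cell_eq; have := congr1 (fun a => sval a) (wh_fibre e).
  by rewrite /= [T \c (F \c G)]comp1A.
- exact: wh_fibre.
Qed.

Lemma wh_field F (u : cell F (T \c F)) : vector_field (C := tcY) u ->
  vector_field (C := tcY') (whT u).
Proof.
move=> /(congr1 (fun a => sval a \wr G)) /=; rewrite hcmp_idt => e.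
have [d c] := svalP u.
by apply: cell_eq; rewrite /= -[RHS]e wr_cmp ?wr_wr //; dc; rewrite c.
Qed.

Lemma whTT_vert A F (w x : cell A (T \c F)) : pcell F \@ w = pcell F \@ x ->
  whTT (vert (C := tcY) w x) = vert (C := tcY') (whT w) (whT x).
Proof.
move=> e; rewrite /vert /add2 /= whTT_c whTT_add; last exact: nu_fibre.
by rewrite !whTT_c whTT_l whTT_z.
Qed.

Lemma wh_bracket F (u v w : cell F (T \c F)) :
  vector_field (C := tcY) u -> vector_field (C := tcY) v ->
  is_bracket (C := tcY) u v w ->
  is_bracket (C := tcY') (whT u) (whT v) (whT w).
Proof.
move=> hu hv [hw e]; split; first exact: wh_field.
have Pw : pcell F \@ w = pcell F \@ v := eq_trans hw (esym hv).
move/(congr1 (@whTT _ _)): e; rewrite /= whTT_T => ->.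
rewrite whTT_add; first by rewrite whTT_c whTT_T whTT_vert.
apply: eq_trans (esym (P_vert (C := tcY) Pw)).
exact: eq_trans (PFlx (C := tcY) (Tcell u \@ v)) (vfield_TP (C := tcY) hu v).
Qed.
End WhiskerCells.

(** * Vector fields and brackets of tangent cells *)

Section TngPair.
Context (K : two_category) (Y X : tangentad K).
Local Notation T := (tT X).

Lemma tcell_cmp (b a : tangent_cell Y X) (F G H : lax_morphism Y X) :
  tdom a = F -> tcod a = G -> tdom b = G -> tcod b = H ->
  [/\ tdom (cmp_tcell b a) = F, tcod (cmp_tcell b a) = H
    & tcell (cmp_tcell b a) = tcell b \v tcell a].
Proof. by move=> <- ca db <-; apply: cmp_tcellE; rewrite ca. Qed.

(* Pairings of tangent cells are computed in K: the pairing in K is tangent   *)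
(* because T preserves the pullback.                                          *)
Lemma tng_pair (pr : 'I_2 -> tangent_cell Y X) (E B A : lax_morphism Y X) q q'
    (x y : tangent_cell Y X) :
  (forall i, tdom (pr i) = E) -> (forall i, tcod (pr i) = B) ->
  dom q = lax_ob B ->
  is_nfold_pullback q (lax_ob E) (fun i => tcell (pr i)) ->
  is_nfold_pullback q' (T \c E) (fun i => T \wl tcell (pr i)) ->
  tdom x = A -> tcod x = B -> tdom y = A -> tcod y = B ->
  q \v tcell x = q \v tcell y ->
  let m := @pair_arr (hom_tng Y X) pr x y in
  [/\ tdom m = A, tcod m = E & tcell m = pair_arr (fun i => tcell (pr i)) x y].
Proof.
move=> dpr cpr dq pb pbT dx cx dy cy qxy.
have Ax : arrow (tcell x) A (dom q) by rewrite dq -dx -cx; exact: tcell_arrow.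
have Ay : arrow (tcell y) A (dom q) by rewrite dq -dy -cy; exact: tcell_arrow.
have [Am m1 m2] := pair_arrP pb Ax Ay qxy.
set m0 := pair_arr _ _ _ in Am m1 m2 *.
have [dm cm] := Am.
have dp i : dom (tcell (pr i)) = E by rewrite dom_tcell dpr.
have cp' i : cod (tcell (pr i)) = B by rewrite cod_tcell cpr.
have H (w : tangent_cell Y X) i : tdom w = A -> tcod w = B ->
    tcell (pr i) \v m0 = tcell w ->
    (T \wl tcell (pr i)) \v (T \wl m0) \v lax_cell A =
    (T \wl tcell (pr i)) \v lax_cell E \v (m0 \wr tT Y).
  move=> dw cw ew; have nw := tcell_nat w; have ni := tcell_nat (pr i).
  rewrite dw cw in nw; rewrite dpr cpr in ni.
  rewrite !cmpA; try by (dc; rewrite ?dpr ?cpr ?dm ?cm).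
  rewrite ni -wl_cmp; last by rewrite cm dp.
  rewrite ew nw -ew -cmpA; try by (dc; rewrite ?dpr ?cpr ?dm ?cm).
  by rewrite wr_cmp // cm dp.
have nat : (T \wl m0) \v lax_cell A = lax_cell E \v (m0 \wr tT Y).
  apply: (pullback_inj (A := A \c tT Y) pbT).
  - by split; rewrite ?dom_cmp ?cod_cmp; dc; rewrite ?dm ?cm.
  - by split; rewrite ?dom_cmp ?cod_cmp; dc; rewrite ?dm ?cm.
  - by apply: ord2P; [apply: (H x)|apply: (H y)].
pose M := TangentCell Am nat.
have PM : [/\ @arrow (hom_tng Y X) M (tdom x) (tdom (pr k1)),
    @cmp (hom_tng Y X) (pr k1) M = x & @cmp (hom_tng Y X) (pr k2) M = y].
  split; first by split=> //=; rewrite ?dx ?dpr.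
  - have [||||d c e] := @tcell_cmp (pr k1) M A E B => //.
    by apply: tcell_eq; rewrite ?d ?c ?e.
  - have [||||d c e] := @tcell_cmp (pr k2) M A E B => //.
    by apply: tcell_eq; rewrite ?d ?c ?e.
have := @the_orP _ x (fun m : tangent_cell Y X =>
  [/\ @arrow (hom_tng Y X) m (tdom x) (tdom (pr k1)),
    @cmp (hom_tng Y X) (pr k1) m = x & @cmp (hom_tng Y X) (pr k2) m = y])
  (ex_intro _ M PM).
rewrite -/(@pair_arr (hom_tng Y X) pr x y) /=.
set m := pair_arr _ _ _; case=> -[/= dm' cm'] e1 e2.
rewrite dx dpr in dm' cm'; split=> //.
have [||||_ _ t1] := @tcell_cmp (pr k1) m A E B => //.
have [||||_ _ t2] := @tcell_cmp (pr k2) m A E B => //.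
apply: (pullback_inj pb _ Am).
  by rewrite -dm' -cm'; exact: tcell_arrow.
by apply: ord2P; rewrite ?m1 ?m2 -?t1 -?t2 ?e1 ?e2.
Qed.
End TngPair.

Section TngOps.
Context (K : two_category) (Y X : tangentad K) (n : negatives X).
Local Notation T := (tT X).
Local Notation O := (hom_tangent Y X).
Local Notation b_ := (@cmp (hom_tng Y X)).
Local Notation TL F := (comp_lax (T_lax X) F).
Local Notation tcY := (cell_tancat n Y).
Local Notation "b \@ a" := (vcmp b a).
Implicit Types A F G H M : lax_morphism Y X.

(** A relation rather than a function: the source and target of a composite of tangent cells are
    known only up to a provable equality of lax morphisms. *)
Definition tcell_of F G (a : tangent_cell Y X) (f : cell F G) :=
  [/\ tdom a = F, tcod a = G & tcell a = sval f].

Lemma tcell_of_cmp F G H (b a : tangent_cell Y X) (g : cell G H) (f : cell F G)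
  :
  tcell_of b g -> tcell_of a f -> @tcell_of F H (cmp_tcell b a) (g \@ f).
Proof.
move=> [db cb eb] [da ca ea].
by have [d c e] := tcell_cmp da ca db cb; split; rewrite // e eb ea.
Qed.

Lemma tcell_ofP F G (a : tangent_cell Y X) (da : tdom a = F) (ca : tcod a = G) :
  exists f : cell F G, tcell_of a f.
Proof.
have Aa : arrow (tcell a) F G by rewrite -da -ca; exact: tcell_arrow.
by exists (Cell Aa).
Qed.

Lemma tcell_of_nat F G (a : tangent_cell Y X) (f : cell F G) : tcell_of a f ->
  (T \wl sval f) \v lax_cell F = lax_cell G \v (sval f \wr tT Y).
Proof. by move=> [da ca <-]; have := tcell_nat a; rewrite da ca. Qed.

Lemma tcell_of_T F G (a : tangent_cell Y X) (f : cell F G) : tcell_of a f ->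
  @tcell_of (TL F) (TL G) (hcmp_tcell (id_tcell (T_lax X)) a) (Tcell f).
Proof. by move=> [da ca e]; split; rewrite /= ?da ?ca ?e. Qed.

Lemma tcell_of_p F :
  @tcell_of (TL F) F (hcmp_tcell (p_cell X) (id_tcell F)) (pcell F).
Proof. by split; rewrite //= comp_lax_idl. Qed.

Lemma tcell_of_z F :
  @tcell_of F (TL F) (hcmp_tcell (z_cell X) (id_tcell F)) (zcell F).
Proof. by split; rewrite //= comp_lax_idl. Qed.

Lemma tcell_of_l F :
  @tcell_of (TL F) (TL (TL F)) (hcmp_tcell (l_cell X) (id_tcell F)) (lcell F).
Proof. by split; rewrite //= comp_laxA. Qed.

Lemma tcell_of_c F :
  @tcell_of (TL (TL F)) (TL (TL F)) (hcmp_tcell (c_cell X) (id_tcell F)) (ccell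
    F).
Proof. by split; rewrite //= comp_laxA. Qed.

Lemma tcell_of_n F :
  @tcell_of (TL F) (TL F) (hcmp_tcell (n_cell n) (id_tcell F)) (ncell n F).
Proof. by split. Qed.

Lemma tcell_of_add A F (a b : tangent_cell Y X) (f g : cell A (T \c F)) :
  @tcell_of A (TL F) a f -> @tcell_of A (TL F) b g -> pcell F \@ f =
    pcell F \@ g ->
  @tcell_of A (TL F) (cmp_tcell (hcmp_tcell (s_cell X) (id_tcell F))
    (@pair_arr (hom_tng Y X) (o_pi O F) a b)) (cadd f g).
Proof.
move=> [da ca ea] [db cb eb] e.
have e' : (tp X \wr F) \v tcell a = (tp X \wr F) \v tcell b.
  by have := congr1 (fun a => sval a) e; rewrite /= ea eb.
have [] := @tng_pair K Y X (o_pi O F) (comp_lax (T2_lax X) F) (TL F) A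
  (tp X \wr F) (T \wl (tp X \wr F)) a b => //.
- by dc.
- exact: T2_pb.
- exact: TT2_pb.
set m := pair_arr _ _ _ => dm cm em.
have [||||d c ec] := @tcell_cmp _ _ _ (hcmp_tcell (s_cell X) (id_tcell F)) m A
  (comp_lax (T2_lax X) F) (TL F) => //.
by split=> //; rewrite ec sval_cadd // /add_T /= em ea eb.
Qed.

(** Handles the equation that characterizes a brace, where [T s] is applied to a pairing into T
    T_2. *)
Lemma tcell_of_Tadd A F (a b : tangent_cell Y X) (f g : cell A (T \c (T \c F)))
  :
  @tcell_of A (TL (TL F)) a f -> @tcell_of A (TL (TL F)) b g ->
  Tcell (pcell F) \@ f = Tcell (pcell F) \@ g ->
  @tcell_of A (TL (TL F)) (cmp_tcell (hcmp_tcell (id_tcell (T_lax X))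
       (hcmp_tcell (s_cell X) (id_tcell F)))
    (@pair_arr (hom_tng Y X) (fun i =>
      hcmp_tcell (id_tcell (T_lax X)) (o_pi O F i)) a b))
    (add2 (C := tcY) f g).
Proof.
move=> [da ca ea] [db cb eb] e.
have e' : (T \wl (tp X \wr F)) \v tcell a = (T \wl (tp X \wr F)) \v tcell b.
  by have := congr1 (fun a => sval a) e; rewrite /= ea eb.
have [] := @tng_pair K Y X (fun i =>
  hcmp_tcell (id_tcell (T_lax X)) (o_pi O F i))
   (TL (comp_lax (T2_lax X) F)) (TL (TL F)) A
  (T \wl (tp X \wr F)) (T \wl (T \wl (tp X \wr F))) a b => //.
- by dc.
- exact: TT2_pb.
- move: (@Tn_pullback _ _ X 2 isT Y F 2);
  rewrite /= comp1_idr !comp1A !wl_wl !wl_wr.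
  move=> pb; rewrite /=.
  by under [in X in is_nfold_pullback _ _ X]eq_fun =>
    i do rewrite !wl_wr !wl_wl.
set m := pair_arr _ _ _ => dm cm em.
have [||||d c ec] := @tcell_cmp _ _ _ (hcmp_tcell (id_tcell (T_lax X))
       (hcmp_tcell (s_cell X) (id_tcell F))) m A (TL (comp_lax (T2_lax X) F))
         (TL (TL F)) => //.
split=> //; rewrite ec.
have [m' [m1 m2]] := Tpair_cell_ex e.
have -> : add2 (C := tcY) f g = Tcell (scell F) \@ m'.
  by rewrite Ts_cadd m1 m2.
rewrite /= em; congr (_ \v _).
have /= ef := congr1 (fun a => sval a) m1;
  have /= eg := congr1 (fun a => sval a) m2.
apply: (pair_arr_eq (A := lax_ob A) (TT2_pb F)); rewrite ?ea ?eb //.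
- by have [d' c'] := svalP f; split; rewrite ?d' ?c'; dc.
- by have [d' c'] := svalP g; split; rewrite ?d' ?c'; dc.
- exact: (svalP m').
Qed.

Lemma tcell_of_inj F G (a b : tangent_cell Y X) (f : cell F G) :
  tcell_of a f -> tcell_of b f -> a = b.
Proof. by move=> [d c e] [d' c' e']; apply: tcell_eq; rewrite ?d ?c ?e. Qed.

Lemma tcell_of_fun F G (a : tangent_cell Y X) (f g : cell F G) :
  tcell_of a f -> tcell_of a g -> f = g.
Proof. by move=> [d c e] [d' c' e']; apply: cell_eq; rewrite -e. Qed.

Lemma tcell_of_id F : @tcell_of F F (id_tcell F) (idc F).
Proof. by split. Qed.

Lemma vf_cell M u : is_vector_field O M u <->
  exists2 f : cell M (T \c M), @tcell_of M (TL M) u f & vector_field (C :=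
    tcY) f.
Proof.
split=> [[[du cu] pu]|[f [du cu eu] hf]].
  have [f hf] := tcell_ofP du cu; exists f => //.
  by apply: (tcell_of_fun (tcell_of_cmp (tcell_of_p M) hf));
    rewrite [cmp_tcell _ _]pu.
split; first by split.
apply: (tcell_of_inj (tcell_of_cmp (tcell_of_p M) (And3 du cu eu))).
by rewrite [_ \@ _]hf; exact: tcell_of_id.
Qed.

Lemma vf_add_cell M u w (f g : cell M (T \c M)) :
  @tcell_of M (TL M) u f -> @tcell_of M (TL M) w g ->
  vector_field (C := tcY) f -> vector_field (C := tcY) g ->
  @tcell_of M (TL M) (vf_add O M u w) (cadd f g).
Proof. by move=> uf wg hf hg; apply: tcell_of_add => //;
  exact: eq_trans hf (esym hg). Qed.

Lemma vf_opp_cell M u (f : cell M (T \c M)) : @tcell_of M (TL M) u f ->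
  @tcell_of M (TL M) (vf_opp (hom_neg n) M u) (ncell n M \@ f).
Proof. by move=> uf; apply: tcell_of_cmp uf; exact: tcell_of_n. Qed.

(** The vertical component [k] of [f] exists in K(Y, X), and is tangent by [vertical_compat] with
    the lax cells of [A] and [M] as [a] and [b]. Hence the property that defines [brace] is
    satisfiable in [Tng K]. *)
Lemma brace_cell A M h (f : cell A (T \c (T \c M))) :
  @tcell_of A (TL (TL M)) h f ->
  Tcell (pcell M) \@ f = zcell M \@ (pcell M \@ (pcell (T \c M) \@ f)) ->
  exists k : cell A (T \c M), [/\ @tcell_of A (TL M) (brace O M h) k,
    pcell M \@ k = pcell M \@ (pcell (T \c M) \@ f) &
    vert (C := tcY) k (pcell (T \c M) \@ f) = f].
Proof.
move=> hf eh.
have ph := tcell_of_cmp (tcell_of_p (TL M)) hf.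
have pph := tcell_of_cmp (tcell_of_p M) ph.
have zph := tcell_of_cmp (tcell_of_z (TL M)) ph.
have [k pk ek] := lift_cell_ex eh.
have vk := vert_fibre (C := tcY) pk.
have k_nat : (T \wl sval k) \v lax_cell A =
  lax_cell (TL M) \v (sval k \wr tT Y).
  pose a : cell (A \c tT Y) (T \c A) := Cell (lax_arrow A).
  pose b : cell (M \c tT Y) (T \c M) := Cell (lax_arrow M).
  have [dk ck] := svalP k; have [df cf] := svalP f.
  have nP := tcell_of_nat ph; have nf := tcell_of_nat hf.
  have eP : Tcell (pcell (T \c M) \@ f) \@ a =
      ccell M \@ (Tcell b \@ whT (tT Y) (pcell (T \c M) \@ f)).
    apply: cell_eq; move: nP; rewrite /= /comp_lax_cell /= => ->.
    by rewrite -cmpA //; dc.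
  have ef : Tcell f \@ a =
      ccell (T \c M) \@ (Tcell (ccell M) \@ (Tcell (Tcell b) \@ whTT (tT Y) f)).
    apply: cell_eq; move: nf;
      rewrite /= /comp_lax_cell /= /comp_lax_cell /= => ->.
    by rewrite wl_cmp -?cmpA //; dc.
  have := vertical_compat (C := tcY) (a := a) (b :=
    b) pk (wh_fibre (tT Y) pk) eP.
  have ev : vert (C := tcY) k (pcell (T \c M) \@ f) = f by exact: ek.
  have := whTT_vert n (tT Y) pk; rewrite ev /vert => <-.
  move: ev; rewrite /vert => -> /(_ ef) /(congr1 (fun a => sval a)) /= ->.
  by rewrite /comp_lax_cell /= -cmpA //; dc.
pose kt := @TangentCell _ _ _ A (TL M) (sval k) (svalP k) k_nat.
have ktk : @tcell_of A (TL M) kt k by [].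
pose Q (k : arr (hom_tng Y X)) :=
  [/\ arrow k (dom (h : arr (hom_tng Y X))) (fob (o_T O) M),
        o_p O M \v k = o_p O M \v o_p O (fob (o_T O) M) \v (h : arr (hom_tng Y
          X))
      & farr (o_T O) (o_s O M) \v pair_arr (fun i => farr (o_T O) (o_pi O M i))
          (o_l O M \v k) (o_z O (fob (o_T O) M) \v o_p O (fob (o_T O) M) \v (h
            : arr (hom_tng Y X))) = h].
have Qkt : Q kt.
  split.
  - by have [dh _ _] := hf; split; rewrite /= ?dh.
  - apply: (tcell_of_inj (tcell_of_cmp (tcell_of_p M) ktk)).
    by rewrite pk; exact: pph.
  - apply: (@tcell_of_inj A (TL (TL M)) _ _ f) => //;
    rewrite -[X in tcell_of _ X]ek.
    exact: (tcell_of_Tadd (tcell_of_cmp (tcell_of_l M) ktk) zph).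
(* The value chosen by [brace] is not compared with [kt]: it satisfies [Q] too, and [Q] translates
   into the claims. *)
have := the_orP h (ex_intro _ kt Qkt); rewrite -/(brace O M h).
set b := brace O M h; case=> -[/= db cb] pb eb.
case: (hf) => dh _ _; rewrite dh in db.
have [k' hk'] := @tcell_ofP A (TL M) b db cb.
have pk' : pcell M \@ k' = pcell M \@ (pcell (T \c M) \@ f).
  apply: (tcell_of_fun (tcell_of_cmp (tcell_of_p M) hk')).
  by rewrite [cmp_tcell _ _]pb; exact: pph.
exists k'; split=> //.
apply: (tcell_of_fun _ hf); rewrite -[X in tcell_of X _]eb.
apply: (tcell_of_Tadd (tcell_of_cmp (tcell_of_l M) hk') zph).
exact: (vert_fibre (C := tcY) pk').
Qed.

Lemma lie_cell M u w (f g : cell M (T \c M)) :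
  @tcell_of M (TL M) u f -> @tcell_of M (TL M) w g ->
  vector_field (C := tcY) f -> vector_field (C := tcY) g ->
  exists2 h : cell M (T \c M),
    @tcell_of M (TL M) (lie_bracket O (hom_neg n) M u w) h
    & is_bracket (C := tcY) f g h.
Proof.
move=> uf wg hf hg.
have [eh H] := lie_lift (C := tcY) hf hg.
have Tg := tcell_of_T wg; have Tf := tcell_of_T uf.
have a1 := tcell_of_cmp Tg uf.
have a2 := tcell_of_cmp (tcell_of_c M) (tcell_of_cmp Tf wg).
have a3 := tcell_of_cmp (tcell_of_n (TL M)) a2.
have [||k [kk pk ek]] := brace_cell (tcell_of_add a1 a3 _) _.
- have e1 : pcell (T \c M) \@ (Tcell g \@ f) = g.
    by rewrite vcmpA pcell_nat -vcmpA (hf : pcell M \@ f = idc M) vcmp1r.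
  have e2 : pcell (T \c M) \@ (ccell M \@ (Tcell f \@ g)) = g.
    by rewrite vcmpA pc_cell vcmpA -TcellM (hf : pcell M \@ f =
      idc M) Tcell1 vcmp1l.
  by rewrite e1 (vcmpA (pcell (T \c M)) (ncell n (T \c M))) pn_cell e2.
- exact: eh.
by exists k => //; apply: H.
Qed.
End TngOps.

(** * The bundle of vector fields *)

Section StrictArrows.
Context (K : two_category).

Lemma strict_arrP (X Y : tangentad K) (s : strict_arrow K) :
  sa_dom s = X -> sa_cod s = Y -> exists F : strict_morphism X Y, s =
    strict_arr F.
Proof. by case: s => X' Y' F /= <- <-; exists F. Qed.

(** A retraction of [strict_arr], with default [d] off its image; it gives injectivity of
    [strict_arr] without inverting an equality of dependent records. *)
Definition sa_cast (X Y : tangentad K) (d : strict_morphism X Y) (s :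
  strict_arrow K) :
    strict_morphism X Y :=
  match pselect (sa_dom s = X), pselect (sa_cod s = Y) with
  | left e, left e' => ecast X (strict_morphism X Y) e
      (ecast Y (strict_morphism (sa_dom s) Y) e' (sa_mor s))
  | _, _ => d
  end.

Lemma strict_arrK (X Y : tangentad K) (d : strict_morphism X Y) :
  cancel (@strict_arr K X Y) (sa_cast d).
Proof.
move=> F; rewrite /sa_cast; case: pselect => //= e; case: pselect => //= e'.
by rewrite (Prop_irrelevance e erefl) (Prop_irrelevance e' erefl).
Qed.

Lemma strict_arr_inj (X Y : tangentad K) : injective (@strict_arr K X Y).
Proof. by move=> F G; apply: can_inj (strict_arrK F) F G. Qed.

Lemma strict_lax_comp (X Y Z : tangentad K) (G : strict_morphism Y Z) (F :
  lax_morphism X Y) :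
  lax_cell (comp_lax G F) = G \wl lax_cell F.
Proof.
have e : G \c tT Y = tT Z \c G by rewrite -(cod_lax G) strictP cod_idt.
rewrite /= /comp_lax_cell strictP hcmp_idt cmp_idl' // cod_hcmp cod_idt cod_lax.
by rewrite comp1A.
Qed.

Lemma strict_ob (X Y : tangentad K) (F : lax_morphism X Y) : strict F ->
  F \c tT X = tT Y \c F.
Proof. by move=> hF; rewrite -(cod_lax F) hF cod_idt. Qed.

(** As the lax cell of [F] is an identity, naturality of [w] reads [T w = c_F o w_T]; c is an
    involution. *)
Lemma strict_tcell (X Y : tangentad K) (F : lax_morphism X Y) (w : tangent_cell
  X Y) :
  strict F -> tdom w = F -> tcod w = comp_lax (T_lax Y) F ->
  tcell w \wr tT X = (tc Y \wr F) \v (tT Y \wl tcell w).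
Proof.
move=> hF dw cw; have := tcell_nat w; rewrite dw cw /= /comp_lax_cell hF.
have eF := strict_ob hF.
have cw' : cod (tcell w) = tT Y \c F by rewrite cod_tcell cw.
rewrite !hcmp_idt cmp_idr'; last by rewrite dom_hcmp dom_idt dom_tcell dw.
rewrite [X in _ = X \v _]cmp_idr';
  last by rewrite dom_hcmp dom_tc dom_idt /= -comp1A eF.
move=> ->; rewrite cmpA; last 2 first.
- by rewrite cod_hcmp cw' dom_hcmp dom_tc !cod_idt dom_idt -!comp1A eF.
- by dc.
rewrite -wr_cmp; last by dc.
rewrite cc hcmp_idt cmp_idl' // cod_hcmp cw' cod_idt -!comp1A eF //.
Qed.
End StrictArrows.

Section VFStrict.
Context (K : two_category) (X : tangentad K) (D : vf_construction X).
Local Notation V := (VF D).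
Local Notation U := (vfU D).
Local Notation v := (tcell (vfv D)).

Lemma tdom_vfv : tdom (vfv D) = U.
Proof. by have [[/= -> _] _] := vfvP D. Qed.

Lemma tcod_vfv : tcod (vfv D) = comp_lax (T_lax X) U.
Proof. by have [[/= _ ->] _] := vfvP D. Qed.

Lemma v_T : v \wr tT V = (tc X \wr U) \v (tT X \wl v).
Proof. exact: strict_tcell (strictP U) tdom_vfv tcod_vfv. Qed.

(** [H T] and [T H] classify the same vector field, by [strict_tcell] for the field on [U H] and
    [v_T] for the one on U, hence are equal. The cell of [H] then lies over an identity, and U is
    faithful on parallel cells. *)
Lemma strict_of_comp (Y : tangentad K) (H : lax_morphism Y V) :
  strict (comp_lax U H) -> strict H.
Proof.
move=> hs; have eUH := strict_ob hs; have eU := strict_ob (strictP U).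
have hU : U \wl lax_cell H =
  idt (U \c H \c tT Y) by rewrite -strict_lax_comp hs.
have eob : H \c tT Y = tT V \c H.
  apply: VF_inj; first by rewrite !comp1A eU eUH comp1A.
  have [_ cv] := vfv_arrow D; have [dv _] := vfv_arrow D.
  have := strict_tcell (w := hcmp_tcell (vfv D) (id_tcell H)) hs.
  rewrite /= tdom_vfv tcod_vfv -comp_laxA wr_wr => -> //.
  rewrite -[RHS]wr_wr v_T wr_cmp ?wr_wr ?wl_wr //.
  by rewrite cod_hcmp cv cod_idt; dc.
rewrite /strict; apply: (@VF_faithful _ _ D);
  last by rewrite hU hcmp_idt comp1A.
- by rewrite dom_lax dom_idt.
- by rewrite cod_lax cod_idt.
Qed.

Lemma strict_vf_ex (Y : tangentad K) (M : strict_morphism Y X) (w :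
  tangent_cell Y X) :
  is_vector_field (hom_tangent Y X) (strict_lax M) w ->
  exists H : strict_morphism Y V, corresponds H M w.
Proof.
move=> /(Gamma_surj D)[H HM]; have [/= e _] := HM.
have hH : strict H by apply: strict_of_comp; rewrite e; exact: strictP.
by exists (StrictMorphism hH).
Qed.

Lemma corresponds_ob (Y : tangentad K) (H : lax_morphism Y V) M w :
  corresponds H M w -> U \c H = lax_ob M /\ v \wr H = tcell w.
Proof. by move=> [/= <- <-]. Qed.

Lemma strict_VF_inj (Y : tangentad K) (x y : strict_morphism Y V) :
  U \c x = U \c y -> v \wr x = v \wr y -> x = y.
Proof.
move=> eU ev; have e := VF_inj eU ev; apply: strict_eq; apply: lax_eq => //.
by rewrite !strictP e.
Qed.
End VFStrict.

(** * From 2-pullbacks in [Tng K] to pullbacks of strict morphisms *)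

Section StrictPullback.
Context (K : two_category) (V X : tangentad K) (U : strict_morphism V X).
Context (m : nat) (P : tangentad K) (pr : 'I_m.+1 -> strict_morphism P V).
Context (pbK : is_nfold_2pullback (lax_ob U) (fun i => lax_ob (pr i))).
Context (pbT : @is_nfold_2pullback (Tng K) V X (strict_lax U) m.+1 P
  (fun i => strict_lax (pr i))).

(** The 2-pullback in [Tng K] yields a unique lax morphism. Its cell projects to the identity cells
    of the given strict morphisms, so it is an identity by uniqueness for 2-cells in K. *)
Lemma strict_pullback :
  is_nfold_pullback (strict_arr U : arr (strict_tng K)) P (fun i =>
    strict_arr (pr i)).
Proof.
have [eK _ uK] := pbK; have [eT uT _] := pbT.
have inj (A : tangentad K) (x y : strict_morphism A V) :
    cmp_strict (strict_arr U) (strict_arr x) =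
      cmp_strict (strict_arr U) (strict_arr y) <->
    comp_lax U x = comp_lax U y.
  rewrite !cmp_strictE;
    split=> [/strict_arr_inj /(congr1 (@strict_lax _ _ _))|e] //.
  by congr StrictArrow; apply: strict_eq.
split=> [//|i j|A f Af ef]; first exact/inj/eT.
have /choice[g gf] : forall i, exists g : strict_morphism A V, f i =
  strict_arr g.
  by move=> i; have [d c] := Af i; exact: strict_arrP d c.
have eg i j : comp_lax U (g i) = comp_lax U (g j)
  by apply/inj; rewrite -!gf; exact: ef.
have [h [/= hg uh]] := uT A (fun i => strict_lax (g i)) eg.
have hs : strict h.
  have [|b [_ ub]] := uK A (fun i => idt (g i \c tT A)).
    move=> i j; rewrite !hcmp_idt !comp1A.
    by have /= -> := congr1 (@lax_ob _ _ _) (eg i j).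
  rewrite /strict -(ub (lax_cell h)) => [|i]; last first.
    by rewrite -strict_lax_comp hg strictP.
  by rewrite -(ub (idt (lax_ob h \c tT A))) // => i;
    rewrite hcmp_idt comp1A -(hg i).
exists (strict_arr (StrictMorphism hs)); split=> [|h' [[/= dh' ch'] eh']].
  split=> // i; rewrite gf /= cmp_strictE; congr StrictArrow.
  by apply: strict_eq; exact: hg i.
have [h1 eh1] := strict_arrP dh' ch'; rewrite eh1; congr StrictArrow.
apply: strict_eq; apply: uh => i; have := eh' i.
by rewrite gf eh1 /= cmp_strictE => /strict_arr_inj <-.
Qed.
End StrictPullback.

(** * The bundle laws on generalized elements *)

Section LieBundle.
Context (K : two_category) (X : tangentad K) (n : negatives X) (D :
  vf_construction X).
Local Notation V := (VF D).
Local Notation U := (vfU D).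
Local Notation v := (tcell (vfv D)).
Local Notation T := (tT X).
Local Notation q := (strict_arr U : arr (strict_tng K)).
Local Notation "b \@ a" := (vcmp b a).
Local Notation CT := (cell_tancat n).
Local Notation field A := (@vector_field (CT A) _).

Section Represents.
Context (A : tangentad K).
Implicit Types (x y : strict_morphism A V) (M : ob (Hom A X)).

(** Read: [x] into VF stands for the vector field [f] on [M]. With the base [M] given up to an
    equation, fields of several morphisms over the same base have one type. *)
Definition represents M x (f : cell M (T \c M)) :=
  U \c x = M /\ v \wr x = sval f.

Lemma represents_inj M x y (f : cell M (T \c M)) :
  represents x f -> represents y f -> x = y.
Proof. by move=> [e1 e2] [e3 e4]; apply: strict_VF_inj; rewrite ?e1 ?e2. Qed.

Lemma represents_ex M x : U \c x = M -> exists f : cell M (T \c M),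
  represents x f.
Proof.
move=> <-; have [d c] := vfv_arrow D.
have Af : arrow (v \wr x) (U \c x) (T \c (U \c x)) 
  by split; rewrite ?dom_hcmp ?cod_hcmp ?d ?c; dc.
by exists (Cell Af).
Qed.

Lemma represents_field M x (f : cell M (T \c M)) : represents x f -> field A f.
Proof.
move=> [eM ef]; subst M; apply: cell_eq; rewrite /= -ef -wr_wr -wr_cmp.
  by rewrite vfv_p hcmp_idt.
by have [_ ->] := vfv_arrow D; dc.
Qed.

Lemma represents_corr (M : lax_morphism A X) x w (f : cell M (T \c M)) :
  corresponds x M w -> @tcell_of _ _ _ M (comp_lax (T_lax X) M) w f ->
    represents x f.
Proof. by move=> /corresponds_ob[e1 e2] [_ _ e3]; split; rewrite // e2. Qed.
End Represents.

Lemma same_fibreP (A : tangentad K) (x : strict_morphism A V) y :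
  same_fibre q (strict_arr x) y ->
  exists2 y' : strict_morphism A V, y = strict_arr y' & U \c x = U \c y'.
Proof.
move=> [/= dy _ cy e]; have [y' ey] := strict_arrP (esym dy) cy;
  exists y' => //.
move: e; rewrite ey !cmp_strictE => /strict_arr_inj.
by move=> /(congr1 (fun F => lax_ob (strict_lax F))).
Qed.

Section Operations.
Context (P : tangentad K) (pr : 'I_2 -> strict_morphism P V).
Context (pb : is_nfold_pullback q P (fun i => strict_arr (pr i))).
Local Notation op o x y := (fibre_op (fun i : 'I_2 => strict_arr (pr i) : arr (strict_tng K))
  (strict_arr o) (strict_arr x) (strict_arr y)).

(** Yoneda: the pair [x], [y] factors through the 2-fold pullback by some [m], the operation takes
    the value [o m] on it, and all fields involved are the generic [f1], [f2], [h0] precomposed with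
    [m]. A relation [Q] that holds for all precompositions of the generic ones thus holds for every
    pair. *)
Lemma op_represents (M0 : ob (Hom P X)) (o : strict_morphism P V)
    (f1 f2 h0 : cell M0 (T \c M0))
    (Q : forall (A : tangentad K) (M : ob (Hom A X)), cell M (T \c M) ->
       cell M (T \c M) -> cell M (T \c M) -> Prop) :
  represents (pr k1) f1 -> represents (pr k2) f2 -> represents o h0 ->
  (forall (A : tangentad K) (G : ob (Hom A P)),
    Q A _ (whT G f1) (whT G f2) (whT G h0)) ->
  forall (A : tangentad K) (M : ob (Hom A X)) (x y : strict_morphism A V) f g,
    @represents A M x f -> represents y g ->
    exists r h, [/\ op o x y = strict_arr r, represents r h & Q A M f g h].
Proof.
move=> [e1 ef1] [_ ef2] [eo eh0] HQ A M x y f g [ex ef] [ey eg].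
have Ax (w : strict_morphism A V) :
    @arrow (strict_tng K) (strict_arr w) A (dom q) by [].
have [|[dm cm] m1 m2] := pair_arrP pb (Ax x) (Ax y).
  rewrite /= !cmp_strictE; congr StrictArrow; apply: strict_eq; apply: lax_eq.
    by rewrite /= ex ey.
  by rewrite !strictP /= ex ey.
have [m em] := strict_arrP dm cm.
rewrite /fibre_op em /= cmp_strictE; rewrite em /= !cmp_strictE in m1 m2.
have {}m1 := strict_arr_inj m1; have {}m2 := strict_arr_inj m2.
have eM : M = M0 \c m by rewrite -ex -m1 /= comp1A e1.
move: f g ef eg; rewrite eM => f g ef eg.
exists (comp_strict o m), (whT m h0); split=> //.
  by split; rewrite /= ?comp1A ?eo // -wr_wr eh0.
have -> : f = whT m f1 by apply: cell_eq; rewrite -ef -m1 /= -wr_wr ef1.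
have -> : g = whT m f2 by apply: cell_eq; rewrite -eg -m2 /= -wr_wr ef2.
exact: HQ.
Qed.

Context (M0 : ob (Hom P X)) (f1 f2 b0 : cell M0 (T \c M0)) (fv : cell (lax_ob
  U) (T \c U)).
Context (zero : strict_morphism X V) (plus bracket : strict_morphism P V)
  (minus : strict_morphism V V).
Context (rf1 : represents (pr k1) f1) (rf2 : represents (pr k2) f2).
Context (rv : represents (id_strict V) fv).
Context (rzero : represents zero (zcell (id1 X))).
Context (rplus : represents plus (cadd f1 f2)).
Context (rbracket : represents bracket b0) (hb0 : @is_bracket (CT P) _ f1 f2
  b0).
Context (rminus : represents minus (ncell n U \@ fv)).

Lemma plus_represents (A : tangentad K) (M : ob (Hom A X)) (x y :
  strict_morphism A V) f g :
  @represents A M x f -> represents y g ->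
  exists2 r, op plus x y = strict_arr r & represents r (cadd f g).
Proof.
have e12 : pcell M0 \@ f1 = pcell M0 \@ f2.
  exact: eq_trans (represents_field rf1) (esym (represents_field rf2)).
move=> rx ry.
have [|r [h [e rr eh]]] := op_represents (Q := fun A M f g h => h =
  cadd f g) rf1 rf2 rplus _ rx ry.
  by move=> A' G; rewrite whT_add.
by exists r; rewrite // -eh.
Qed.

Lemma bracket_represents (A : tangentad K) (M : ob (Hom A X)) (x y :
  strict_morphism A V) f g :
  @represents A M x f -> represents y g ->
  exists r h, [/\ op bracket x y = strict_arr r,
    represents r h & @is_bracket (CT A) _ f g h].
Proof.
apply: (op_represents (Q := fun A M f g h =>
  @is_bracket (CT A) M f g h) rf1 rf2 rbracket).
by move=> A' G; apply: wh_bracket hb0;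
  [exact: represents_field rf1|exact: represents_field rf2].
Qed.

Lemma zero_represents (A : tangentad K) (M : ob (Hom A X)) (x : strict_morphism
  A V) :
  U \c x = M ->
  exists2 r, (strict_arr zero : arr (strict_tng K)) \v q \v (strict_arr x) =
    strict_arr r
    & represents r (zcell M).
Proof.
move=> eM; exists (comp_strict zero (comp_strict U x)).
  by rewrite /= !cmp_strictE.
have [e1 e2] := rzero; split=> /=; first by rewrite comp1A e1 comp1_idl eM.
by rewrite -wr_wr e2 /= wr_wr comp1_idl eM.
Qed.

Lemma vf_additive_bundle :
  (forall k, 0 < k -> exists (En : tangentad K) (prn : 'I_k ->
    arr (strict_tng K)),
     is_nfold_pullback q En prn) ->
  is_additive_bundle q P (fun i =>
    strict_arr (pr i)) (strict_arr zero) (strict_arr plus).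
Proof.
move=> pbn; split=> //.
- rewrite /= cmp_strictE; congr StrictArrow; apply: strict_eq; apply: lax_eq.
    by have [] := rzero.
  rewrite strictP /=; have [/= -> _] := rzero.
  by rewrite comp1_idl.
- have [e1 _] := rf1; have [e2 _] := rplus.
  rewrite /= !cmp_strictE; congr StrictArrow; apply: strict_eq; apply: lax_eq.
    by rewrite /= e1.
  by rewrite !strictP /= e1 e2.
- move=> x y w sxy; have [_ cx _ _] := sxy.
  have [x' ex] := strict_arrP erefl cx; move: sxy; rewrite ex.
  move=> /same_fibreP[y' ->] exy /same_fibreP[w' ->] eyw.
  have [f rx] := represents_ex (erefl (U \c x')).
  have [g ry] := represents_ex (esym exy).
  have [h rw] := represents_ex (esym (etrans exy eyw)).
  have [r1 -> r1P] := plus_represents rx ry.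
  have [r2 -> r2P] := plus_represents r1P rw.
  have [r3 -> r3P] := plus_represents ry rw.
  have [r4 -> r4P] := plus_represents rx r3P.
  congr strict_arr; apply: represents_inj r2P _; rewrite caddA //.
  - exact: eq_trans (represents_field rx) (esym (represents_field ry)).
  - exact: eq_trans (represents_field ry) (esym (represents_field rw)).
- move=> x y sxy; have [_ cx _ _] := sxy.
  have [x' ex] := strict_arrP erefl cx; move: sxy; rewrite ex.
  move=> /same_fibreP[y' ->] exy.
  have [f rx] := represents_ex (erefl (U \c x')).
  have [g ry] := represents_ex (esym exy).
  have [r1 -> r1P] := plus_represents rx ry.
  have [r2 -> r2P] := plus_represents ry rx.
  congr strict_arr; apply: represents_inj r1P _; rewrite caddC //.
  exact: eq_trans (represents_field rx) (esym (represents_field ry)).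
- move=> x cx; have [x' ->] := strict_arrP erefl cx.
  have [f rx] := represents_ex (erefl (U \c x')).
  have [r1 -> r1P] := zero_represents (erefl (U \c x')).
  have [r2 -> r2P] := plus_represents r1P rx.
  congr strict_arr; apply: represents_inj r2P _.
  have hf : pcell _ \@ f = idc _ := represents_field rx.
  by have := caddZ f; rewrite hf vcmp1r => ->.
Qed.

Lemma over_base (o : strict_morphism P V) (h : cell M0 (T \c M0)) : represents
  o h ->
  q \v (strict_arr o : arr (strict_tng K)) = q \v strict_arr (pr k1).
Proof.
move=> [e2 _]; have [e1 _] := rf1.
rewrite /= !cmp_strictE; congr StrictArrow; apply: strict_eq; apply: lax_eq.
  by rewrite /= e1.
by rewrite !strictP /= e1 e2.
Qed.

Lemma vf_abelian_group_bundle :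
  (forall k, 0 < k -> exists (En : tangentad K) (prn : 'I_k ->
    arr (strict_tng K)),
     is_nfold_pullback q En prn) ->
  is_abelian_group_bundle q P (fun i => strict_arr (pr i)) (strict_arr zero)
    (strict_arr plus) (strict_arr minus).
Proof.
move=> pbn; split=> //; first exact: vf_additive_bundle.
  rewrite /= cmp_strictE; congr StrictArrow; apply: strict_eq; apply: lax_eq.
    by have [] := rminus.
  by rewrite !strictP /=; have [-> _] := rminus.
have hf : pcell _ \@ fv = idc _ := represents_field rv.
have [r1 e1 r1P] := plus_represents rminus rv.
have [r2 e2 r2P] := zero_represents (comp1_idr U : U \c id_strict V = U).
rewrite [LHS]e1.
(* [q] is composed with the identity, the generalized element to which [zero_represents] was
   applied. *)
have -> : q = q \v (strict_arr (id_strict V) : arr (strict_tng K)).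
  by rewrite /= cmp_strictE; congr StrictArrow; apply: strict_eq;
    rewrite /= comp_lax_idr.
rewrite e2; congr strict_arr; apply: represents_inj r1P _.
by rewrite caddN hf vcmp1r.
Qed.

(** Each law becomes an identity of vector fields on one 1-cell in K(A, X), and [represents_inj]
    carries it back. Brackets are known only through [is_bracket], so [bracket_uniq] identifies the
    two sides where needed. *)
Lemma vf_lie_algebra_bundle :
  (forall k, 0 < k -> exists (En : tangentad K) (prn : 'I_k ->
    arr (strict_tng K)),
     is_nfold_pullback q En prn) ->
  is_lie_algebra_bundle q P (fun i => strict_arr (pr i)) (strict_arr zero)
    (strict_arr plus) (strict_arr bracket).
Proof.
move=> pbn; split=> //; first exact: vf_additive_bundle.
- exact: over_base rbracket.
- move=> x y w sxy; have [_ cx _ _] := sxy.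
  have [x' ex] := strict_arrP erefl cx; move: sxy; rewrite ex.
  move=> /same_fibreP[y' ->] exy /same_fibreP[w' ->] eyw.
  have [f rx] := represents_ex (erefl (U \c x')).
  have [g ry] := represents_ex (esym exy).
  have [h rw] := represents_ex (esym (etrans exy eyw)).
  have hf := represents_field rx; have hg := represents_field ry.
  have hh := represents_field rw.
  have [r1 -> r1P] := plus_represents rx ry.
  have [r2 [b2 [-> r2P hb2]]] := bracket_represents r1P rw.
  have [r3 [b3 [-> r3P hb3]]] := bracket_represents rx rw.
  have [r4 [b4 [-> r4P hb4]]] := bracket_represents ry rw.
  have [r5 -> r5P] := plus_represents r3P r4P.
  congr strict_arr; apply: represents_inj r2P _.
  rewrite (bracket_uniq (vf_field_add hf hg) hh hb2 (bracket_add hf hg hh hb3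
    hb4)).
  exact: r5P.
- move=> x cx; have [x' ->] := strict_arrP erefl cx.
  have [f rx] := represents_ex (erefl (U \c x')).
  have [r1 -> r1P] := zero_represents (erefl (U \c x')).
  have [r2 [b2 [-> r2P hb2]]] := bracket_represents r1P rx.
  have hf := represents_field rx.
  congr strict_arr; apply: represents_inj r2P _.
  rewrite (bracket_uniq (represents_field r1P) hf hb2 (bracket_zero hf)).
  exact: r1P.
- move=> x y sxy; have [_ cx _ _] := sxy.
  have [x' ex] := strict_arrP erefl cx; move: sxy; rewrite ex.
  move=> /same_fibreP[y' ->] exy.
  have [f rx] := represents_ex (erefl (U \c x')).
  have [g ry] := represents_ex (esym exy).
  have hf := represents_field rx; have hg := represents_field ry.
  have [r1 [b1 [-> r1P hb1]]] := bracket_represents rx ry.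
  have [r2 [b2 [-> r2P hb2]]] := bracket_represents ry rx.
  have [r3 -> r3P] := plus_represents r1P r2P.
  have [r4 -> r4P] := zero_represents (erefl (U \c x')).
  congr strict_arr; apply: represents_inj r3P _.
  rewrite (bracket_uniq hg hf hb2 (bracket_anti hf hg hb1)).
  by rewrite (_ : cadd _ _ = zcell _) //;
    exact: field_addN (represents_field r1P).
- move=> x y w sxy; have [_ cx _ _] := sxy.
  have [x' ex] := strict_arrP erefl cx; move: sxy; rewrite ex.
  move=> /same_fibreP[y' ->] exy /same_fibreP[w' ->] eyw.
  have [f rx] := represents_ex (erefl (U \c x')).
  have [g ry] := represents_ex (esym exy).
  have [h rw] := represents_ex (esym (etrans exy eyw)).
  have hf := represents_field rx; have hg := represents_field ry.
  have hh := represents_field rw.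
  have [r1 [b1 [-> r1P hb1]]] := bracket_represents rx ry.
  have [r2 [b2 [-> r2P hb2]]] := bracket_represents r1P rw.
  have [r3 [b3 [-> r3P hb3]]] := bracket_represents rw rx.
  have [r4 [b4 [-> r4P hb4]]] := bracket_represents r3P ry.
  have [r5 [b5 [-> r5P hb5]]] := bracket_represents ry rw.
  have [r6 [b6 [-> r6P hb6]]] := bracket_represents r5P rx.
  have [r7 -> r7P] := plus_represents r2P r4P.
  have [r8 -> r8P] := plus_represents r7P r6P.
  have [r9 -> r9P] := zero_represents (erefl (U \c x')).
  congr strict_arr; apply: represents_inj r8P _.
  rewrite (_ : cadd _ _ = zcell _) //.
  exact: jacobi hf hg hh hb1 hb2 hb3 hb4 hb5 hb6.
Qed.

End Operations.
End LieBundle.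

Section LieTheorem.
Context (K : two_category) (X : tangentad K) (n : negatives X) (D :
  vf_construction X).
Context (VFn : forall m : nat,
  nfold_2pullback (lax_ob (strict_lax (vfU D))) m.+1).

Lemma lie_bundle (E : forall m : nat, tangent_structure (apex (VFn m)))
     (pr : forall m : nat, 'I_m.+1 ->
       strict_morphism (Tangentad (E m)) (VF D)) :
     induced_structure VFn E pr ->
     let VF1 := VF D in
     let VF2 := Tangentad (E 1) in
     let U : lax_morphism VF1 X := vfU D in
     let pi1 : lax_morphism VF2 VF1 := pr 1 k1 in
     let pi2 : lax_morphism VF2 VF1 := pr 1 k2 in
     let v := vfv D in
     let v1 := hcmp_tcell v (id_tcell pi1) in
     let v2 := hcmp_tcell v (id_tcell pi2) in
     let O2 := hom_tangent VF2 X in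
     exists (zero : strict_morphism X VF1) (plus : strict_morphism VF2 VF1)
       (minus : strict_morphism VF1 VF1) (bracket : strict_morphism VF2 VF1),
       [/\ corresponds zero (id_lax X) (z_cell X),
           corresponds plus (comp_lax U pi1)
             (vf_add O2 (comp_lax U pi1) v1 v2),
           corresponds minus U (vf_opp (hom_neg n) U v)
         & corresponds bracket (comp_lax U pi1)
             (lie_bracket O2 (hom_neg n) (comp_lax U pi1) v1 v2)] /\
       let q := strict_arr (vfU D) in
       let E2 : ob (strict_tng K) := VF2 in
       let pr2 := fun i : 'I_2 => strict_arr (pr 1 i) in
       is_abelian_group_bundle q E2 pr2
         (strict_arr zero) (strict_arr plus) (strict_arr minus) /\
       is_lie_algebra_bundle q E2 pr2
         (strict_arr zero) (strict_arr plus) (strict_arr bracket).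
Proof.
move=> [proj_pr pbT] VF1 VF2 U pi1 pi2 v v1 v2 O2.
have pb m : is_nfold_pullback (strict_arr (vfU D) : arr (strict_tng K))
    (Tangentad (E m)) (fun i => strict_arr (pr m i)).
  apply: strict_pullback (pbT m).
  have := projP (VFn m); congr is_nfold_2pullback.
  by apply: funext => i; rewrite proj_pr.
have pbn k : 0 < k -> exists (En : tangentad K) (prn : 'I_k ->
  arr (strict_tng K)),
     is_nfold_pullback (strict_arr (vfU D) : arr (strict_tng K)) En prn.
  by case: k => // k _;
    exists (Tangentad (E k)), (fun i => strict_arr (pr k i)).
(* [v1] and [v2] are fields on [U pi1] and [U pi2], which are equal lax morphisms; [M] is this
   common base, kept as a strict morphism for [strict_vf_ex]. *)
pose M := comp_strict (vfU D) (pr 1 k1).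
have eM : comp_lax U pi2 = strict_lax M by have [e _ _] := pbT 1;
  exact: (e k2 k1).
have [fv vfv_of hfv] := (vf_cell n U v).1 (vfvP D).
have [f1 v1_of hf1] := (vf_cell n M v1).1 (Gamma_vf (vfvP D) pi1).
have [f2 v2_of hf2] : exists2 f2 : cell M (tT X \c M),
    @tcell_of _ _ _ M (comp_lax (T_lax X) M) v2 f2 & vector_field (C :=
      cell_tancat n VF2) f2.
  by apply: (vf_cell n M v2).1; rewrite -eM; exact: (Gamma_vf (vfvP D) pi2).
have z_of : @tcell_of _ _ _ (id_lax X) (comp_lax (T_lax X) (id_lax X)) (z_cell
  X) (zcell (id1 X)).
  by split; rewrite //= ?comp_lax_idr ?hcmp_idr.
have hz : vector_field (C := cell_tancat n X) (zcell (id1 X)).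
  exact: vf_field_zero.
have [zero cor_zero] := strict_vf_ex D (M :=
  id_strict X) ((vf_cell n (id_lax X) _).2 (ex_intro2 _ _ _ z_of hz)).
have plus_of := vf_add_cell v1_of v2_of hf1 hf2.
have [plus cor_plus] := strict_vf_ex D (M :=
  M) ((vf_cell n M _).2 (ex_intro2 _ _ _ plus_of (vf_field_add hf1 hf2))).
have minus_of := vf_opp_cell n vfv_of.
have [minus cor_minus] := strict_vf_ex D (M :=
  vfU D) ((vf_cell n U _).2 (ex_intro2 _ _ _ minus_of (vf_field_opp hfv))).
have [b0 b_of hb] := lie_cell v1_of v2_of hf1 hf2.
have [bracket cor_bracket] := strict_vf_ex D (M :=
  M) ((vf_cell n M _).2 (ex_intro2 _ _ _ b_of hb.1)).
exists zero, plus, minus, bracket; split=> //.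
have rv : represents (id_strict VF1) fv.
  by have [_ _ e] := vfv_of; split; rewrite /= ?comp1_idr // hcmp_idr e.
have rf1 : represents (pr 1 k1) f1 by have [_ _ e] := v1_of; split;
  rewrite // -e.
have rf2 : represents (pr 1 k2) f2.
  have [_ _ e] := v2_of; split; last by rewrite -e.
  by have := congr1 (@lax_ob _ _ _) eM.
have rzero := represents_corr cor_zero z_of.
have rplus := represents_corr cor_plus plus_of.
have rbracket := represents_corr cor_bracket b_of.
have rminus := represents_corr cor_minus minus_of.
split.
- exact: (vf_abelian_group_bundle (pb 1) rf1 rf2 rv rzero rplus rminus pbn).
- exact: (vf_lie_algebra_bundle (pb 1) rf1 rf2 rzero rplus rbracket hb pbn).
Qed.
End LieTheorem.

(** * The tangent structure on VF_n *)

(* P represents the objects of K(-, X) with an I-indexed family of vector      *)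
(* fields, the universal one being (R, v).                                    *)
Section Classifier.
Context (K : two_category) (X : tangentad K) (n : negatives X) (P : K) (I :
  Type).
Context (R : ob (Hom P X)) (v : I -> arr (Hom P X)).
Local Notation T := (tT X).
Context (v_arrow : forall i, arrow (v i) R (T \c R)).
Context (pv : forall i, (tp X \wr R) \v v i = idt R).
Context (cl_surj : forall (Y : K) (M : ob (Hom Y X)) (w : I -> arr (Hom Y X)),
  (forall i, arrow (w i) M (T \c M)) -> (forall i, (tp X \wr M) \v w i =
    idt M) ->
  exists H : ob (Hom Y P), R \c H = M /\ forall i, v i \wr H = w i).
Context (cl_faithful : forall (Y : K) (a a' : arr (Hom Y P)),
  dom a = dom a' -> cod a = cod a' -> R \wl a = R \wl a' -> a = a').
Context (cl_full : forall (Y : K) (H H' : ob (Hom Y P)) f,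
  arrow f (R \c H) (R \c H') ->
  (forall i, (T \wl f) \v (v i \wr H) = (v i \wr H') \v f) ->
  exists a, arrow a H H' /\ R \wl a = f).
Local Notation "b \@ a" := (vcmp b a).
Local Notation CT := (cell_tancat n).

Definition vc i : cell R (T \c R) := Cell (v_arrow i).

Lemma vc_field i : vector_field (C := CT P) (vc i).
Proof. by apply: cell_eq; rewrite /= pv. Qed.

(** The tangent functor on objects with fields sends [(M, v)] to [(T M, c o T v)]; this is its value
    on the universal family. *)
Lemma TP_ex : exists H : ob (Hom P P), R \c H = T \c R /\
  forall i, v i \wr H = sval (ccell R \@ Tcell (vc i)).
Proof.
apply: (cl_surj (w := fun i => sval (ccell R \@ Tcell (vc i)))) => i.
  exact: (svalP (ccell R \@ Tcell (vc i))).
by have := clift_field (vc_field i) => /(congr1 (fun a => sval a)).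
Qed.

Definition TP := sval (cid TP_ex).
Lemma R_TP : R \c TP = T \c R. Proof. by have [] := svalP (cid TP_ex). Qed.
Lemma v_TP i : v i \wr TP = (tc X \wr R) \v (T \wl v i).
Proof. by have [_] := svalP (cid TP_ex). Qed.

Section Tn.
Context (k : nat) (k0 : 0 < k).

Lemma TnT_pb : is_nfold_pullback (T \wl (tp X \wr R)) (T \c (tTn X k \c R))
  (fun j : 'I_k => T \wl (tpi X j \wr R)).
Proof.
move: (Tn_pullback X k0 R 1); rewrite /= comp1_idr comp1A wl_wr.
by under [in X in _ -> X]eq_fun => i do rewrite wl_wr.
Qed.

Lemma tpin_arrow (j : 'I_k) : arrow (tpi X j) (tTn X k) T.
Proof.
have [Aq _ _] := @Tn_pb0 _ _ X k k0.
by have [d c] := Aq j; split=> //; rewrite c dom_tp.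
Qed.

Lemma picelln_arrow (j : 'I_k) : arrow (tpi X j \wr R) (tTn X k \c R) (T \c R).
Proof. by have [d c] := tpin_arrow j; split; dc; rewrite ?d ?c. Qed.
Definition picelln j := Cell (picelln_arrow j).

Lemma p_picelln j j' : pcell R \@ picelln j = pcell R \@ picelln j'.
Proof.
have [Aq qq _] := @Tn_pb0 _ _ X k k0.
have dq := (Aq _).1; have cq := (Aq _).2.
by apply: cell_eq; rewrite /= -!wr_cmp ?cq // (qq j j').
Qed.

(** The field on T_k R has as [j]-th component the complete lift of [v i] after [pi_j]. These
    components form a compatible family, so they factor through the pullback T T_k R; the section
    condition is checked after each projection. *)
Lemma TnP_ex : exists H : ob (Hom P P), R \c H = tTn X k \c R /\
  forall i (j : 'I_k), (T \wl (tpi X j \wr R)) \v (v i \wr H) =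
    (v i \wr TP) \v (tpi X j \wr R).
Proof.
have A B (y : cell B (T \c (T \c R))) : arrow (sval y) B (dom (T \wl (tp X \wr
  R))).
  by split; dc.
have /choice[w wP] : forall i, exists w,
  arrow w (tTn X k \c R) (T \c (tTn X k \c R)) /\
  forall j, (T \wl (tpi X j \wr R)) \v w =
    sval (ccell R \@ (Tcell (vc i) \@ picelln j)).
  move=> i; have [_ _ univ] := TnT_pb.
  have [||w [[Aw wP] _]] := univ (tTn X k \c R)
    (fun j => sval (ccell R \@ (Tcell (vc i) \@ picelln j))).
  - by move=> j; apply: A.
  - move=> j j'; have E l : Tcell (pcell R) \@ (ccell R \@ (Tcell (vc i) \@
    picelln l)) =
        vc i \@ (pcell R \@ picelln l).
      by rewrite Tp_ccell vcmpA pcell_nat -vcmpA.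
    by have := congr1 (fun a => sval a) (E j); rewrite (p_picelln j j') -E.
  - by exists w.
have wA i := (wP i).1; have wE i := (wP i).2.
have [i|H [e eH]] := cl_surj wA.
- pose W : cell (tTn X k \c R) (T \c (tTn X k \c R)) := Cell (wA i).
  have E j : picelln j \@ (pcell (tTn X k \c R) \@ W) = picelln j.
    rewrite vcmpA -pcell_nat -vcmpA.
    have -> : Tcell (picelln j) \@ W = ccell R \@ (Tcell (vc i) \@ picelln j).
      by apply: cell_eq; exact: wE.
    rewrite vcmpA pc_cell vcmpA -TcellM.
    by rewrite (vc_field i : pcell R \@ vc i = idc R) Tcell1 vcmp1l.
  apply: (pullback_inj (Tn_pb X R k0) (svalP (pcell (tTn X k \c R) \@ W))
    (idc_arrow _)).
  move=> j; have /= -> := congr1 (fun a => sval a) (E j).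
  by rewrite cmp_idr' //; case: (picelln_arrow j).
exists H; split=> // i j; rewrite eH wE v_TP /=.
have [dv cv] := v_arrow i; have [dp cp'] := picelln_arrow j.
by rewrite cmpA //; rewrite ?cp' ?cod_hcmp ?dom_hcmp ?dv ?cv; dc.
Qed.
End Tn.

(** The value at [k = 0] is a default: [tTn] is a total function, constrained only for positive
    arguments. *)
Definition TnP k : ob (Hom P P) :=
  if ltnP 0 k is LtnNotGeq k0 then sval (cid (TnP_ex k0)) else id1 P.

Lemma TnPP k : 0 < k -> R \c TnP k = tTn X k \c R /\
  forall i (j : 'I_k), (T \wl (tpi X j \wr R)) \v (v i \wr TnP k) =
    (v i \wr TP) \v (tpi X j \wr R).
Proof. by rewrite /TnP; case: ltnP => // k0 _;
  exact: (svalP (cid (TnP_ex k0))). Qed.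

Lemma v_nat Y (a : arr (Hom Y P)) H H' i : arrow a H H' ->
  (T \wl (R \wl a)) \v (v i \wr H) = (v i \wr H') \v (R \wl a).
Proof. by move=> Aa; rewrite wl_wl -(swap Aa (v_arrow i)). Qed.

Lemma v_TTP i : v i \wr (TP \c TP) =
  sval (ccell (T \c R) \@ (Tcell (ccell R) \@ Tcell (Tcell (vc i)))).
Proof.
have [dv cv] := v_arrow i.
rewrite -wr_wr v_TP wr_cmp; last by dc; rewrite cv comp1A.
rewrite wr_wr R_TP -wl_wr v_TP wl_cmp //.
by dc; rewrite cv comp1A.
Qed.

Lemma R_TTP : R \c (TP \c TP) = T \c (T \c R).
Proof. by rewrite comp1A R_TP -comp1A R_TP. Qed.

Section StructureCells.

(** By [cl_full], a structure cell at [R] lifts to P once it is a morphism between the fields on its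
    source and target. For p this is [T p o c = p_T] and naturality. *)
Lemma p_ex : exists a, arrow a TP (id1 P) /\ R \wl a = tp X \wr R.
Proof.
apply: cl_full => [|i]; first by rewrite R_TP comp1_idr; exact: pcell_arrow.
have e : Tcell (pcell R) \@ (ccell R \@ Tcell (vc i)) = vc i \@ pcell R.
  by rewrite Tp_ccell pcell_nat.
by rewrite v_TP hcmp_idr; exact: (congr1 (fun a => sval a) e).
Qed.
Definition pP := sval (cid p_ex).
Lemma pP_arrow : arrow pP TP (id1 P). Proof. exact: (svalP (cid p_ex)).1. Qed.
Lemma R_pP : R \wl pP = tp X \wr R. Proof. exact: (svalP (cid p_ex)).2. Qed.

Lemma z_ex : exists a, arrow a (id1 P) TP /\ R \wl a = tz X \wr R.
Proof.
apply: cl_full => [|i]; first by rewrite R_TP comp1_idr; exact: zcell_arrow.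
have e : Tcell (zcell R) \@ vc i = (ccell R \@ Tcell (vc i)) \@ zcell R.
  by rewrite -vcmpA zcell_nat -cz_cell !vcmpA cc_cell vcmp1l.
by rewrite v_TP hcmp_idr; exact: (congr1 (fun a => sval a) e).
Qed.
Definition zP := sval (cid z_ex).
Lemma zP_arrow : arrow zP (id1 P) TP. Proof. exact: (svalP (cid z_ex)).1. Qed.
Lemma R_zP : R \wl zP = tz X \wr R. Proof. exact: (svalP (cid z_ex)).2. Qed.

Lemma pi_ex k (j : 'I_k) : exists a, 0 < k ->
  arrow a (TnP k) TP /\ R \wl a = tpi X j \wr R.
Proof.
have [k0|] := ltnP 0 k; last by exists (idt TP).
have [e vT] := TnPP k0.
have [|i|a aP] := cl_full (H := TnP k) (H' := TP) (f := tpi X j \wr R).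
- by rewrite R_TP e; exact: picelln_arrow.
- exact: vT.
- by exists a.
Qed.
Definition piP k (j : 'I_k) := sval (cid (pi_ex j)).
Lemma piP_arrow k (j : 'I_k) : 0 < k -> arrow (piP j) (TnP k) TP.
Proof. by move=> k0; have [] := svalP (cid (pi_ex j)) k0. Qed.
Lemma R_piP k (j : 'I_k) : 0 < k -> R \wl piP j = tpi X j \wr R.
Proof. by move=> k0; have [] := svalP (cid (pi_ex j)) k0. Qed.

(** The field on T_2 R has components [c (T v_i) pi_j]. [T s] adds them along [T p], that is by [+]
    after c, and [T v_i] is additive for [+]. *)
Lemma s_ex : exists a, arrow a (TnP 2) TP /\ R \wl a = ts X \wr R.
Proof.
have [eT vT] := @TnPP 2 isT.
apply: cl_full => [|i]; first by rewrite R_TP eT; exact: scell_arrow.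
have Aw : arrow (v i \wr TnP 2) (tTn X 2 \c R) (T \c (tTn X 2 \c R)).
  have [dv cv] := v_arrow i.
  by split; rewrite ?dom_hcmp ?cod_hcmp ?dv ?cv ?dom_idt ?cod_idt -?comp1A eT.
have e0 j : Tcell (picell j R) \@ Cell Aw =
  (ccell R \@ Tcell (vc i)) \@ picell j R.
  by apply: cell_eq; rewrite /= vT v_TP.
have e : Tcell (scell R) \@ Cell Aw = (ccell R \@ Tcell (vc i)) \@ scell R.
  rewrite Ts_cadd !e0 -!vcmpA !(vcmpA (ccell R) (ccell R)) cc_cell !vcmp1l.
  rewrite -Tcell_caddr; last exact: ppi_cell.
  by have := caddE (idc (tTn X 2 \c R)); rewrite !vcmp1r => ->.
by rewrite v_TP; exact: (congr1 (fun a => sval a) e).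
Qed.
Definition sP := sval (cid s_ex).
Lemma sP_arrow : arrow sP (TnP 2) TP. Proof. exact: (svalP (cid s_ex)).1. Qed.
Lemma R_sP : R \wl sP = ts X \wr R. Proof. exact: (svalP (cid s_ex)).2. Qed.

Lemma l_ex : exists a, arrow a TP (TP \c TP) /\ R \wl a = tl X \wr R.
Proof.
apply: cl_full => [|i]; first by rewrite R_TTP R_TP; exact: lcell_arrow.
have e : Tcell (lcell R) \@ (ccell R \@ Tcell (vc i)) =
    (ccell (T \c R) \@ (Tcell (ccell R) \@ Tcell (Tcell (vc i)))) \@ lcell R.
  by rewrite vcmpA -ccl_cell -!vcmpA lcell_nat.
by rewrite v_TP v_TTP; exact: (congr1 (fun a => sval a) e).
Qed.
Definition lP := sval (cid l_ex).
Lemma lP_arrow : arrow lP TP (TP \c TP). Proof. exact: (svalP (cid l_ex)).1.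
  Qed.
Lemma R_lP : R \wl lP = tl X \wr R. Proof. exact: (svalP (cid l_ex)).2. Qed.

Lemma c_ex : exists a, arrow a (TP \c TP) (TP \c TP) /\ R \wl a = tc X \wr R.
Proof.
apply: cl_full => [|i]; first by rewrite R_TTP; exact: ccell_arrow.
have e : Tcell (ccell R) \@ (ccell (T \c R) \@ (Tcell (ccell R) \@ Tcell (Tcell
  (vc i)))) =
    (ccell (T \c R) \@ (Tcell (ccell R) \@ Tcell (Tcell (vc i)))) \@ ccell R.
  by rewrite -!vcmpA ccell_nat !vcmpA -(vcmpA (Tcell _)) ccc_cell -!vcmpA.
by rewrite v_TTP; exact: (congr1 (fun a => sval a) e).
Qed.
Definition cP := sval (cid c_ex).
Lemma cP_arrow : arrow cP (TP \c TP) (TP \c TP). Proof. exact: (svalP (cid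
  c_ex)).1. Qed.
Lemma R_cP : R \wl cP = tc X \wr R. Proof. exact: (svalP (cid c_ex)).2. Qed.
End StructureCells.

Lemma R_pow m : R \c pow1 TP m = pow1 T m \c R.
Proof.
elim: m => [|m IHm] /=; first by rewrite comp1_idr comp1_idl.
by rewrite comp1A R_TP -comp1A IHm comp1A.
Qed.

Section Whiskered.
Context (Y : K) (F : ob (Hom Y P)).

Lemma R_wpw m (a : arr (Hom P P)) b : R \wl a = b \wr R ->
  R \wl (pow1 TP m \wl a \wr F) = pow1 T m \wl b \wr (R \c F).
Proof.
by move=> e; rewrite wl_wr wl_wl R_pow -wl_wl e wl_wr wr_wr.
Qed.
End Whiskered.

(** The mediating cell [mu] is found over X. It lifts to P because it is a morphism of vector
    fields, and its equations and uniqueness lift because [R] is faithful. *)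
Lemma TnP_pullback k : 0 < k -> forall (Y : K) (F : ob (Hom Y P)) (m : nat),
  is_nfold_pullback (pow1 TP m \wl pP \wr F) (pow1 TP m \c TnP k \c F)
    (fun j : 'I_k => pow1 TP m \wl piP j \wr F).
Proof.
move=> k0 Y F m; have [eT vT] := TnPP k0.
have [dpP cpP] := pP_arrow.
have Api (j : 'I_k) : arrow (pow1 TP m \wl piP j \wr F) (pow1 TP m \c TnP k \c
  F) (pow1 TP m \c TP \c F).
  by have [d c] := piP_arrow j k0; split; dc; rewrite ?d ?c.
have Ap : arrow (pow1 TP m \wl pP \wr F) (pow1 TP m \c TP \c F) (pow1 TP m \c
  F).
  by split; dc; rewrite ?dpP ?cpP ?comp1_idr.
have eTm : R \c (pow1 TP m \c TnP k \c F) = pow1 T m \c tTn X k \c (R \c F).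
  by rewrite !comp1A R_pow -!comp1A (comp1A R) eT !comp1A.
have [Aq eq univ] := Tn_pullback X k0 (R \c F) m.
split.
- by move=> j; rewrite Ap.1; exact: Api.
- move=> i j; apply: cl_faithful.
  + by rewrite !dom_cmp ?(Api _).1 ?(Api _).2 ?Ap.1.
  + by rewrite !cod_cmp ?(Api _).2 ?Ap.1.
  + rewrite !wl_cmp ?(Api _).2 ?Ap.1 //.
    by rewrite (R_wpw _ _ R_pP) !(R_wpw _ _ (R_piP _ k0)) (eq i j).
move=> A f Af ef.
have [|i j|mu [[Amu muE] umu]] := univ (R \c A) (fun j => R \wl f j).
- move=> j; have [df cf] := Af j; split; first by dc; rewrite df.
  rewrite cod_hcmp cf Ap.1 cod_idt !comp1A R_pow -!comp1A (comp1A R) R_TP.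
  by dc.
- by rewrite -!(R_wpw _ _ R_pP) -!wl_cmp ?(ef i j) //;
  [case: (Af j)|case: (Af i)].
have [||b [Ab eb]] := cl_full (H := A) (H' := pow1 TP m \c TnP k \c F) (f :=
  mu).
- by rewrite eTm.
- move=> i.
  have [Aq' _ _] := Tn_pullback X k0 (R \c F) m.+1.
  (* T of the pullback at stage [m], that is the one at stage [m.+1]: after its projections,
     compatibility of [mu] with the fields becomes that of the cells [R f_j], which come from P. *)
  have pb' : is_nfold_pullback (T \wl (pow1 T m \wl tp X \wr (R \c F)))
      (T \c (pow1 T m \c tTn X k \c (R \c F)))
      (fun j : 'I_k => T \wl (pow1 T m \wl tpi X j \wr (R \c F))).
    move: (Tn_pullback X k0 (R \c F) m.+1); rewrite /= -!comp1A.
    rewrite -wl_wr -wl_wl wl_wr.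
    by under [in X in _ -> X]eq_fun => j do rewrite wl_wr wl_wl.
  have [dmu cmu] := Amu; have [dv cv] := v_arrow i.
  have Av (H : ob (Hom Y P)) : arrow (v i \wr H) (R \c H) (T \c (R \c H)).
    by split; rewrite ?dom_hcmp ?cod_hcmp ?dv ?cv ?dom_idt ?cod_idt ?comp1A.
  apply: (pullback_inj (A := R \c A) pb').
  + have e1 : cod (v i \wr A) = dom (T \wl mu).
      by rewrite (Av _).2 dom_hcmp dmu dom_idt.
    split; first by rewrite dom_cmp // (Av _).1.
    by rewrite cod_cmp // cod_hcmp cmu cod_idt.
  + have e1 : cod mu = dom (v i \wr (pow1 TP m \c TnP k \c F)).
      by rewrite (Av _).1 cmu eTm.
    split; first by rewrite dom_cmp //.
    by rewrite cod_cmp // (Av _).2 eTm.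
  move=> j; rewrite -(R_wpw _ _ (R_piP j k0)).
  have Rc : cod (R \wl f j) = dom (v i \wr (pow1 TP m \c TP \c F)).
    by rewrite cod_hcmp (Af j).2 (Av _).1 Ap.1 cod_idt.
  rewrite [LHS]cmpA ?(Av _).2; last 2 first.
  - by rewrite dom_hcmp dmu dom_idt.
  - by rewrite cod_hcmp cmu dom_hcmp dom_hcmp (Api j).1 !dom_idt !cod_idt eTm.

  rewrite -wl_cmp; last by rewrite cmu dom_hcmp (Api j).1 dom_idt eTm.
  rewrite (R_wpw _ _ (R_piP j k0)) muE (v_nat i (Af j)) Ap.1.
  rewrite [RHS]cmpA; last 2 first.
  - by rewrite cmu (Av _).1 eTm.
  - by rewrite (Av _).2 -(R_wpw _ _ (R_piP j k0)) dom_hcmp dom_hcmp (Api j).1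
    !dom_idt.
  rewrite -(R_wpw _ _ (R_piP j k0)) (v_nat i (Api j)) -cmpA; last 2 first.
  - by rewrite cmu dom_hcmp (Api j).1 dom_idt eTm.
  - by rewrite (Av _).1 cod_hcmp (Api j).2 cod_idt.
  by rewrite (R_wpw _ _ (R_piP j k0)) muE.
have cb B (b' : arr (Hom Y P)) (j : 'I_k) : arrow b' B (pow1 TP m \c TnP k \c
  F) ->
    cod b' = dom (pow1 TP m \wl piP j \wr F).
  by move=> [_ ->]; rewrite (Api j).1.
exists b; split=> [|b' [Ab' b'E]].
  split=> // j; have [df cf] := Af j; have [db cb'] := Ab.
  apply: cl_faithful.
  - by rewrite dom_cmp ?df // (cb _ _ j Ab).
  - by rewrite cod_cmp ?cf ?(Api j).2 ?Ap.1 // (cb _ _ j Ab).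
  - by rewrite wl_cmp ?(cb _ _ j Ab) // (R_wpw _ _ (R_piP j k0)) eb muE.
have [db cb'] := Ab; have [db' cb''] := Ab'.
apply: cl_faithful; rewrite ?db ?cb' ?db' ?cb'' // eb.
apply: umu; split=> [|j].
  by split; rewrite ?dom_hcmp ?cod_hcmp ?db' ?cb'' ?dom_idt ?cod_idt.
by rewrite -(R_wpw _ _ (R_piP j k0)) -wl_cmp ?b'E // (cb _ _ j Ab').
Qed.

Lemma dom_pP : dom pP = TP. Proof. exact: pP_arrow.1. Qed.
Lemma cod_pP : cod pP = id1 P. Proof. exact: pP_arrow.2. Qed.
Lemma dom_zP : dom zP = id1 P. Proof. exact: zP_arrow.1. Qed.
Lemma cod_zP : cod zP = TP. Proof. exact: zP_arrow.2. Qed.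
Lemma dom_sP : dom sP = TnP 2. Proof. exact: sP_arrow.1. Qed.
Lemma cod_sP : cod sP = TP. Proof. exact: sP_arrow.2. Qed.
Lemma dom_lP : dom lP = TP. Proof. exact: lP_arrow.1. Qed.
Lemma cod_lP : cod lP = TP \c TP. Proof. exact: lP_arrow.2. Qed.
Lemma dom_cP : dom cP = TP \c TP. Proof. exact: cP_arrow.1. Qed.
Lemma cod_cP : cod cP = TP \c TP. Proof. exact: cP_arrow.2. Qed.
Lemma dom_piP i : dom (@piP 2 i) = TnP 2. Proof. by have [] :=
  piP_arrow i isT. Qed.
Lemma cod_piP i : cod (@piP 2 i) = TP. Proof. by have [] :=
  piP_arrow i isT. Qed.
Lemma dom_piP3 i : dom (@piP 3 i) = TnP 3. Proof. by have [] :=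
  piP_arrow i isT. Qed.
Lemma cod_piP3 i : cod (@piP 3 i) = TP. Proof. by have [] :=
  piP_arrow i isT. Qed.
Lemma dom_tpi3 i : dom (@tpi _ _ X 3 i) = tTn X 3.
Proof. by have [] := tpin_arrow (isT : 0 < 3) i. Qed.
Lemma cod_tpi3 i : cod (@tpi _ _ X 3 i) = T.
Proof. by have [] := tpin_arrow (isT : 0 < 3) i. Qed.
Lemma dom_v i : dom (v i) = R. Proof. exact: (v_arrow i).1. Qed.
Lemma cod_v i : cod (v i) = T \c R. Proof. exact: (v_arrow i).2. Qed.
#[local] Hint Rewrite dom_v cod_v dom_pP cod_pP dom_zP cod_zP dom_sP cod_sP
  dom_lP cod_lP
  dom_cP cod_cP dom_piP cod_piP dom_piP3 cod_piP3 dom_tpi3 cod_tpi3 : cell.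

Section Pb.
Context (k : nat) (k0 : 0 < k).

Lemma TnP_pb Y (F : ob (Hom Y P)) :
  is_nfold_pullback (pP \wr F) (TnP k \c F) (fun i : 'I_k => piP i \wr F).
Proof.
move: (TnP_pullback k0 F 0); rewrite /= hcmp_idl comp1_idl.
by under eq_fun => i do rewrite hcmp_idl.
Qed.

Lemma TnP_pbT : is_nfold_pullback (TP \wl pP) (TP \c TnP k)
  (fun i : 'I_k => TP \wl piP i).
Proof.
move: (TnP_pullback k0 (id1 P) 1); rewrite /= hcmp_idr !comp1_idr.
by under eq_fun => i do rewrite hcmp_idr.
Qed.

Lemma TnP_pb0 : is_nfold_pullback pP (TnP k) (@piP k).
Proof.
move: (TnP_pb (id1 P)); rewrite /= hcmp_idr !comp1_idr.
by under eq_fun => i do rewrite hcmp_idr.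
Qed.
End Pb.

(** An equation between composites of cells of P follows from its counterpart in X once each factor
    lifts the corresponding one, by [lifts_inj]. *)
Definition lifts (a : arr (Hom P P)) (a' : arr (Hom X X)) := R \wl a = a' \wr R.

Lemma lifts_cmp a b a' b' : cod a = dom b -> cod a' = dom b' ->
  lifts b b' -> lifts a a' -> lifts (b \v a) (b' \v a').
Proof. by move=> e e' hb ha; rewrite /lifts wl_cmp // hb ha wr_cmp. Qed.

Lemma lifts_T a a' : lifts a a' -> lifts (TP \wl a) (T \wl a').
Proof. by move=> h; rewrite /lifts wl_wl R_TP -wl_wl h wl_wr. Qed.

Lemma lifts_wT a a' : lifts a a' -> lifts (a \wr TP) (a' \wr T).
Proof. by move=> h; rewrite /lifts wl_wr h !wr_wr R_TP. Qed.

Lemma lifts_id : lifts (idt (id1 P)) (idt (id1 X)).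
Proof. by rewrite /lifts hcmp_idl hcmp_idr. Qed.

Lemma lifts_idT : lifts (idt TP) (idt T).
Proof. by rewrite /lifts !hcmp_idt R_TP. Qed.

Lemma lifts_idTT : lifts (idt (TP \c TP)) (idt (T \c T)).
Proof. by rewrite /lifts !hcmp_idt R_TTP comp1A. Qed.

Lemma lifts_inj a b a' : dom a = dom b -> cod a = cod b -> lifts a a' ->
  lifts b a' -> a = b.
Proof. by move=> d c ha hb; apply: cl_faithful; rewrite ?ha ?hb. Qed.

(** Both whiskered pairings have the same projections in the pullback [pb''], the pullback of X
    whiskered with [R]. *)
Lemma lifts_pair q q' q'' E E' (pr : 'I_2 -> arr (Hom P P)) (pr' : 'I_2 ->
  arr (Hom X X))
    A A' x y x' y' :
  is_nfold_pullback q E pr -> is_nfold_pullback q' E' pr' ->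
  is_nfold_pullback q'' (E' \c R) (fun i => pr' i \wr R) ->
  lifts q q' -> (forall i, lifts (pr i) (pr' i)) -> R \c E = E' \c R ->
  arrow x A (dom q) -> arrow y A (dom q) -> arrow x' A' (dom q') ->
    arrow y' A' (dom q') ->
  R \c A = A' \c R -> q' \v x' = q' \v y' -> lifts x x' -> lifts y y' ->
  [/\ arrow (pair_arr pr x y) A E, arrow (pair_arr pr' x' y') A' E'
    & lifts (pair_arr pr x y) (pair_arr pr' x' y')].
Proof.
move=> pb pb' pb'' hq hpr eE Ax Ay Ax' Ay' eA exy' hx hy.
have [dx cx] := Ax; have [dy cy] := Ay; have [dx' cx'] := Ax';
  have [dy' cy'] := Ay'.
have exy : q \v x = q \v y.
  apply: (lifts_inj (a' := q' \v x')); rewrite ?dom_cmp ?cod_cmp ?dx //.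
  - exact: lifts_cmp.
  - by rewrite exy'; exact: lifts_cmp.
have [Am m1 m2] := pair_arrP pb Ax Ay exy.
have [Am' m1' m2'] := pair_arrP pb' Ax' Ay' exy'.
split=> //; set m := pair_arr _ _ _ in Am m1 m2 *;
  set m' := pair_arr _ _ _ in Am' m1' m2' *.
have [dm cm] := Am; have [dm' cm'] := Am'.
have dpr i : dom (pr i) = E by case: pb => /(_ i)[].
have dpr' i : dom (pr' i) = E' by case: pb' => /(_ i)[].
apply: (pullback_inj (A := R \c A) pb'').
- by split; rewrite ?dom_hcmp ?cod_hcmp ?dm ?cm ?dom_idt ?cod_idt.
- by split; rewrite ?dom_hcmp ?cod_hcmp ?dm' ?cm' ?dom_idt ?cod_idt.
apply: ord2P.
- by rewrite -hpr -wl_cmp ?cm ?dpr // m1 hpr -wr_cmp ?cm' ?dpr' // m1' hx.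
- by rewrite -hpr -wl_cmp ?cm ?dpr // m2 hpr -wr_cmp ?cm' ?dpr' // m2' hy.
Qed.

Lemma R_TnP2 : R \c TnP 2 = tTn X 2 \c R. Proof. exact: (@TnPP 2 isT).1. Qed.

Lemma T2X_pbR : is_nfold_pullback (T \wl tp X \wr R) (T \c tTn X 2 \c R)
  (fun i => T \wl @tpi _ _ X 2 i \wr R).
Proof. by move: (@Tn_pullback _ _ X 2 isT P R 1); rewrite /= comp1_idr. Qed.

Section Pairs.
Context (A : ob (Hom P P)) (A' : ob (Hom X X)) (eA : R \c A = A' \c R).
Context (x y : arr (Hom P P)) (x' y' : arr (Hom X X)).
Context (hx : lifts x x') (hy : lifts y y').

Lemma lifts_pair0 : arrow x A TP -> arrow y A TP -> arrow x' A' T ->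
  arrow y' A' T ->
  tp X \v x' = tp X \v y' ->
  [/\ arrow (pair_arr (@piP 2) x y) A (TnP 2),
      arrow (pair_arr (@tpi _ _ X 2) x' y') A' (tTn X 2)
    & lifts (pair_arr (@piP 2) x y) (pair_arr (@tpi _ _ X 2) x' y')].
Proof.
move=> Ax Ay Ax' Ay' e.
apply: (lifts_pair (@TnP_pb0 2 isT) (@Tn_pb0 _ _ X 2 isT) (T2_pb X R) (A' :=
  A')) => //.
- exact: R_pP.
- by move=> i; exact: R_piP.
- exact: R_TnP2.
- by rewrite dom_pP.
- by rewrite dom_pP.
- by rewrite dom_tp.
- by rewrite dom_tp.
Qed.

Lemma lifts_pairT : arrow x A (TP \c TP) -> arrow y A (TP \c TP) ->
  arrow x' A' (T \c T) -> arrow y' A' (T \c T) ->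
  (T \wl tp X) \v x' = (T \wl tp X) \v y' ->
  [/\ arrow (pair_arr (fun i => TP \wl @piP 2 i) x y) A (TP \c TnP 2),
      arrow (pair_arr (fun i => T \wl @tpi _ _ X 2 i) x' y') A' (T \c tTn X 2)
    & lifts (pair_arr (fun i => TP \wl @piP 2 i) x y)
        (pair_arr (fun i => T \wl @tpi _ _ X 2 i) x' y')].
Proof.
move=> Ax Ay Ax' Ay' e.
apply: (lifts_pair (@TnP_pbT 2 isT) (@Tn_pbT _ _ X 2 isT) T2X_pbR (A' :=
  A')) => //.
- by apply: lifts_T; exact: R_pP.
- by move=> i; apply: lifts_T; exact: R_piP.
- by rewrite comp1A R_TP -comp1A R_TnP2 comp1A.
- by rewrite dom_hcmp dom_pP dom_idt.
- by rewrite dom_hcmp dom_pP dom_idt.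
- by rewrite dom_hcmp dom_tp dom_idt.
- by rewrite dom_hcmp dom_tp dom_idt.
Qed.

Lemma lifts_pairw : arrow x A (TP \c TP) -> arrow y A (TP \c TP) ->
  arrow x' A' (T \c T) -> arrow y' A' (T \c T) ->
  (tp X \wr T) \v x' = (tp X \wr T) \v y' ->
  [/\ arrow (pair_arr (fun i => @piP 2 i \wr TP) x y) A (TnP 2 \c TP),
      arrow (pair_arr (fun i => @tpi _ _ X 2 i \wr T) x' y') A' (tTn X 2 \c T)
    & lifts (pair_arr (fun i => @piP 2 i \wr TP) x y)
        (pair_arr (fun i => @tpi _ _ X 2 i \wr T) x' y')].
Proof.
move=> Ax Ay Ax' Ay' e.
have pb'' : is_nfold_pullback (tp X \wr T \wr R) (tTn X 2 \c T \c R)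
    (fun i => @tpi _ _ X 2 i \wr T \wr R).
  move: (T2_pb X (T \c R)); rewrite comp1A -wr_wr.
  by under [in X in _ -> X]eq_fun => i do rewrite wr_wr.
apply: (lifts_pair (@TnP_pb 2 isT _ TP) (T2_pb X T) pb'' (A' := A')) => //.
- by apply: lifts_wT; exact: R_pP.
- by move=> i; apply: lifts_wT; exact: R_piP.
- by rewrite comp1A R_TnP2 -comp1A R_TP comp1A.
- by rewrite dom_hcmp dom_pP dom_idt.
- by rewrite dom_hcmp dom_pP dom_idt.
- by rewrite dom_hcmp dom_tp dom_idt.
- by rewrite dom_hcmp dom_tp dom_idt.
Qed.
End Pairs.

Lemma lifts_sum A A' x y x' y' : R \c A = A' \c R -> lifts x x' -> lifts y y' ->
  arrow x A TP -> arrow y A TP -> arrow x' A' T -> arrow y' A' T ->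
  tp X \v x' = tp X \v y' ->
  [/\ arrow (sP \v pair_arr (@piP 2) x y) A TP,
      arrow (ts X \v pair_arr (@tpi _ _ X 2) x' y') A' T,
      tp X \v (ts X \v pair_arr (@tpi _ _ X 2) x' y') = tp X \v x'
    & lifts (sP \v pair_arr (@piP 2) x y) (ts X \v pair_arr (@tpi _ _ X 2) x'
      y')].
Proof.
move=> eA hx hy Ax Ay Ax' Ay' e.
have [[d c] [d' c'] h] := lifts_pair0 eA hx hy Ax Ay Ax' Ay' e.
have AT w : arrow w A' T -> arrow w A' (dom (tp X)) by rewrite dom_tp.
have [_ e1 _] := pair_arrP (@Tn_pb0 _ _ X 2 isT) (AT _ Ax') (AT _ Ay') e.
have cs : cod (pair_arr (@tpi _ _ X 2) x' y') = dom (ts X) by rewrite c' dom_ts.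
have csP : cod (pair_arr (@piP 2) x y) = dom sP by rewrite c dom_sP.
split.
- by split; rewrite ?dom_cmp ?cod_cmp // cod_sP.
- by split; rewrite ?dom_cmp ?cod_cmp // cod_ts.
- rewrite cmpA //; last by dc.
  by rewrite ps -cmpA ?e1 //; [rewrite c'|]; dc.
- by apply: lifts_cmp => //; exact: R_sP.
Qed.

Lemma lifts_pi3 i : lifts (@piP 3 i) (@tpi _ _ X 3 i).
Proof. exact: R_piP. Qed.
Lemma lifts_pi i : lifts (@piP 2 i) (@tpi _ _ X 2 i).
Proof. exact: R_piP. Qed.

Lemma sPA : let q1 := piP (@Ordinal 3 0 isT) in
       let q2 := piP (@Ordinal 3 1 isT) in
       let q3 := piP (@Ordinal 3 2 isT) in
    sP \v pair_arr (@piP 2) (sP \v pair_arr (@piP 2) q1 q2) q3 =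
    sP \v pair_arr (@piP 2) q1 (sP \v pair_arr (@piP 2) q2 q3).
Proof.
have [_ qq _] := @Tn_pb0 _ _ X 3 isT.
have eA : R \c TnP 3 = tTn X 3 \c R by exact: (@TnPP 3 isT).1.
have Aq i := @piP_arrow 3 i isT.
have Aq' i : arrow (@tpi _ _ X 3 i) (tTn X 3) T by exact: tpin_arrow.
move=> q1 q2 q3.
have [A1 B1 e1 h1] := lifts_sum eA (lifts_pi3 (@Ordinal 3 0 isT)) (lifts_pi3
  (@Ordinal 3 1 isT))
  (Aq _) (Aq _) (Aq' _) (Aq' _) (qq _ _).
have [A2 B2 e2 h2] := lifts_sum eA (lifts_pi3 (@Ordinal 3 1 isT)) (lifts_pi3
  (@Ordinal 3 2 isT))
  (Aq _) (Aq _) (Aq' _) (Aq' _) (qq _ _).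
have [A3 B3 _ h3] := lifts_sum eA h1 (lifts_pi3 (@Ordinal 3 2 isT))
  A1 (Aq _) B1 (Aq' _) (etrans e1 (qq _ _)).
have [A4 B4 _ h4] := lifts_sum eA (lifts_pi3 (@Ordinal 3 0 isT)) h2
  (Aq _) A2 (Aq' _) B2 (etrans (qq _ _) (esym e2)).
apply: (lifts_inj _ _ h3).
- by rewrite A3.1 A4.1.
- by rewrite A3.2 A4.2.
- by rewrite (sA X); exact: h4.
Qed.

Lemma sPC : sP \v pair_arr (@piP 2) (piP k2) (piP k1) = sP.
Proof.
have Aq i := @piP_arrow 2 i isT.
have [A1 B1 e1 h1] := lifts_sum R_TnP2 (lifts_pi k2) (lifts_pi k1)
  (Aq _) (Aq _) (pi_arrow X _) (pi_arrow X _) (p_tpi X _).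
apply: (lifts_inj _ _ h1); rewrite ?A1.1 ?A1.2; try by dc.
by rewrite (sC X); exact: R_sP.
Qed.

Lemma sP_unit : sP \v pair_arr (@piP 2) (zP \v pP) (idt TP) = idt TP.
Proof.
have hz : lifts (zP \v pP) (tz X \v tp X).
  by apply: lifts_cmp; try (by dc); [exact: R_zP|exact: R_pP].
have [|||||A1 B1 e1 h1] := lifts_sum R_TP hz lifts_idT; try by split; dc.
  by rewrite cmpA ?pz ?cmp_idl' ?cmp_idr' //; dc.
apply: (lifts_inj _ _ h1); rewrite ?A1.1 ?A1.2; try by dc.
by rewrite (s_unit X); exact: lifts_idT.
Qed.

(** Proves [lifts a a'] by following the common shape of the two composites. *)
Ltac lft := repeat first
  [ exact: R_pP | exact: R_zP | exact: R_sP | exact: R_lP | exact: R_cP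
  | exact: lifts_pi | exact: lifts_id | exact: lifts_idT | exact: lifts_idTT
  | apply: lifts_T | apply: lifts_wT | apply: lifts_cmp; [by dc | by dc | | ] ].

Lemma pzP : pP \v zP = idt (id1 P).
Proof. by apply: (lifts_inj (a' := idt (id1 X))); try (by dc);
  [rewrite -(pz X)|]; lft. Qed.

Lemma psP : pP \v sP = pP \v piP k1.
Proof. by apply: (lifts_inj (a' := tp X \v ts X)); try (by dc); [|rewrite ps];
  lft. Qed.

Lemma lpP : (TP \wl pP) \v lP = zP \v pP.
Proof. by apply: (lifts_inj (a' := tz X \v tp X)); try (by dc);
  [rewrite -(lp X)|]; lft. Qed.

Lemma lzP : lP \v zP = (TP \wl zP) \v zP.
Proof. by apply: (lifts_inj (a' := tl X \v tz X)); try (by dc); [|rewrite lz];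
  lft. Qed.

Lemma cpP : (pP \wr TP) \v cP = TP \wl pP.
Proof. by apply: (lifts_inj (a' := T \wl tp X)); try (by dc);
  [rewrite -(cp X)|]; lft. Qed.

Lemma czP : cP \v (TP \wl zP) = zP \wr TP.
Proof. by apply: (lifts_inj (a' := tz X \wr T)); try (by dc);
  [rewrite -(cz X)|]; lft. Qed.

Lemma llP : (TP \wl lP) \v lP = (lP \wr TP) \v lP.
Proof. by apply: (lifts_inj (a' := (T \wl tl X) \v tl X)); try (by dc);
  [|rewrite ll]; lft. Qed.

Lemma clP : cP \v lP = lP.
Proof. by apply: (lifts_inj (a' := tl X)); try (by dc); [rewrite -(cl X)|];
  lft. Qed.

Lemma cclP : (cP \wr TP) \v (TP \wl cP) \v (lP \wr TP) = (TP \wl lP) \v cP.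
Proof.
by apply: (lifts_inj (a' := (T \wl tl X) \v tc X)); try (by dc);
  [rewrite -(ccl X)|]; lft.
Qed.

Lemma ccP : cP \v cP = idt (TP \c TP).
Proof. by apply: (lifts_inj (a' := idt (T \c T))); try (by dc);
  [rewrite -(cc X)|]; lft. Qed.

Lemma cccP : (TP \wl cP) \v (cP \wr TP) \v (TP \wl cP) =
        (cP \wr TP) \v (TP \wl cP) \v (cP \wr TP).
Proof.
by apply: (lifts_inj (a' := (T \wl tc X) \v (tc X \wr T) \v (T \wl tc X)));
  try (by dc);
  [|rewrite ccc]; lft.
Qed.

Lemma lsP : lP \v sP = (TP \wl sP) \v
    pair_arr (fun i => TP \wl @piP 2 i) (lP \v piP k1) (lP \v piP k2).
Proof.
have [|||||||[dm cm] [_ cm'] h] := lifts_pairT R_TnP2 (x := lP \v piP k1) (y :=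
  lP \v piP k2)
  (x' := tl X \v tpi X k1) (y' := tl X \v tpi X k2); try (by split; dc);
    try by lft.
  rewrite !cmpA; try by dc.
  by rewrite lp -!cmpA ?(p_tpi X k2) //; dc.
apply: (lifts_inj (a' := tl X \v ts X)).
- by rewrite !dom_cmp ?dm ?cm; dc.
- by rewrite !cod_cmp ?dm ?cm; dc.
- by lft.
rewrite ls; apply: lifts_cmp h; rewrite ?cm; first by dc.
- by rewrite cm'; dc.
- by lft.
Qed.

Lemma csP : cP \v (TP \wl sP) = (sP \wr TP) \v
    pair_arr (fun i => @piP 2 i \wr TP)
      (cP \v (TP \wl piP k1)) (cP \v (TP \wl piP k2)).
Proof.
have eA : R \c (TP \c TnP 2) = (T \c tTn X 2) \c R.
  by rewrite comp1A R_TP -comp1A R_TnP2 comp1A.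
have [|||||||[dm cm] [_ cm'] h] := lifts_pairw eA (x :=
  cP \v (TP \wl piP k1)) (y := cP \v (TP \wl piP k2))
  (x' := tc X \v (T \wl tpi X k1)) (y' := tc X \v (T \wl tpi X k2));
    try (by split; dc); try by lft.
  rewrite !cmpA; try by dc.
  by rewrite cp -!wl_cmp ?(p_tpi X k2) //; dc.
apply: (lifts_inj (a' := tc X \v (T \wl ts X))).
- by rewrite !dom_cmp ?dm ?cm; dc.
- by rewrite !cod_cmp ?dm ?cm; dc.
- by lft.
rewrite cs; apply: lifts_cmp h; rewrite ?cm; first by dc.
- by rewrite cm'; dc.
- by lft.
Qed.

Definition nuP := (TP \wl sP) \v pair_arr (fun i => TP \wl @piP 2 i)
  (lP \v piP k1) ((zP \wr TP) \v piP k2).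
Local Notation nuX := ((T \wl ts X) \v pair_arr (fun i => T \wl @tpi _ _ X 2 i)
  (tl X \v tpi X k1) ((tz X \wr T) \v tpi X k2)).

Lemma nuPP : arrow nuP (TnP 2) (TP \c TP) /\ lifts nuP nuX.
Proof.
have [|||||||[dm cm] [dm' cm'] h] := lifts_pairT R_TnP2 (x := lP \v piP k1)
  (y := (zP \wr TP) \v piP k2) (x' := tl X \v tpi X k1)
  (y' := (tz X \wr T) \v tpi X k2); try (by split; dc); try by lft.
  rewrite !cmpA; try by dc.
  rewrite lp (z_nat (tp_arrow X)) -!cmpA; try by dc.
  by rewrite hcmp_idr (p_tpi X k2).
split; last by apply: lifts_cmp h; rewrite ?cm ?cm'; [dc|dc|lft].
by split; rewrite /nuP ?dom_cmp ?cod_cmp ?dm ?cm; dc.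
Qed.

Section VerticalLift.
Context (Y : K) (F : ob (Hom Y P)).

Lemma lifts_wr a a' : lifts a a' -> R \wl (a \wr F) = a' \wr (R \c F).
Proof. by move=> h; rewrite wl_wr h wr_wr. Qed.

(** The mediating [mu] again exists over X and has to respect the fields. Its second component, the
    base point, does so by applying [p_T] to the compatibility of [x] ([Q2]); its first, the
    vertical part, by [vertical_compat] ([Q1]). *)
Lemma vertical_liftP : is_pullback (nuP \wr F) ((pP \v piP k1) \wr F)
      (TP \wl pP \wr F) (zP \wr F).
Proof.
have [[dnu cnu] hnu] := nuPP.
have [[dnX cnX] cbX cfX ecX univ] := vertical_lift X (R \c F).
have hb : lifts (pP \v piP k1) (tp X \v tpi X k1) by lft.
have hf : lifts (TP \wl pP) (T \wl tp X) by lft.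
have hg : lifts zP (tz X) by lft.
split.
- by split; dc; rewrite ?dnu ?cnu; dc.
- by dc.
- by dc.
- apply: cl_faithful.
  + by rewrite !dom_cmp; dc; rewrite ?dnu ?cnu; dc.
  + by rewrite !cod_cmp; dc; rewrite ?dnu ?cnu; dc.
  + rewrite !wl_cmp; try by (dc; rewrite ?dnu ?cnu; dc).
    by rewrite (lifts_wr hf) (lifts_wr hg) (lifts_wr hnu) (lifts_wr hb) ecX.
move=> x y dxy cx cy exy.
have eRx : R \wl x = R \wl x by [].
have [|||| mu [[Amu mu1 mu2] umu]] := univ (R \wl x) (R \wl y).
- by rewrite !dom_hcmp dxy.
- rewrite cod_hcmp cx; dc; by rewrite R_TP -!comp1A (comp1A R) R_TP; dc.
- by rewrite cod_hcmp cy; dc.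
- by rewrite -(lifts_wr hf) -(lifts_wr hg) -!wl_cmp ?exy ?cx ?cy.
set A := dom x.
have eT2F : R \c (TnP 2 \c F) = tTn X 2 \c (R \c F).
  by rewrite comp1A R_TnP2 comp1A.
have [dmu cmu] := Amu.
have Amu' : arrow mu (R \c A) (tTn X 2 \c (R \c F)).
  by split; rewrite ?dmu ?cmu; dc.
have [||b [Ab eb]] := cl_full (H := A) (H' := TnP 2 \c F) (f := mu).
- by rewrite eT2F.
- move=> i; have [dv cv] := v_arrow i.
  have Av (H : ob (Hom Y P)) : arrow (v i \wr H) (R \c H) (T \c (R \c H)).
    by split; rewrite ?dom_hcmp ?cod_hcmp ?dv ?cv ?dom_idt ?cod_idt ?comp1A.
  pose MU : cell (R \c A) (tTn X 2 \c (R \c F)) := Cell Amu'.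
  pose VA : cell (R \c A) (T \c (R \c A)) := Cell (Av A).
  pose VF : cell (R \c F) (T \c (R \c F)) := Cell (Av F).
  have A2 : arrow (v i \wr (TnP 2 \c F)) (tTn X 2 \c (R \c F)) (T \c (tTn X 2
    \c (R \c F))).
    by rewrite -eT2F; exact: Av.
  pose V2 : cell (tTn X 2 \c (R \c F)) (T \c (tTn X 2 \c (R \c F))) := Cell A2.
  have V2E j : Tcell (picell j (R \c F)) \@ V2 =
      ccell (R \c F) \@ (Tcell VF \@ picell j (R \c F)).
    have := congr1 (fun a => a \wr F) ((@TnPP 2 isT).2 i j).
    rewrite v_TP !wr_cmp; try by (dc; rewrite -?comp1A ?R_TnP2).
    rewrite -!wl_wr !wr_wr => e; apply: cell_eq; rewrite /= e -cmpA //; by dc.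
  have Ax : arrow (R \wl x) (R \c A) (T \c (T \c (R \c F))).
    split; first by rewrite dom_hcmp dom_idt.
    rewrite cod_hcmp cx; dc; by rewrite R_TP -!comp1A (comp1A R) R_TP; dc.
  pose XC : cell (R \c A) (T \c (T \c (R \c F))) := Cell Ax.
  have XCE : Tcell XC \@ VA =
      ccell (T \c (R \c F)) \@ (Tcell (ccell (R \c F)) \@ (Tcell (Tcell VF) \@
        XC)).
    have Axx : arrow x A (TP \c (TP \c F)) by split; rewrite // cx; dc.
    have := v_nat i Axx; rewrite (comp1A TP) -(wr_wr F) v_TTP /=.
    rewrite !wr_cmp; try by dc.
    rewrite -!wl_wr !wr_wr -!comp1A => e; apply: cell_eq; rewrite /= e.
    have cX : R \c cod x = T \c T \c R \c F by have [_] := Ax; dc.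
    by rewrite -!cmpA //; dc; rewrite cX.
  have fk : pcell (R \c F) \@ (picell k1 (R \c F) \@ MU) =
      pcell (R \c F) \@ (picell k2 (R \c F) \@ MU).
    by rewrite !vcmpA (ppi_cell k1 k2).
  have vX : vert (C := CT Y) (picell k1 (R \c F) \@ MU) (picell k2 (R \c F) \@
    MU) = XC.
    have [nu enu nuE] := nu_cell (R \c F).
    rewrite /vert /add2 /= -nuE; apply: cell_eq; rewrite /= enu; exact: mu1.
  have Q2 : Tcell (picell k2 (R \c F) \@ MU) \@ VA =
      ccell (R \c F) \@ (Tcell VF \@ (picell k2 (R \c F) \@ MU)).
    have <- : pcell (T \c (R \c F)) \@ XC = picell k2 (R \c F) \@ MU.
      by rewrite -vX; exact: (P_vert (C := CT Y)).
    rewrite TcellM -vcmpA XCE Tp_ccell !vcmpA pcell_nat -!vcmpA.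
    by rewrite (vcmpA (pcell _) (Tcell (Tcell VF))) pcell_nat -!vcmpA.
  have Q1 : Tcell (picell k1 (R \c F) \@ MU) \@ VA =
      ccell (R \c F) \@ (Tcell VF \@ (picell k1 (R \c F) \@ MU)).
    apply: (vertical_compat (C := CT Y) (a := VA) (b := VF) fk fk Q2).
    by move: vX; rewrite /vert => ->; exact: XCE.
  have E : Tcell MU \@ VA = V2 \@ MU.
    apply: Tpair_cell_inj; rewrite !vcmpA V2E -TcellM -!vcmpA.
    - exact: Q1.
    - exact: Q2.
  exact: (congr1 (fun a => sval a) E).
have [db cb] := Ab.
exists b; split.
  split; first by split; rewrite ?db ?cb; dc.
  - apply: cl_faithful; rewrite ?dom_cmp ?cod_cmp ?db ?cb; try by (dc;
    rewrite ?dnu ?cnu ?cx ?cy; dc).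
    rewrite wl_cmp; last by dc; rewrite cb dnu.
    by rewrite (lifts_wr hnu) eb mu1.
  - apply: cl_faithful; rewrite ?dom_cmp ?cod_cmp ?db ?cb; try by (dc;
    rewrite ?dnu ?cnu ?cx ?cy; dc).
    rewrite wl_cmp; last by rewrite cb; dc.
    by rewrite (lifts_wr hb) eb mu2.
move=> b' [[db' cb'] b1 b2].
apply: cl_faithful.
- by rewrite db db'.
- by rewrite cb cb'; dc.
rewrite eb; apply: umu; split.
- by split; rewrite ?dom_hcmp ?cod_hcmp ?db' ?cb'; dc; rewrite R_TnP2.
- rewrite -(lifts_wr hnu) -wl_cmp ?b1 //; rewrite cb'; dc; by rewrite dnu.
- by rewrite -(lifts_wr hb) -wl_cmp ?b2 // cb'; dc.
Qed.
End VerticalLift.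

Definition classifier_structure : tangent_structure P :=
  @TangentStructure K P TP pP TnP piP zP sP lP cP pP_arrow zP_arrow sP_arrow
    lP_arrow cP_arrow TnP_pullback pzP psP sPA sPC sP_unit lpP lzP lsP cpP czP
    csP llP clP cclP ccP cccP (@vertical_liftP).

(** Keeps of the construction only how [R] maps the structure of P to that of X, which is what
    strictness of the projections requires. *)
Lemma classifier_tangent : exists S : tangent_structure P,
  [/\ R \c tT S = T \c R,
      forall i, v i \wr tT S = (tc X \wr R) \v (T \wl v i),
      R \wl tp S = tp X \wr R /\ R \wl tz S = tz X \wr R,
      (forall j, R \wl @tpi _ _ S 2 j = @tpi _ _ X 2 j \wr R) /\ R \wl ts S =
        ts X \wr R
    & R \wl tl S = tl X \wr R /\ R \wl tc S = tc X \wr R].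
Proof.
exists classifier_structure; split.
- exact: R_TP.
- exact: v_TP.
- by split; [exact: R_pP | exact: R_zP].
- by split; [move=> j; exact: R_piP | exact: R_sP].
- by split; [exact: R_lP | exact: R_cP].
Qed.
End Classifier.

(** * Strict morphisms as 1-cells preserving the structure *)

Section StrictFacts.
Context (K : two_category) (X Y : tangentad K).

Lemma strict_of_preserves (F : ob (Hom (tan_ob X) (tan_ob Y))) :
  F \c tT X = tT Y \c F -> F \wl tp X = tp Y \wr F -> F \wl tz X = tz Y \wr F ->
  F \wl ts X = (ts Y \wr F) \v pair_arr (fun i => @tpi _ _ Y 2 i \wr F)
      (F \wl tpi X k1) (F \wl tpi X k2) ->
  F \wl tl X = tl Y \wr F -> F \wl tc X = tc Y \wr F ->
  exists S : strict_morphism X Y, lax_ob S = F.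
Proof.
move=> eT ep ez es el ec.
have dF (a : arr (Hom (tan_ob X) (tan_ob X))) : cod a = tT X ->
  idt (F \c tT X) \v (F \wl a) = F \wl a.
  by move=> e; rewrite cmp_idl' // cod_hcmp cod_idt e.
have A : arrow (idt (F \c tT X)) (F \c tT X) (tT Y \c F).
  by split; rewrite ?dom_idt ?cod_idt.
have lp' : (tp Y \wr F) \v idt (F \c tT X) = F \wl tp X.
  by rewrite cmp_idr' ?ep // dom_hcmp dom_tp dom_idt.
have lz' : idt (F \c tT X) \v (F \wl tz X) = tz Y \wr F by rewrite dF ?cod_tz.
have ls' : idt (F \c tT X) \v (F \wl ts X) = (ts Y \wr F) \v
    pair_arr (fun i => @tpi _ _ Y 2 i \wr F)
      (idt (F \c tT X) \v (F \wl tpi X k1)) (idt (F \c tT X) \v (F \wl tpi X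
        k2)).
  by rewrite !dF ?cod_tpi ?cod_ts.
have TT : (tT Y \wl idt (F \c tT X)) \v (idt (F \c tT X) \wr tT X) =
    idt (F \c (tT X \c tT X)).
  by rewrite !hcmp_idt !comp1A -eT cmp_idl' // cod_idt.
have ll' : (tl Y \wr F) \v idt (F \c tT X) =
    (tT Y \wl idt (F \c tT X)) \v (idt (F \c tT X) \wr tT X) \v (F \wl tl X).
  rewrite cmpA; last 2 first.
  - by dc.
  - by rewrite !hcmp_idt dom_idt cod_idt comp1A eT.
  by rewrite TT cmp_idl' ?cmp_idr' ?el //; dc; rewrite eT -!comp1A eT.
have lc' : (tc Y \wr F) \v (tT Y \wl idt (F \c tT X)) \v (idt (F \c tT X) \wr
  tT X) =
    (tT Y \wl idt (F \c tT X)) \v (idt (F \c tT X) \wr tT X) \v (F \wl tc X).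
  rewrite [RHS]cmpA; last 2 first.
  - by dc.
  - by rewrite !hcmp_idt dom_idt cod_idt comp1A eT.
  rewrite TT cmp_idl'; last by dc.
  by rewrite cmp_idr' ?ec //; dc; rewrite eT -!comp1A eT.
by exists (@StrictMorphism K X Y (LaxMorphism A lp' lz' ls' ll' lc') erefl).
Qed.

Context (F : strict_morphism X Y).

Lemma strict_wl (a : arr (Hom (tan_ob X) (tan_ob X))) : cod a = tT X ->
  lax_cell F \v (F \wl a) = F \wl a.
Proof. by move=> e; rewrite strictP cmp_idl' // cod_hcmp cod_idt e. Qed.

Lemma strict_p : F \wl tp X = tp Y \wr F.
Proof.
by rewrite -lax_p strictP cmp_idr' // dom_hcmp dom_tp dom_idt -(strict_ob
  (strictP F)).
Qed.

Lemma strict_z : F \wl tz X = tz Y \wr F.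
Proof. by rewrite -lax_z strict_wl ?cod_tz. Qed.

Lemma strict_s : F \wl ts X = (ts Y \wr F) \v pair_arr (fun i =>
  @tpi _ _ Y 2 i \wr F)
  (F \wl tpi X k1) (F \wl tpi X k2).
Proof. by have := lax_s F; rewrite !strict_wl ?cod_tpi ?cod_ts. Qed.

Lemma strict_TT : (tT Y \wl lax_cell F) \v (lax_cell F \wr tT X) =
    idt (F \c (tT X \c tT X)).
Proof.
by rewrite !strictP !hcmp_idt !comp1A -(strict_ob (strictP F)) cmp_idl' //
  cod_idt.
Qed.

Lemma strict_l : F \wl tl X = tl Y \wr F.
Proof.
have eT := strict_ob (strictP F).
have := lax_l F; rewrite [in RHS]cmpA; try by dc.
by rewrite strict_TT strictP cmp_idr' ?cmp_idl' //; dc; rewrite eT -!comp1A eT.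
Qed.

Lemma strict_c : F \wl tc X = tc Y \wr F.
Proof.
have eT := strict_ob (strictP F).
have := lax_c F; rewrite [in RHS]cmpA; try by dc.
rewrite strict_TT cmp_idr' ?cmp_idl' //; dc; by rewrite eT -!comp1A eT.
Qed.
End StrictFacts.

(** * 2-pullbacks in K with strict projections are 2-pullbacks in [Tng K] *)

Section TngPullback.
Context (K : two_category) (V X : tangentad K) (U : strict_morphism V X).
Context (m : nat) (P : tangentad K) (pr : 'I_m.+1 -> strict_morphism P V).
Context (pbK : is_nfold_2pullback (lax_ob U) (fun i => lax_ob (pr i))).

Lemma pb_ob_inj (Y : K) (g g' : ob (Hom Y P)) : (forall i, pr i \c g =
  pr i \c g') -> g = g'.
Proof.
move=> e; have [e1 u1 _] := pbK.
have [|h [_ uh]] := u1 Y (fun i => pr i \c g').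
  by move=> i j; rewrite !comp1A (e1 i j).
by rewrite -(uh g e) -(uh g').
Qed.

Lemma pb_arr_inj (Y : K) (a a' : arr (Hom Y P)) : (forall i, pr i \wl a =
  pr i \wl a') -> a = a'.
Proof.
move=> e; have [e1 _ u2] := pbK.
have [|h [_ uh]] := u2 Y (fun i => pr i \wl a').
  by move=> i j; rewrite !wl_wl (e1 i j).
by rewrite -(uh a e) -(uh a').
Qed.

Lemma pb_arrow (Y : K) (a : arr (Hom Y P)) g h :
  (forall i, arrow (pr i \wl a) (pr i \c g) (pr i \c h)) -> arrow a g h.
Proof.
move=> H; split; apply: pb_ob_inj => i; have := H i.
- by move=> [<- _]; rewrite dom_hcmp dom_idt.
- by move=> [_ <-]; rewrite cod_hcmp cod_idt.
Qed.

Section LaxLift.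
Context (Y : tangentad K) (f : 'I_m.+1 -> lax_morphism Y V).
Context (g : ob (Hom (tan_ob Y) (tan_ob P))) (ga : arr (Hom (tan_ob Y) (tan_ob
  P))).
Context (gf : forall i, pr i \c g = f i) (gaf : forall i, pr i \wl ga =
  lax_cell (f i)).

Lemma lift_arrow : arrow ga (g \c tT Y) (tT P \c g).
Proof.
apply: pb_arrow => i;
  rewrite gaf !comp1A (strict_ob (strictP (pr i))) gf -comp1A gf.
exact: lax_arrow.
Qed.

Lemma dom_ga : dom ga = g \c tT Y. Proof. exact: lift_arrow.1. Qed.
Lemma cod_ga : cod ga = tT P \c g. Proof. exact: lift_arrow.2. Qed.
#[local] Hint Rewrite dom_ga cod_ga : cell.

Lemma pr_wr i (a : arr (Hom (tan_ob P) (tan_ob P))) b : pr i \wl a =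
  b \wr pr i ->
  pr i \wl (a \wr g) = b \wr f i.
Proof. by move=> e; rewrite wl_wr e wr_wr gf. Qed.

Lemma pr_wl i (a : arr (Hom (tan_ob Y) (tan_ob Y))) : pr i \wl (g \wl a) =
  f i \wl a.
Proof. by rewrite wl_wl gf. Qed.

Lemma pr_T i (a : arr (Hom (tan_ob Y) (tan_ob P))) : pr i \wl (tT P \wl a) =
  tT V \wl (pr i \wl a).
Proof. by rewrite !wl_wl (strict_ob (strictP (pr i))). Qed.

Lemma lift_p : (tp P \wr g) \v ga = g \wl tp Y.
Proof.
apply: pb_arr_inj => i; rewrite wl_cmp ?pr_wl; last by dc.
by rewrite (pr_wr (strict_p (pr i))) gaf lax_p.
Qed.

Lemma lift_z : ga \v (g \wl tz Y) = tz P \wr g.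
Proof.
apply: pb_arr_inj => i; rewrite wl_cmp ?pr_wl; last by dc.
by rewrite (pr_wr (strict_z (pr i))) gaf lax_z.
Qed.

Lemma lift_l : (tl P \wr g) \v ga =
  (tT P \wl ga) \v (ga \wr tT Y) \v (g \wl tl Y).
Proof.
apply: pb_arr_inj => i; rewrite !wl_cmp ?pr_wl; try by dc.
by rewrite (pr_wr (strict_l (pr i))) pr_T wl_wr !gaf lax_l.
Qed.

Lemma lift_c : (tc P \wr g) \v (tT P \wl ga) \v (ga \wr tT Y) =
  (tT P \wl ga) \v (ga \wr tT Y) \v (g \wl tc Y).
Proof.
apply: pb_arr_inj => i; rewrite !wl_cmp ?pr_wl; try by dc.
by rewrite (pr_wr (strict_c (pr i))) pr_T wl_wr !gaf lax_c.
Qed.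

(** Strictness of [pr i] does not assert that it carries the chosen T_2 of [P] to that of [V]. The
    two sides are compared through the pairing [ka], from [pr i] after T_2 of [P] to T_2 of [V]
    after [pr i]. *)
Lemma lift_s : ga \v (g \wl ts Y) = (ts P \wr g) \v pair_arr (fun i =>
  @tpi _ _ P 2 i \wr g)
  (ga \v (g \wl tpi Y k1)) (ga \v (g \wl tpi Y k2)).
Proof.
have Aw j : arrow (ga \v (g \wl @tpi _ _ Y 2 j)) (g \c tTn Y 2) (tT P \c g) by
  split; dc.
have ew : (tp P \wr g) \v ga \v (g \wl @tpi _ _ Y 2 k1) =
  (tp P \wr g) \v ga \v (g \wl @tpi _ _ Y 2 k2).
  rewrite !cmpA; try by dc.
  by rewrite lift_p -!wl_cmp ?(p_tpi Y k2) //; dc.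
have [[dm cm] m1 m2] := pair_T2P (Aw k1) (Aw k2) ew.
set w := pair_arr _ _ _ in dm cm m1 m2 *.
apply: pb_arr_inj => i; rewrite wl_cmp ?pr_wl; last by dc.
rewrite gaf lax_s' wl_cmp; last by dc; rewrite cm.
have Ak j : arrow (pr i \wl @tpi _ _ P 2 j) (pr i \c tTn P 2) (tT V \c pr i).
  by split; dc; rewrite (strict_ob (strictP (pr i))).
have ek : (tp V \wr pr i) \v (pr i \wl @tpi _ _ P 2 k1) =
  (tp V \wr pr i) \v (pr i \wl @tpi _ _ P 2 k2).
  rewrite -strict_p -!wl_cmp ?(p_tpi P k2) //; by dc.
have [[dk ck] e1 e2] := pair_T2P (Ak k1) (Ak k2) ek.
have := strict_s (pr i); set ka := pair_arr _ _ _ in dk ck e1 e2 * => es.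
rewrite wl_wr es wr_cmp; last by rewrite ck; dc.
rewrite wr_wr gf -cmpA; last 2 first.
- by rewrite !cod_hcmp cm !cod_idt dom_hcmp dk dom_idt comp1A.
- by rewrite !dom_hcmp cod_hcmp ck dom_ts !dom_idt cod_idt -comp1A gf.
congr (_ \v _).
have dL := dom_lax_pair (f i); have cL := cod_lax_pair (f i).
have kw : cod (pr i \wl w) = dom (ka \wr g).
  by rewrite !cod_hcmp cm !cod_idt dom_hcmp dk dom_idt comp1A.
apply: (pullback_inj (A := f i \c tTn Y 2) (T2_pb V (f i))).
- by split.
- split; first by rewrite dom_cmp // dom_hcmp dm dom_idt comp1A gf.
  by rewrite cod_cmp // cod_hcmp ck cod_idt -comp1A gf.
have H j : (@tpi _ _ V 2 j \wr pr i) \v ka = pr i \wl @tpi _ _ P 2 j ->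
    (@tpi _ _ P 2 j \wr g) \v w = ga \v (g \wl @tpi _ _ Y 2 j) ->
    (@tpi _ _ V 2 j \wr f i) \v lax_pair (f i) =
      (@tpi _ _ V 2 j \wr f i) \v (ka \wr g) \v (pr i \wl w).
  move=> h1 h2; rewrite (lax_pairP (f i)).2.
  have -> : @tpi _ _ V 2 j \wr f i =
    @tpi _ _ V 2 j \wr pr i \wr g by rewrite wr_wr gf.
  rewrite cmpA //; last by rewrite !dom_hcmp cod_hcmp ck dom_tpi !dom_idt
    cod_idt.
  rewrite -wr_cmp; last by rewrite ck dom_hcmp dom_tpi dom_idt.
  rewrite h1 -wl_wr -wl_cmp; last by rewrite cm; dc.
  rewrite h2 wl_cmp; last by dc.
  by rewrite gaf pr_wl.
by apply: ord2P; exact: H.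
Qed.

Definition lift_lax : lax_morphism Y P :=
  LaxMorphism lift_arrow lift_p lift_z lift_s lift_l lift_c.

Lemma lift_laxE i : comp_lax (pr i) lift_lax = f i.
Proof. by apply: lax_eq; rewrite ?strict_lax_comp /= ?gf ?gaf. Qed.
End LaxLift.

(** 1-cells, lax cells and 2-cells are lifted by the 2-pullback in K. Their tangent laws hold
    because cells into [P] agree as soon as all projections agree, and each strict projection turns
    a law into that of the component. *)
Lemma tng_2pullback : @is_nfold_2pullback (Tng K) V X (strict_lax U) m.+1 P
  (fun i => strict_lax (pr i)).
Proof.
have [e1 u1 u2] := pbK.
have laxu (Y : tangentad K) (f : 'I_m.+1 -> lax_morphism Y V) :
    (forall i j, comp_lax U (f i) = comp_lax U (f j)) ->
    exists! g : lax_morphism Y P, forall i, comp_lax (pr i) g = f i.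
  move=> ef.
  have [|g [gf _]] := u1 Y (fun i => lax_ob (f i)).
    by move=> i j; have := congr1 (@lax_ob _ _ _) (ef i j).
  have [|ga [gaf _]] := u2 Y (fun i => lax_cell (f i)).
    by move=> i j; rewrite -!strict_lax_comp (ef i j).
  exists (lift_lax gf gaf); split=> [i|g' g'f]; first exact: lift_laxE.
  apply: lax_eq; first by apply: pb_ob_inj => i /=; rewrite gf -g'f.
  by apply: pb_arr_inj => i /=; rewrite gaf -g'f strict_lax_comp.
split=> [i j|Y f ef|Y a ea].
- apply: lax_eq; first exact: e1.
  by rewrite !strict_lax_comp !strictP !hcmp_idt !comp1A (e1 i j).
- exact: laxu ef.
have [|G [eG uG]] := laxu Y (fun i => tdom (a i)).
  by move=> i j; have := congr1 (fun b : tangent_cell Y X => tdom b) (ea i j).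
have [|H [eH uH]] := laxu Y (fun i => tcod (a i)).
  by move=> i j; have := congr1 (fun b : tangent_cell Y X => tcod b) (ea i j).
have [|b [eb _]] := u2 Y (fun i => tcell (a i)).
  by move=> i j; have := congr1 (fun b : tangent_cell Y X => tcell b) (ea i j).
have Ab : arrow b G H.
  apply: pb_arrow => i; rewrite eb.
  have /= -> := congr1 (@lax_ob _ _ _) (eG i).
  have /= -> := congr1 (@lax_ob _ _ _) (eH i).
  exact: tcell_arrow.
have [db cb] := Ab.
have nat : (tT P \wl b) \v lax_cell G = lax_cell H \v (b \wr tT Y).
  apply: pb_arr_inj => i; rewrite !wl_cmp; try by (dc; rewrite ?db ?cb).
  rewrite pr_T eb wl_wr eb -!strict_lax_comp eG eH.
  exact: tcell_nat.
exists (TangentCell Ab nat); split=> [i|b' b'E].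
  by apply: tcell_eq; rewrite /= ?eG ?eH ?eb.
have tE i := congr1 (fun b : tangent_cell Y V => tcell b) (b'E i).
apply: tcell_eq => /=.
- by apply: uG => i; have := congr1 (fun b : tangent_cell Y V =>
  tdom b) (b'E i).
- by apply: uH => i; have := congr1 (fun b : tangent_cell Y V =>
  tcod b) (b'E i).
- by apply: pb_arr_inj => i; rewrite eb -(tE i).
Qed.
End TngPullback.

(** * The tangent structure on VF_n from its universal family of fields *)

Section Induced.
Context (K : two_category) (X : tangentad K) (n : negatives X) (D :
  vf_construction X).
Local Notation V := (VF D).
Local Notation U := (vfU D).
Local Notation v := (tcell (vfv D)).
Local Notation T := (tT X).
Context (m : nat) (W : nfold_2pullback (lax_ob U) m.+1).
Local Notation P := (apex W).
Local Notation pr := (@proj _ _ _ _ _ W).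

Let R : ob (Hom P X) := U \c pr ord0.
Let w (i : 'I_m.+1) : arr (Hom P X) := v \wr pr i.

Lemma U_pr i : U \c pr i = R.
Proof. by have [e _ _] := projP W; exact: e. Qed.

Lemma w_arrow i : arrow (w i) R (T \c R).
Proof.
have [d c] := vfv_arrow D; rewrite -(U_pr i).
by split; rewrite /w ?dom_hcmp ?cod_hcmp ?d ?c ?dom_idt ?cod_idt ?comp1A.
Qed.

Lemma w_p i : (tp X \wr R) \v w i = idt R.
Proof.
have [_ cv] := vfv_arrow D;
  rewrite -(U_pr i) -wr_wr -wr_cmp ?vfv_p ?hcmp_idt //.
by rewrite cv; dc.
Qed.

Lemma w_surj (Y : K) (M : ob (Hom Y X)) (u : 'I_m.+1 -> arr (Hom Y X)) :
  (forall i, arrow (u i) M (T \c M)) -> (forall i, (tp X \wr M) \v u i =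
    idt M) ->
  exists H : ob (Hom Y P), R \c H = M /\ forall i, w i \wr H = u i.
Proof.
move=> Au pu.
have /choice[h hP] : forall i, exists h : ob (Hom Y V), U \c h = M /\ v \wr h =
  u i.
  by move=> i; apply: VF_surj.
have [_ u1 _] := projP W.
have [|g [gh _]] := u1 Y h; first by move=> i j; rewrite (hP i).1 (hP j).1.
exists g; split; first by rewrite -comp1A gh (hP _).1.
by move=> i; rewrite wr_wr gh (hP i).2.
Qed.

Lemma w_faithful (Y : K) (a a' : arr (Hom Y P)) :
  dom a = dom a' -> cod a = cod a' -> R \wl a = R \wl a' -> a = a'.
Proof.
move=> d c e; have [_ _ u2] := projP W.
have E i : pr i \wl a = pr i \wl a'.
  apply: (@VF_faithful _ _ D); rewrite ?dom_hcmp ?cod_hcmp ?d ?c //.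
  by rewrite !wl_wl U_pr.
have [|b [_ ub]] := u2 Y (fun i => pr i \wl a).
  by move=> i j; rewrite !wl_wl !U_pr.
by rewrite -(ub a) // -(ub a').
Qed.

Lemma w_full (Y : K) (H H' : ob (Hom Y P)) f : arrow f (R \c H) (R \c H') ->
  (forall i, (T \wl f) \v (w i \wr H) = (w i \wr H') \v f) ->
  exists a, arrow a H H' /\ R \wl a = f.
Proof.
move=> Af ef; have [e1 u1 u2] := projP W.
have /choice[a aP] : forall i, exists a,
  arrow a (pr i \c H) (pr i \c H') /\ U \wl a = f.
  move=> i; apply: VF_full; first by rewrite !comp1A U_pr.
  by rewrite -!(wr_wr _ (pr i)); exact: ef.
have [|b [ba _]] := u2 Y a; first by move=> i j; rewrite (aP i).2 (aP j).2.
have ob_inj (g g' : ob (Hom Y P)) : (forall i, pr i \c g = pr i \c g') -> g =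
  g'.
  move=> e; have [|h [_ uh]] := u1 Y (fun i => pr i \c g').
    by move=> i j; rewrite !comp1A !U_pr.
  by rewrite -(uh g e) -(uh g').
exists b; split; last by rewrite -wl_wl ba (aP _).2.
split; apply: ob_inj => i; have [[da ca] _] := aP i.
- by rewrite -da -ba dom_hcmp dom_idt.
- by rewrite -ca -ba cod_hcmp cod_idt.
Qed.

Lemma induced_ex : exists (S : tangent_structure P)
  (q : 'I_m.+1 -> strict_morphism (Tangentad S) V),
  (forall i, lax_ob (q i) = pr i) /\
  @is_nfold_2pullback (Tng K) V X (strict_lax U) m.+1 (Tangentad S)
    (fun i => strict_lax (q i)).
Proof.
have [S [RT wT [Rp Rz] [Rpi Rs] [Rl Rc]]] :=
  classifier_tangent n w_arrow w_p w_surj w_faithful w_full.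
have eU := strict_ob (strictP U).
have [dv cv] := vfv_arrow D.
(* Both sides classify the field [c o T w_i] on [T R], by [wT] on the one hand and [v_T] on the
   other. *)
have prT i : pr i \c tT S = tT V \c pr i.
  apply: (@VF_inj _ _ D); first by rewrite !comp1A U_pr RT eU -comp1A U_pr.
  rewrite -wr_wr wT -[RHS]wr_wr v_T wr_cmp;
    last by rewrite cod_hcmp cv cod_idt; dc.
  by rewrite wr_wr U_pr wl_wr.
have A i (a : arr (Hom P P)) (b : arr (Hom (tan_ob V) V)) (b' : arr (Hom
  (tan_ob X) X)) :
    R \wl a = b' \wr R -> U \wl b = b' \wr U -> pr i \c dom a = dom b \c pr i ->
    pr i \c cod a = cod b \c pr i -> pr i \wl a = b \wr pr i.
  move=> ea eb d c; apply: (@VF_faithful _ _ D).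
  - by rewrite !dom_hcmp !dom_idt.
  - by rewrite !cod_hcmp !cod_idt.
  - by rewrite wl_wl U_pr ea wl_wr eb wr_wr U_pr.
have prTT i : pr i \c tT S \c tT S = tT V \c tT V \c pr i.
  by rewrite prT -comp1A prT comp1A.
have RT2 : R \c tTn S 2 = tTn X 2 \c R.
  by have := congr1 dom (Rpi k1); rewrite !dom_hcmp !dom_tpi !dom_idt.
(* The chosen T_2 are compared by pairings, [a] from [S] to V and [b] from V to X. Their composite
   is an identity ([E]), because [R] carries the projections of [S] exactly to those of X. *)
have s_pres i : pr i \wl ts S = (ts V \wr pr i) \v
    pair_arr (fun j => @tpi _ _ V 2 j \wr pr i) (pr i \wl tpi S k1) (pr i \wl
      tpi S k2).
  have Ax j : arrow (pr i \wl @tpi _ _ S 2 j) (pr i \c tTn S 2) (tT V \c pr i).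
    by split; dc; rewrite prT.
  have ex : (tp V \wr pr i) \v (pr i \wl @tpi _ _ S 2 k1) =
    (tp V \wr pr i) \v (pr i \wl @tpi _ _ S 2 k2).
    have <- : pr i \wl tp S = tp V \wr pr i.
      by apply: (A i _ _ _ Rp (strict_p U)); dc;
        rewrite ?prT ?comp1_idr ?comp1_idl.
    by rewrite -!wl_cmp ?(p_tpi S k2) //; dc.
  have [[dm cm] m1 m2] := pair_T2P (Ax k1) (Ax k2) ex.
  set a := pair_arr _ _ _ in dm cm m1 m2 *.
  have Ak j : arrow (U \wl @tpi _ _ V 2 j) (U \c tTn V 2) (tT X \c U).
    by split; dc; rewrite eU.
  have ek : (tp X \wr U) \v (U \wl @tpi _ _ V 2 k1) =
    (tp X \wr U) \v (U \wl @tpi _ _ V 2 k2).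
    by rewrite -strict_p -!wl_cmp ?(p_tpi V k2) //; dc.
  have [[dk ck] e1 e2] := pair_T2P (Ak k1) (Ak k2) ek.
  have := strict_s U; set b := pair_arr _ _ _ in dk ck e1 e2 * => es.
  have ab : cod (U \wl a) = dom (b \wr pr i).
    by rewrite cod_hcmp cm dom_hcmp dk dom_idt cod_idt comp1A.
  have dR : tTn X 2 \c R =
    dom (U \wl a) by rewrite dom_hcmp dm dom_idt comp1A U_pr RT2.
  have E : (b \wr pr i) \v (U \wl a) = idt (tTn X 2 \c R).
    apply: (pullback_inj (A := tTn X 2 \c R) (T2_pb X R)).
    - split; first by rewrite dom_cmp // -dR.
      by rewrite cod_cmp // cod_hcmp ck cod_idt -comp1A U_pr.
    - by split; rewrite ?dom_idt ?cod_idt.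
    have H j : (@tpi _ _ X 2 j \wr U) \v b = U \wl @tpi _ _ V 2 j ->
        (@tpi _ _ V 2 j \wr pr i) \v a = pr i \wl @tpi _ _ S 2 j ->
        (@tpi _ _ X 2 j \wr R) \v (b \wr pr i) \v (U \wl a) =
        (@tpi _ _ X 2 j \wr R) \v idt (tTn X 2 \c R).
      move=> h1 h2; rewrite [RHS]cmp_idr'; last by dc.
      rewrite -{1}(U_pr i) -wr_wr cmpA //; last first.
        by rewrite cod_hcmp ck !dom_hcmp dom_tpi !dom_idt cod_idt.
      rewrite -wr_cmp; last by rewrite ck dom_hcmp dom_tpi dom_idt.
      rewrite h1 -wl_wr -wl_cmp; last by rewrite cm; dc.
      by rewrite h2 wl_wl U_pr Rpi.
    by apply: ord2P; exact: H.
  apply: (@VF_faithful _ _ D).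
  - rewrite dom_cmp ?dm; first by dc.
    by rewrite cm; dc.
  - rewrite cod_cmp; first by dc; rewrite prT.
    by rewrite cm; dc.
  rewrite wl_wl U_pr Rs wl_cmp; last by rewrite cm; dc.
  rewrite wl_wr es wr_cmp; last by rewrite ck; dc.
  rewrite -cmpA //; last by rewrite cod_hcmp ck !dom_hcmp dom_ts !dom_idt
    cod_idt.
  by rewrite E wr_wr U_pr cmp_idr' //; dc.
have /choice[q qP] : forall i, exists q : strict_morphism (Tangentad S) V,
  lax_ob q = pr i.
  move=> i; apply: (@strict_of_preserves K (Tangentad S) V (pr i)) => /=.
  - exact: prT.
  - by apply: (A i _ _ _ Rp (strict_p U)); dc;
    rewrite ?prT ?comp1_idr ?comp1_idl.
  - by apply: (A i _ _ _ Rz (strict_z U)); dc;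
    rewrite ?prT ?comp1_idr ?comp1_idl.
  - exact: s_pres.
  - by apply: (A i _ _ _ Rl (strict_l U)); dc; rewrite ?prTT ?prT.
  - by apply: (A i _ _ _ Rc (strict_c U)); dc; rewrite ?prTT ?prT.
exists S, q; split=> //.
apply: tng_2pullback; have := projP W; congr is_nfold_2pullback.
by apply: funext => i; rewrite qP.
Qed.
End Induced.

Theorem theorem3p20 (K : two_category)
    (D : forall X : tangentad K, vf_construction X)
    (VFn : forall (X : tangentad K) (m : nat),
       nfold_2pullback (lax_ob (strict_lax (vfU (D X)))) m.+1)
    (X : tangentad K) (n : negatives X) :
  (exists (E : forall m : nat, tangent_structure (apex (VFn X m)))
     (pr : forall m : nat, 'I_m.+1 ->
        strict_morphism (Tangentad (E m)) (VF (D X))),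
     induced_structure (VFn X) E pr) /\
  (forall (E : forall m : nat, tangent_structure (apex (VFn X m)))
     (pr : forall m : nat, 'I_m.+1 ->
        strict_morphism (Tangentad (E m)) (VF (D X))),
     induced_structure (VFn X) E pr ->
     let VF1 := VF (D X) in
     let VF2 := Tangentad (E 1) in
     let U : lax_morphism VF1 X := vfU (D X) in
     let pi1 : lax_morphism VF2 VF1 := pr 1 k1 in
     let pi2 : lax_morphism VF2 VF1 := pr 1 k2 in
     let v := vfv (D X) in
     let v1 := hcmp_tcell v (id_tcell pi1) in
     let v2 := hcmp_tcell v (id_tcell pi2) in
     let O2 := hom_tangent VF2 X in
     exists (zero : strict_morphism X VF1) (plus : strict_morphism VF2 VF1)
       (minus : strict_morphism VF1 VF1) (bracket : strict_morphism VF2 VF1),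
       [/\ corresponds zero (id_lax X) (z_cell X),
           corresponds plus (comp_lax U pi1)
             (vf_add O2 (comp_lax U pi1) v1 v2),
           corresponds minus U (vf_opp (hom_neg n) U v)
         & corresponds bracket (comp_lax U pi1)
             (lie_bracket O2 (hom_neg n) (comp_lax U pi1) v1 v2)] /\
       let q := strict_arr (vfU (D X)) in
       let E2 : ob (strict_tng K) := VF2 in
       let pr2 := fun i : 'I_2 => strict_arr (pr 1 i) in
       is_abelian_group_bundle q E2 pr2
         (strict_arr zero) (strict_arr plus) (strict_arr minus) /\
       is_lie_algebra_bundle q E2 pr2
         (strict_arr zero) (strict_arr plus) (strict_arr bracket)).
Proof.
split; last by move=> E pr; exact: lie_bundle.
pose S m := sval (cid (induced_ex n (VFn X m))).
pose q m := sval (cid (svalP (cid (induced_ex n (VFn X m))))).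
have H m := svalP (cid (svalP (cid (induced_ex n (VFn X m))))).
by exists S, q; split=> [m i|m]; have [h1 h2] := H m; [exact: h1|exact: h2].
Qed.
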